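(* Let $T=T_N\to\infty$ as $N\to\infty$ with $\log T\sim N^{\zeta}$ for some $0<\zeta<1$. Let $\epsilon>0$, $\Delta>0$, $1<r<e^{\Delta}$ be fixed and let $\mu_0>0$ be given. Let $X^n_t\sim{\rm Poisson}(\mu^n_t)$ be independent, $1\le t\le T$, $1\le n\le N$. Consider the sparse likelihood algorithm (defined in the context) with integers $1\le h_1<h_2<\cdots$ and $1\le d_1<d_2<\cdots$, $h_i\ge d_i$, and critical values $c_T$ satisfying $$\tfrac{h_{i+1}}{h_i}\to1\ \text{ and }\ d_i=o(h_i)\ \text{ as }i\to\infty,\qquad \log\Big(\sum_{i=1}^{i_T}\tfrac{h_i}{d_i}\Big)=o(\log T)\ \text{ as }T\to\infty,$$ $$c_T=o(\log T)\ \text{ and }\ c_T-\log\Big(\sum_{i=1}^{i_T}\tfrac{h_i}{d_i}\Big)\to\infty\ \text{ as }T\to\infty,$$ where $i_T=\max\{i:h_i+d_i\le T\}$, and with score parameters $\lambda_1>0$ (fixed) and $\lambda_2=\sqrt{\tfrac{\log T}{\log\log T}}$. Then, as a test of $H_0:\boldsymbol{\mu}\in\Lambda_0$ versus $H_1:\boldsymbol{\mu}\in\Lambda_1(\Delta,V,h)$, it achieves, as $N\to\infty$, $$\sup_{\boldsymbol{\mu}\in\Lambda_0}P_{\boldsymbol{\mu}}(\text{Type I error})+\sup_{\boldsymbol{\mu}\in\Lambda_1(\Delta,V,h)}P_{\boldsymbol{\mu}}(\text{Type II error})\to0$$ under either of the following conditions. (a) $V=o\big(\tfrac{\log T}{\log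 N}\big)$ and $h=(1+\epsilon)I_r^{-1}\big(\tfrac{\log T}{\mu_0V}\big)$. (b) $V\sim N^{1-\beta}$ for some $\tfrac{1-\zeta}{2}<\beta<1-\zeta$ and $h=(1+\epsilon)\rho_r(\beta,\zeta)\big(\tfrac{\log N}{\mu_0}\big)$.
   Context: Model classes. $\boldsymbol{\mu}=(\mu^n_t:1\le t\le T,1\le n\le N)$ is the array of Poisson means and $P_{\boldsymbol{\mu}}$ is the corresponding probability. The set of change-points is $\boldsymbol{\tau}=\{t:\mu^n_t\ne\mu^n_{t+1}\text{ for some }n\}=\{\tau_1<\cdots<\tau_J\}$, $J=\#\boldsymbol{\tau}$, with $\tau_0=0$, $\tau_{J+1}=T$. $V=V_N$ is a positive integer (a number of sequences). Let $$m_{j\Delta}=\#\{n:|\log(\mu^n_{\tau_j+1}/\mu^n_{\tau_j})|\ge\Delta\},\qquad \Lambda=\{\boldsymbol{\mu}:\mu^n_t\ge\mu_0\text{ for all }n\text{ and }t\},\qquad \Lambda_0=\{\boldsymbol{\mu}\in\Lambda:J=0\},$$ $$\Lambda_1(\Delta,V,h)=\{\boldsymbol{\mu}\in\Lambda:\text{there exists }1\le j\le J\text{ such that }\min(\tau_{j+1}-\tau_j,\tau_j-\tau_{j-1})\ge h\text{ and }m_{j\Delta}\ge V\}.$$ A Type I error is concluding $H_1$ when $H_0$ is true; a Type II error is concluding $H_0$ when $H_1$ is true. For $r>1$, $$I_r=r\log\big(\tfrac{2r}{r+1}\big)+\log\big(\tfrac{2}{r+1}\big),\qquad g_r(\omega)=\Big(\tfrac{1+r^{\omega}}{2}\Big)^{1/\omega},$$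 $$\rho_r(\beta,\zeta)=\max_{\frac{1-\zeta}{\beta}<\omega\le2}\Big(\frac{\beta-\omega^{-1}(1-\zeta)}{2g_r(\omega)-1-r}\Big)\quad\text{for }\tfrac{1-\zeta}{2}<\beta<1-\zeta.$$ P-values. For integers $0\le s<t<u\le T$ let $Y^n_{st}=\sum_{v=s+1}^tX^n_v$. When $Y^n_{st}=y^n_{st}$ and $Y^n_{su}=y^n_{su}$, simulate (independently over $n$) $$\psi^n_{stu}\sim{\rm Uniform}\big(P(Y<y^n_{st}),P(Y\le y^n_{st})\big),\qquad Y\sim{\rm Binomial}\big(y^n_{su},\tfrac{t-s}{u-s}\big),$$ and set $p^n_{stu}=2\min(\psi^n_{stu},1-\psi^n_{stu})$, ${\bf p}_{stu}=(p^1_{stu},\ldots,p^N_{stu})$. Scores. For $p\in(0,1]$ let $f_1(p)=\frac{1}{p(2-\log p)^2}-\frac12$, $f_2(p)=\frac1{\sqrt p}-2$, $$\ell_N(p)=\log\Big(1+\tfrac{\lambda_1\log N}{N}f_1(p)+\tfrac{\lambda_2}{\sqrt{N\log N}}f_2(p)\Big),\qquad \ell_N({\bf p})=\sum_{n=1}^N\ell_N(p^n)$$ (well defined for $N$ large), and let $$\ell^{\rm pen}_N({\bf p}_{stu})=\ell_N({\bf p}_{stu})-\log\Big(\tfrac T4\big(\tfrac1{t-s}+\tfrac1{u-t}\big)\Big).$$ Algorithm. For $i\ge1$ and $1\le k\le K_i(T)=\lfloor\frac{T-1}{d_i}\rfloor$ let $s(ik)=\max(0,kd_i-h_i)$, $t(ik)=kd_i$,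 $u(ik)=\min(kd_i+h_i,T)$. The sparse likelihood algorithm, run on the full dataset with critical value $c_T$, declares that there is at least one change-point (concludes $H_1$) if and only if $\ell^{\rm pen}_N({\bf p}_{s(ik),t(ik),u(ik)})\ge c_T$ for some $1\le i\le i_T$ and $1\le k\le K_i(T)$; otherwise it concludes $H_0$. $a_N\sim b_N$ means $a_N/b_N\to1$. *)

(* Defs.v *)
From HB Require Import structures.
From mathcomp Require Import all_boot all_order all_algebra.
From mathcomp Require Import all_classical all_reals all_analysis.

Set Implicit Arguments.
Unset Strict Implicit.
Unset Printing Implicit Defensive.

Import Order.TTheory GRing.Theory Num.Theory.
Import numFieldNormedType.Exports.

Local Open Scope classical_set_scope.
Local Open Scope ring_scope.

(* Sequences are indexed by n : 'I_N and times by naturals t, of which only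
   1 <= t <= T is meaningful; an array is a function 'I_N -> nat -> _. *)

Section change_points.
Context {R : realType} {N : nat}.
Implicit Types (mu : 'I_N -> nat -> R) (T : nat).

(* The change-points tau_1 < ... < tau_J. *)
Definition change_points T mu : seq nat :=
  [seq t <- iota 1 T.-1 | [exists n : 'I_N, mu n t != mu n t.+1]].

Definition num_change T mu : nat := size (change_points T mu).

(* tau 0 = 0, tau (J + 1) = T. *)
Definition tau T mu (j : nat) : nat :=
  nth T (0%N :: rcons (change_points T mu) T) j.

Definition m_change T (Delta : R) mu (j : nat) : nat :=
  #|[set n : 'I_N |
      Delta <= `|ln (mu n (tau T mu j).+1 / mu n (tau T mu j))| ]%SET|.

Definition Lambda T (mu0 : R) : set ('I_N -> nat -> R) :=
  [set mu | forall n t, (1 <= t <= T)%N -> mu0 <= mu n t].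

Definition Lambda0 T (mu0 : R) : set ('I_N -> nat -> R) :=
  [set mu | Lambda T mu0 mu /\ num_change T mu = 0%N].

Definition Lambda1 T (mu0 Delta : R) (V : nat) (h : R) :
    set ('I_N -> nat -> R) :=
  [set mu | Lambda T mu0 mu /\
    exists j : nat,
      [/\ (1 <= j <= num_change T mu)%N,
          h <= (minn (tau T mu j.+1 - tau T mu j)
                     (tau T mu j - tau T mu j.-1))%:R
        & (V <= m_change T Delta mu j)%N]].

End change_points.

Section rates.
Context {R : realType}.
Implicit Types (r w beta zeta : R).

Definition I_ r : R := r * ln (2 * r / (r + 1)) + ln (2 / (r + 1)).

Definition g_ r w : R := ((1 + r `^ w) / 2) `^ w^-1.

(* For r > 1 and (1 - zeta) / 2 < beta < 1 - zeta this supremum is a maximum: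
   the quotient is continuous on the closed interval and vanishes at its
   excluded left end point. *)
Definition rho r beta zeta : R :=
  sup [set (beta - w^-1 * (1 - zeta)) / (2 * g_ r w - 1 - r)
      | w in [set w | (1 - zeta) / beta < w <= 2]].

End rates.

Section scores.
Context {R : realType}.

Definition f1 (p : R) : R := (p * (2 - ln p) ^+ 2)^-1 - 2^-1.

Definition f2 (p : R) : R := (Num.sqrt p)^-1 - 2.

Definition ell (N : nat) (lambda1 lambda2 p : R) : R :=
  ln (1 + lambda1 * ln N%:R / N%:R * f1 p
        + lambda2 / Num.sqrt (N%:R * ln N%:R) * f2 p).

Definition ell_sum (N : nat) (lambda1 lambda2 : R) (p : 'I_N -> R) : R :=
  \sum_(n < N) ell N lambda1 lambda2 (p n).

Definition ell_pen (N T s t u : nat) (lambda1 lambda2 : R)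
    (p : 'I_N -> R) : R :=
  ell_sum lambda1 lambda2 p
  - ln (T%:R / 4 * ((t - s)%:R^-1 + (u - t)%:R^-1)).

End scores.

Section randomized_p_values.
Context {R : realType}.

Definition partial_sum (x : nat -> nat) (s t : nat) : nat :=
  \sum_(s.+1 <= v < t.+1) x v.

(* For Y ~ Binomial(Y_su, (t - s) / (u - s)), the end points P(Y < Y_st) and
   P(Y <= Y_st) of the range of the uniform variable psi_stu of the sequence x. *)
Definition psi_lo (x : nat -> nat) (s t u : nat) : R :=
  fine (binomial_prob (partial_sum x s u) ((t - s)%:R / (u - s)%:R)
          [set y | (y < partial_sum x s t)%N]).

Definition psi_hi (x : nat -> nat) (s t u : nat) : R :=
  fine (binomial_prob (partial_sum x s u) ((t - s)%:R / (u - s)%:R)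
          [set y | (y <= partial_sum x s t)%N]).

Lemma psi_lo_lt_hi (x : nat -> nat) (s t u : nat) :
  (s < t)%N -> (t < u)%N -> psi_lo x s t u < psi_hi x s t u.
Proof.
move=> st tu; rewrite /psi_lo /psi_hi.
set m := partial_sum x s u; set y := partial_sum x s t; set p := _ / _.
have su : (s < u)%N := ltn_trans st tu.
have ym : (y <= m)%N.
  by rewrite /m /partial_sum (@big_cat_nat _ _ _ t.+1) ?leq_addr// ltnW.
have us0 : 0 < (u - s)%:R :> R by rewrite ltr0n subn_gt0.
have p0 : 0 < p by rewrite divr_gt0// ltr0n subn_gt0.
have p1 : p < 1 by rewrite ltr_pdivrMr// mul1r ltr_nat ltn_sub2r.
have -> : [set k | (k <= y)%N] = [set k | (k < y)%N] `|` [set y].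
  apply/seteqP; split => k /=.
    by rewrite leq_eqVlt => /orP[/eqP ->|]; [right|left].
  by move=> [/ltnW|->].
rewrite measureU//; last first.
  by apply/seteqP; split => k //= [/[swap] ->]; rewrite ltnn.
rewrite fineD ?fin_num_measure// ltrDl.
have p01 : 0 <= p <= 1 by rewrite !ltW.
rewrite [X in fine X](_ : _ = (binomial_pmf m p y)%:E) /=; last first.
  by rewrite /= /binomial_prob p01 esum_set1 ?lee_fin ?binomial_pmf_ge0.
rewrite /binomial_pmf pmulrn_lgt0 ?bin_gt0//.
by rewrite mulr_gt0// exprn_gt0// subr_gt0.
Qed.

Definition p_value (psi : R) : R := 2 * Num.min psi (1 - psi).

End randomized_p_values.

Section model.
Context d {Omega : measurableType d} {R : realType} (N T : nat).

(* Taking B i = setT for the other indices gives the product rule for every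
   subfamily. *)
Definition mutually_independent (P : probability Omega R) (I : finType)
    dS (S : measurableType dS) (Z : I -> Omega -> S) : Prop :=
  forall B : I -> set S, (forall i, measurable (B i)) ->
    P (\bigcap_i (Z i @^-1` B i)) = (\prod_(i : I) P (Z i @^-1` B i))%E.

Definition poisson_data (P : probability Omega R) (mu : 'I_N -> nat -> R)
    (X : 'I_N -> nat -> {mfun Omega >-> nat}) : Prop :=
  (forall n t k, (1 <= t <= T)%N ->
    P (X n t @^-1` [set k]) = (poisson_pmf (mu n t) k)%:E) /\
  mutually_independent P (fun q : 'I_N * 'I_T => X q.1 q.2.+1 : Omega -> nat).

(* For every window (s, t, u], conditionally on the data X = x, the variables
   psi^1_stu, ..., psi^N_stu are independent and psi^n_stu is uniform on
   (psi_lo, psi_hi).  The joint behaviour of the psi's attached to different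
   windows is left unspecified. *)
Definition randomized (P : probability Omega R)
    (X : 'I_N -> nat -> {mfun Omega >-> nat})
    (psi : 'I_N -> nat -> nat -> nat -> {mfun Omega >-> R}) : Prop :=
  forall s t u (st : (s < t)%N) (tu : (t < u)%N), (u <= T)%N ->
  forall (x : 'I_N -> nat -> nat) (B : 'I_N -> set R),
    (forall n, measurable (B n)) ->
    let data := [set w | forall n v, (1 <= v <= T)%N -> X n v w = x n v] in
    P (data `&` [set w | forall n, B n (psi n s t u w)]) =
    (P data * \prod_(n < N) uniform_prob (@psi_lo_lt_hi R (x n) s t u st tu)
                              (B n))%E.

Definition poisson_model
    (P : ('I_N -> nat -> R) -> probability Omega R)
    (X : 'I_N -> nat -> {mfun Omega >-> nat})
    (psi : 'I_N -> nat -> nat -> nat -> {mfun Omega >-> R}) : Prop :=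
  forall mu : 'I_N -> nat -> R,
    (forall n t, (1 <= t <= T)%N -> 0 < mu n t) ->
    poisson_data (P mu) mu X /\ randomized (P mu) X psi.

End model.

Section algorithm.
Context {R : realType}.
(* The sequences of window half-widths h_i and grid spacings d_i, i >= 1. *)
Variables hs ds : nat -> nat.

(* max {i >= 1 : h_i + d_i <= T}, and 0 if there is none; the bound i <= T is
   no restriction since i <= h_i. *)
Definition i_max (T : nat) : nat :=
  \max_(1 <= i < T.+1 | (hs i + ds i <= T)%N) i.

Definition window_sum (T : nat) : R :=
  \sum_(1 <= i < (i_max T).+1) (hs i)%:R / (ds i)%:R.

Definition grid_size (T i : nat) : nat := ((T - 1) %/ ds i)%N.

(* Truncated subtraction: s(ik) = max(0, k d_i - h_i). *)
Definition s_ (i k : nat) : nat := (k * ds i - hs i)%N.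
Definition t_ (i k : nat) : nat := (k * ds i)%N.
Definition u_ (T i k : nat) : nat := minn (k * ds i + hs i) T.

Definition declares_change {Omega : Type} (N T : nat) (lambda1 lambda2 c : R)
    (psi : 'I_N -> nat -> nat -> nat -> Omega -> R) : set Omega :=
  [set w | exists i k : nat,
    [/\ (1 <= i <= i_max T)%N, (1 <= k <= grid_size T i)%N
      & c <= ell_pen T (s_ i k) (t_ i k) (u_ T i k) lambda1 lambda2
               (fun n => p_value
                  (psi n (s_ i k) (t_ i k) (u_ T i k) w))]].

End algorithm.

Definition sim_to {R : realType} (a b : nat -> R) : Prop :=
  a N / b N @[N --> \oo] --> (1 : R).

(* Main.v *)
Require Import Defs.
From HB Require Import structures.
From mathcomp Require Import all_boot all_order all_algebra finmap.
From mathcomp Require Import all_classical all_reals all_analysis.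
From mathcomp Require Import measurable_realfun.
From mathcomp Require Import ring lra zify.

Set Implicit Arguments.
Unset Strict Implicit.
Unset Printing Implicit Defensive.

Import Order.TTheory GRing.Theory Num.Theory.
Import numFieldNormedType.Exports.

Local Open Scope classical_set_scope.
Local Open Scope ring_scope.

(** The score of a p-value is the logarithm of the mixture likelihood ratio
    [like a b p = 1 + a * f1 p + b * f2 p], where [a = lambda1 log N / N] and
    [b = lambda2 / sqrt (N log N)].  As [f1] and [f2] integrate to [0] over the
    unit interval, [like a b] is a probability density there, and both errors
    are controlled by means of powers of it.  Given the data, the variable
    [psi] of a window is uniform on an interval that depends on two counts
    only, and these are independent Poisson variables.  [window_markov]
    therefore bounds the tail of a product of functions of the [psi n] by a
    product of sums over two Poisson counts.  Its factor [2] is the price of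
    replacing the functions by simple ones.

    Type I error.  In the absence of a change the intervals of [psi], for a
    given total count, tile the unit interval with their binomial weights, so
    that [like] has mean [1] in every sequence.  By Markov's inequality, and
    by the choice of the penalty, a window of half-width [h_i] exceeds [c] with
    a probability of [4 exp (- c) h_i / T] at most ([null_window]).  Scale [i]
    has at most [T / d_i] windows, and the union bound is [4 exp (- c)] times
    the sum of the [h_i / d_i], which vanishes ([type_I_bound]).

    Type II error.  Some scale has a half-width just below [h], and its grid
    has a point close to the change-point; the two halves of this window have
    means with a ratio of [r] at least in all sequences with a large change
    ([select_window]).  The penalty is at most [log T], so it remains to bound
    the chance that the sum of the scores is at most [c + log T = O(log T)].
    The bound is Chernoff's, with a negative exponent [- th] ([alt_window]).
    Whatever its means, a sequence has a p-value that is stochastically smaller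
    than a uniform one, because the likelihood ratio of its two counts, made
    symmetric, and the mean of an increasing function of the p-value are
    oppositely ordered ([alt_cell_mean_le]).  A sequence without a large change
    thus costs a factor of [1 + th (a + 16 b^2 log (1 + 1 / b))] at most, and
    [N] such factors cost [exp (o (log T))] only ([near_null_cost]).  The [V]
    sequences with a large change have to outweigh [exp (th log T)].

    If [V = o (log T / log N)], the tail of the p-value matters.  Counts close
    to their means give a p-value of [exp (- I_r L)] up to a small share of the
    exponent, where [L] is the smaller of the two means, hence through [f1] a
    score larger than [log T / V] by a fixed share.  With [th] of order
    [l V / log T] every such sequence contributes a factor of [3 exp (- l)],
    and [l] is arbitrarily large ([near_signal_share]).

    If [V] is of order [N ^ (1 - beta)], it takes only a small chance
    [N ^ - E] of a gain in every sequence, with [E < 1 - beta - zeta], since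
    [V N ^ - E] then exceeds [log T], which is of order [N ^ zeta].  The gain
    comes through [f2] from atypical counts [al * L] and [be * L].  The chance
    of such counts falls as they move apart, while the score they bring
    rises, and [rho_r] is the ratio [L / log N] beyond which the best
    compromise succeeds ([rate_choice], [near_moderate_factor]). *)

(** * Poisson and binomial weights *)

Section poisson_weights.
Context {R : realType}.
Implicit Types (a b z : R) (k M : nat).

Definition pois a k : R := a ^+ k / k`!%:R * expR (- a).

Lemma pois_pmf a k : 0 < a -> poisson_pmf a k = pois a k.
Proof. by move=> a0; rewrite /poisson_pmf a0. Qed.

Lemma pois_ge0 a k : 0 <= a -> 0 <= pois a k.
Proof. by move=> a0; rewrite !mulr_ge0 ?exprn_ge0 ?invr_ge0 ?expR_ge0. Qed.

Lemma pois0 k : pois 0 k = (k == 0)%:R.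
Proof.
rewrite /pois oppr0 expR0 mulr1 expr0n; case: k => [|k] /=.
  by rewrite fact0 divr1.
by rewrite mul0r.
Qed.

Lemma sum_exp_coeff_le a M : 0 <= a ->
  \sum_(0 <= k < M) a ^+ k / k`!%:R <= expR a.
Proof.
move=> a0; have h := @is_cvg_series_exp_coeff R a.
apply: (nondecreasing_cvgn_le _ h M).
apply/nondecreasing_seqP => n; rewrite /series /= big_nat_recr//= lerDl.
exact: exp_coeff_ge0.
Qed.

Lemma sum_pois_tilt a z M : 0 <= a -> 0 <= z ->
  \sum_(0 <= k < M) pois a k * z ^+ k <= expR (a * (z - 1)).
Proof.
move=> a0 z0.
have -> : expR (a * (z - 1)) = expR (a * z) * expR (- a).
  by rewrite -expRD; congr expR; ring.
rewrite (eq_bigr (fun k => (a * z) ^+ k / k`!%:R * expR (- a))); last first.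
  by move=> k _; rewrite /pois exprMn; ring.
by rewrite -mulr_suml ler_wpM2r ?expR_ge0 ?sum_exp_coeff_le ?mulr_ge0.
Qed.

Lemma sum_pois_le1 a M : 0 <= a -> \sum_(0 <= k < M) pois a k <= 1.
Proof.
move=> a0; have := @sum_pois_tilt a 1 M a0 ler01.
rewrite subrr mulr0 expR0; apply: le_trans.
by apply: ler_sum => k _; rewrite expr1n mulr1.
Qed.

Lemma pois_conv a b n :
  pois (a + b) n = \sum_(k < n.+1) pois a k * pois b (n - k).
Proof.
rewrite /pois [a + b]addrC exprDn opprD expRD mulr_suml mulr_suml.
apply: eq_bigr => i _; have le_in : (i <= n)%N by rewrite -ltnS.
have /(congr1 (fun m : nat => m%:R : R)) := bin_fact le_in; rewrite !natrM => <-.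
rewrite -mulr_natl; field.
by rewrite !pnatr_eq0 -!lt0n !fact_gt0 bin_gt0.
Qed.

Definition binw m q y : R := 'C(m, y)%:R * q ^+ y * (1 - q) ^+ (m - y).

Lemma binw_pmf m q y : binomial_pmf m q y = binw m q y.
Proof. by rewrite /binomial_pmf /binw /unstable.onem -mulr_natl mulrA. Qed.

Lemma binw_ge0 m q y : 0 <= q <= 1 -> 0 <= binw m q y.
Proof.
by case/andP=> q0 q1; rewrite !mulr_ge0 ?exprn_ge0 ?subr_ge0.
Qed.

Lemma binw_gt0 m q y : 0 < q < 1 -> (y <= m)%N -> 0 < binw m q y.
Proof.
case/andP=> q0 q1 ym.
by rewrite !mulr_gt0 ?exprn_gt0 ?subr_gt0 ?ltr0n ?bin_gt0.
Qed.

Lemma sum_binw m q : \sum_(y < m.+1) binw m q y = 1.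
Proof.
have := exprDn (1 - q) q m; rewrite subrK expr1n => ->.
by apply: eq_bigr => i _; rewrite /binw -mulr_natl; ring.
Qed.

(** Given the total of two independent Poisson counts, the first one is
    binomial. *)
Lemma pois_split a b m y : 0 < a -> 0 < b -> (y <= m)%N ->
  pois a y * pois b (m - y) = pois (a + b) m * binw m (a / (a + b)) y.
Proof.
move=> a0 b0 ym; have ab0 : a + b != 0 by rewrite gt_eqF// addr_gt0.
have e : 1 - a / (a + b) = b / (a + b) by field.
rewrite /binw e /pois opprD expRD !expr_div_n.
have /(congr1 (fun m : nat => m%:R : R)) := bin_fact ym; rewrite !natrM => <-.
have -> : (a + b) ^+ m = (a + b) ^+ y * (a + b) ^+ (m - y).
  by rewrite -exprD subnKC.
have h k : k`!%:R != 0 :> R by rewrite pnatr_eq0 -lt0n fact_gt0.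
have hC : 'C(m, y)%:R != 0 :> R by rewrite pnatr_eq0 -lt0n bin_gt0.
field.
by rewrite !h hC !expf_neq0.
Qed.

(** Truncating the counts below [M] only lowers the weight of each value of
    the sum of independent counts. *)
Lemma coef_prod_pois (I : Type) (s : seq I) (J : pred I) (rate : I -> R) M (z' : nat) :
  (forall i, 0 <= rate i) ->
  0 <= (\prod_(i <- s | J i) \poly_(k < M) pois (rate i) k)`_z'
    <= pois (\sum_(i <- s | J i) rate i) z'.
Proof.
move=> r0; suff: 0 <= \sum_(i <- s | J i) rate i /\
  forall z : nat, 0 <= (\prod_(i <- s | J i) \poly_(k < M) pois (rate i) k)`_z
    <= pois (\sum_(i <- s | J i) rate i) z by case.
apply: (big_ind2 (fun (p : {poly R}) A =>
  0 <= A /\ forall z : nat, 0 <= p`_z <= pois A z)).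
- split=> // z; rewrite coef1 pois0.
  by rewrite ler0n /=.
- move=> p A q B [A0 pA] [B0 qB]; split; first exact: addr_ge0.
  move=> z; rewrite coefM pois_conv; apply/andP; split.
    apply: sumr_ge0 => i _; case/andP: (pA i) => ? _.
    by case/andP: (qB (z - i)%N) => ? _; rewrite mulr_ge0.
  apply: ler_sum => i _; case/andP: (pA i) => ? ?.
  by case/andP: (qB (z - i)%N) => ? ?; rewrite ler_pM.
- move=> i _; split=> // z; rewrite coef_poly; case: ifP => _.
    by rewrite pois_ge0//=.
  by rewrite lexx pois_ge0.
Qed.

(** The sums over two disjoint blocks of independent Poisson counts carry at
    most the weight of two independent Poisson counts.  The joint generating
    polynomial of the truncated counts is a product in two variables, one
    for each block, and its coefficients are the weights sought. *)
Lemma sum_pois_blocks (I : finType) (J1 J2 : pred I) (rate : I -> R)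
    (u : nat -> nat -> R) M K :
  (forall i, 0 <= rate i) -> (forall i, J1 i -> ~~ J2 i) ->
  (forall y1 y2, 0 <= u y1 y2) -> (#|I| * M < K)%N ->
  \sum_(x : {ffun I -> 'I_M}) (\prod_i pois (rate i) (x i)) *
     u (\sum_(i | J1 i) x i)%N (\sum_(i | J2 i) x i)%N
  <= \sum_(0 <= y1 < K) \sum_(0 <= y2 < K)
       pois (\sum_(i | J1 i) rate i) y1 * pois (\sum_(i | J2 i) rate i) y2
       * u y1 y2.
Proof.
move=> r0 J12 u0 MK.
pose A := \sum_(i | J1 i) rate i; pose B := \sum_(i | J2 i) rate i.
pose q i : {poly R} := \poly_(k < M) pois (rate i) k.
pose g i : {poly {poly R}} :=
  if J1 i then ('X)%:P else if J2 i then 'X else 1.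
pose Q i := \sum_(k < M) (pois (rate i) k)%:P%:P * g i ^+ k.
pose s1 (x : {ffun I -> 'I_M}) := (\sum_(i | J1 i) x i)%N.
pose s2 (x : {ffun I -> 'I_M}) := (\sum_(i | J2 i) x i)%N.
have QE1 : \prod_i Q i = \sum_(x : {ffun I -> 'I_M})
    (\prod_i pois (rate i) (x i))%:P%:P * ('X^(s1 x))%:P * 'X^(s2 x).
  rewrite bigA_distr_bigA; apply: eq_bigr => x _.
  rewrite big_split /= -mulrA; congr (_ * _).
    by rewrite !rmorph_prod.
  rewrite (bigID J1)/=; congr (_ * _).
    rewrite /s1 -prodrXr rmorph_prod; apply: eq_bigr => i Ji.
    by rewrite /g Ji rmorphXn.
  rewrite (bigID J2)/= [X in _ * X]big1 ?mulr1; last first.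
    by move=> i /andP[/negbTE a /negbTE b]; rewrite /g a b expr1n.
  rewrite /s2 -prodrXr; apply: eq_big => i.
    by case: (boolP (J1 i)) => [/J12/negbTE ->|].
  by case/andP=> /negbTE a b; rewrite /g a b.
pose c := \prod_(i | ~~ J1 i && ~~ J2 i) (\sum_(k < M) pois (rate i) k).
have QE2 : \prod_i Q i = (\prod_(i | J1 i) q i)%:P *
   map_poly polyC (\prod_(i | J2 i) q i) * c%:P%:P.
  rewrite (bigID J1)/= -mulrA; congr (_ * _).
    rewrite rmorph_prod; apply: eq_bigr => i Ji.
    rewrite /Q /q /g Ji poly_def rmorph_sum; apply: eq_bigr => k _.
    by rewrite -mul_polyC [RHS]polyCM polyC_exp.
  rewrite (bigID J2)/=; congr (_ * _).
    rewrite rmorph_prod; apply: eq_big => i.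
      by case: (boolP (J1 i)) => [/J12/negbTE ->|].
    case/andP=> /negbTE J1i Ji.
    rewrite /Q /q /g J1i Ji poly_def rmorph_sum; apply: eq_bigr => k _.
    by rewrite /= map_polyZ /= map_polyXn -mul_polyC.
  rewrite !rmorph_prod; apply: eq_bigr => i /andP[/negbTE a /negbTE b].
  rewrite /Q /g a b !rmorph_sum; apply: eq_bigr => k _.
  by rewrite expr1n mulr1.
pose W y1 y2 := ((\prod_i Q i)`_y2)`_y1.
have WE1 y1 y2 : W y1 y2 = \sum_(x : {ffun I -> 'I_M})
    (\prod_i pois (rate i) (x i)) * ((s1 x == y1) && (s2 x == y2))%:R.
  rewrite /W QE1 coef_sum coef_sum; apply: eq_bigr => x _.
  rewrite -polyCM coefCM coefXn -mulrA coefCM.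
  case: (eqVneq y2 (s2 x)) => _; last by rewrite andbF mulr0 coef0 !mulr0.
  by rewrite mulr1 coefXn andbT eq_sym.
have c1 : 0 <= c <= 1.
  apply/andP; split; first by apply: prodr_ge0 => i _;
    apply: sumr_ge0 => k _; apply: pois_ge0.
  apply: prodr_ile1 => i _; rewrite sumr_ge0/=; last first.
    by move=> k _; apply: pois_ge0.
  by rewrite -(big_mkord xpredT (fun k => pois (rate i) k)) sum_pois_le1.
have WE2 y1 y2 : W y1 y2 <= pois A y1 * pois B y2.
  rewrite /W QE2 coefMC coefCM coef_map/= coefMC coefMC.
  have /andP[a1 a2] := @coef_prod_pois I (index_enum I) J1 rate M y1 r0.
  have /andP[b1 b2] := @coef_prod_pois I (index_enum I) J2 rate M y2 r0.
  case/andP: c1 => c0 c1; rewrite -[leRHS]mulr1; apply: ler_pM => //.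
    by rewrite mulr_ge0.
  exact: ler_pM.
have sK (J : pred I) (x : {ffun I -> 'I_M}) : (\sum_(i | J i) x i < K)%N.
  apply: leq_ltn_trans MK; rewrite -sum_nat_const.
  rewrite [leqRHS](bigID J)/= -[leqLHS]addn0 leq_add// leq_sum// => i _.
  exact: ltnW.
apply: (@le_trans _ _
  (\sum_(0 <= y1 < K) \sum_(0 <= y2 < K) W y1 y2 * u y1 y2)); last first.
  by apply: ler_sum => y1 _; apply: ler_sum => y2 _; rewrite ler_wpM2r.
rewrite le_eqVlt; apply/orP; left; apply/eqP.
rewrite !big_mkord; under [RHS]eq_bigr do rewrite big_mkord.
under [RHS]eq_bigr => y1 _ do under eq_bigr => y2 _ do
  rewrite WE1 mulr_suml.
under [RHS]eq_bigr => y1 _ do rewrite exchange_big/=.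
rewrite exchange_big/=; apply: eq_bigr => x _.
rewrite [RHS](bigD1 (Ordinal (sK J1 x)))//= [X in _ = _ + X]big1 ?addr0.
  rewrite [RHS](bigD1 (Ordinal (sK J2 x)))//= [X in _ = _ + X]big1 ?addr0.
    by rewrite !eqxx mulr1.
  move=> y2 ne; have /negbTE -> : s2 x != y2 by apply: contraNneq ne => e;
    apply/eqP/val_inj; rewrite /= -e.
  by rewrite andbF mulr0 mul0r.
move=> y1 ne; rewrite big1// => y2 _.
have /negbTE -> : s1 x != y1 by apply: contraNneq ne => e;
  apply/eqP/val_inj; rewrite /= -e.
by rewrite mulr0 mul0r.
Qed.

End poisson_weights.

(** * Markov's inequality for products, given the data *)

Section conditional_product.
Import HBSimple HBNNSimple.
Context d {Omega : measurableType d} {R : realType} (P : probability Omega R).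

Lemma measure_fin_cover (I : finType) (Q : pred I) (A : set Omega)
    (B : I -> set Omega) (b : I -> R) :
  measurable A -> (forall i, Q i -> measurable (B i)) ->
  (forall w, A w -> exists2 i, Q i & B i w) ->
  (forall i, Q i -> (P (B i) <= (b i)%:E)%E) ->
  (P A <= (\sum_(i | Q i) b i)%:E)%E.
Proof.
move=> mA mB AB Bb.
have [mU PU] : measurable (\big[setU/set0]_(i | Q i) B i) /\
    (P (\big[setU/set0]_(i | Q i) B i) <= (\sum_(i | Q i) b i)%:E)%E.
  apply: (big_ind2 (fun A x => measurable A /\ (P A <= x%:E)%E)).
  - by rewrite measure0.
  - move=> A1 x1 A2 x2 [m1 l1] [m2 l2]; split; first exact: measurableU.
    by rewrite (le_trans (measureU2 _ _ _))// EFinD leeD.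
  - by move=> i Qi; split; [exact: mB|exact: Bb].
apply: (le_trans _ PU); apply: le_measure; rewrite ?inE// => w /AB[i Qi Bi].
by rewrite (bigD1 i)//=; left.
Qed.

Context {N : nat} (Psi : 'I_N -> Omega -> R) (D : set Omega)
  (nu : 'I_N -> probability (measurableTypeR R) R).
Hypotheses (mPsi : forall n, measurable_fun setT (Psi n)) (mD : measurable D).
Hypothesis PsiD : forall B : 'I_N -> set R, (forall n, measurable (B n)) ->
  P (D `&` [set w | forall n, B n (Psi n w)]) =
  (P D * \prod_(n < N) nu n (B n))%E.

Lemma measurable_rect (B : 'I_N -> set R) : (forall n, measurable (B n)) ->
  measurable [set w | forall n, B n (Psi n w)].
Proof.
move=> mB.
rewrite [X in measurable X](_ : _ = \bigcap_(n in [set: 'I_N]) (Psi n @^-1` B n)).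
  apply: fin_bigcap_measurable => // n _.
  by rewrite -[X in measurable X]setTI; apply: mPsi.
by apply/seteqP; split => w /=; [move=> h n _; exact: h|move=> h n; exact: h].
Qed.

Lemma measurable_prod_ge (f : R -> R) (c : R) : measurable_fun setT f ->
  measurable [set w | c <= \prod_(n < N) f (Psi n w)].
Proof.
move=> mf; rewrite [X in measurable X](_ : _ =
  setT `&` (fun w => \prod_(n < N) f (Psi n w)) @^-1` `[c, +oo[%classic).
  apply: measurable_prod => // n _; exact: measurableT_comp.
by rewrite setTI; apply/seteqP; split => w /=; rewrite in_itv/= andbT.
Qed.

(** A simple function takes finitely many values, so the event is a finite union
    of the rectangles on which the conditional law of the [Psi n] is known. *)
Lemma markov_prod_nnsfun (f : {nnsfun (measurableTypeR R) >-> R}) (c : R)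
    (v : 'I_N -> R) : 0 < c ->
  (forall n, (\int[nu n]_x (f x)%:E <= (v n)%:E)%E) ->
  (P (D `&` [set w | (c <= \prod_(n < N) f (Psi n w))%R])
   <= P D * (c^-1 * \prod_n v n)%:E)%E.
Proof.
move=> c0 fv.
pose F := fset_set (range f).
have inF x : f x \in F by rewrite in_fset_set ?inE//; exact: fimfunP.
have mpre (a : R) : measurable (f @^-1` [set a]) by exact: measurable_sfunP.
have mf : measurable_fun (setT : set R) f := measurable_funPT f.
pose pr n a := fine (nu n (f @^-1` [set a])).
have prE n a : nu n (f @^-1` [set a]) = (pr n a)%:E.
  by rewrite fineK ?fin_num_measure.
have pr0 n a : 0 <= pr n a by rewrite fine_ge0.
have F0 (a : F) : 0 <= val a.
  have := valP a; rewrite in_fset_set; last exact: fimfunP.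
  by rewrite inE /= => -[x _ <-].
have sumF n : \sum_(a : F) val a * pr n (val a) <= v n.
  rewrite -lee_fin; apply: le_trans (fv n).
  rewrite integral_nnsfun// patch_setT sintegralET.
  rewrite (fsbigTE F) => [|a aF]; last first.
    rewrite preimage10 ?measure0 ?mule0// => -[x _ fxa].
    by move: aF; rewrite -fxa inF.
  rewrite (big_seq_fsetE _ F xpredT) /= -sumEFin.
  by apply: lee_sum => a _; rewrite EFinM prE.
pose p := fine (P D).
have pE : P D = p%:E by rewrite fineK ?fin_num_measure.
pose rect (x : {ffun 'I_N -> F}) :=
  D `&` [set w | forall n, (f @^-1` [set val (x n)]) (Psi n w)].
have mrect x : measurable (rect x).
  apply: measurableI => //; apply: (@measurable_rect (fun n => f @^-1` [set val (x n)])) => n /=.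
  exact: mpre.
apply: (@le_trans _ _ (\sum_(x : {ffun 'I_N -> F} | c <= \prod_n val (x n))
  p * \prod_n pr n (val (x n)))%:E).
  apply: (@measure_fin_cover _ (fun x : {ffun 'I_N -> F} =>
    c <= \prod_n val (x n)) _ rect) => //.
  - by apply: measurableI => //; apply: measurable_prod_ge; exact mf.
  - move=> w [Dw /= cw].
    exists [ffun n => FSetSub (inF (Psi n w))].
      by under eq_bigr do rewrite ffunE.
    by split => //= n; rewrite ffunE.
  move=> x cx.
  rewrite (@PsiD (fun n => f @^-1` [set val (x n)])); last first.
    by move=> n /=; exact: mpre.
  by rewrite pE EFinM -prodEFin; under eq_bigr do rewrite prE.
rewrite pE -EFinM lee_fin.
have p0 : 0 <= p by rewrite fine_ge0.
rewrite -mulr_sumr ler_wpM2l// ler_pdivlMl//.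
apply: (@le_trans _ _ (\prod_(n < N) \sum_(a : F) val a * pr n (val a))).
  rewrite bigA_distr_bigA/= mulr_sumr.
  apply: (@le_trans _ _ (\sum_(x : {ffun 'I_N -> F} | c <= \prod_n val (x n))
    \prod_n (val (x n) * pr n (val (x n))))).
    apply: ler_sum => x cx; rewrite big_split/= ler_wpM2r//.
    by apply: prodr_ge0.
  rewrite [leRHS](bigID (fun x : {ffun 'I_N -> F} => c <= \prod_n val (x n)))/=.
  rewrite lerDl sumr_ge0// => x _; rewrite prodr_ge0// => n _.
  by apply: mulr_ge0; [exact: F0|exact: pr0].
apply: ler_prod => n _; rewrite sumF sumr_ge0// => a _.
by apply: mulr_ge0; [exact: F0|exact: pr0].
Qed.

(** Markov's inequality for the product of [G (Psi n)], whose conditional mean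
    factorizes.  The factor [2] leaves room for simple functions increasing to
    [G] to reach the level [c / 2]. *)
Lemma markov_prod (G : R -> R) (c : R) (v : 'I_N -> R) : 0 < c ->
  measurable_fun setT G -> (forall x, 0 <= G x) ->
  (forall n, (\int[nu n]_x (G x)%:E <= (v n)%:E)%E) ->
  (P (D `&` [set w | (c <= \prod_(n < N) G (Psi n w))%R])
   <= P D * (2 / c * \prod_n v n)%:E)%E.
Proof.
move=> c0 mG G0 Gv.
have mG' : measurable_fun [set: measurableTypeR R] G := mG.
have mGE : measurable_fun [set: measurableTypeR R] (EFin \o G).
  exact/measurable_EFinP.
pose f := nnsfun_approx measurableT mGE.
have fG (j : nat) x : f j x <= G x.
  by rewrite -lee_fin /f nnsfun_approxE; apply: le_approx => // *;
    rewrite lee_fin.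
have f_cvg x : f j x @[j --> \oo] --> G x.
  have GE0 y : setT y -> (0 <= (EFin \o G) y)%E by rewrite lee_fin.
  have /fine_cvgP[_] := cvg_nnsfun_approx measurableT mGE GE0 (I : setT x).
  exact.
pose E j := D `&` [set w | c / 2 <= \prod_(n < N) f j (Psi n w)].
have mE j : measurable (E j).
  apply: measurableI => //; apply: measurable_prod_ge.
  exact (measurable_funPT (f j)).
have sub : D `&` [set w | (c <= \prod_(n < N) G (Psi n w))%R] `<=`
    \bigcup_j E j.
  move=> w [Dw /= cw].
  have h : \prod_(n < N) f j (Psi n w) @[j --> \oo] -->
           \prod_(n < N) G (Psi n w).
    by apply: cvg_big => //; exact: mul_continuous.
  have /(cvgr_ge _ h)[j _ /(_ j (leqnn j)) /= hj] :
    c / 2 < \prod_(n < N) G (Psi n w).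
    by apply: lt_le_trans cw; rewrite ltr_pdivrMr// ltr_pMr// ltr1n.
  by exists j.
apply: (@le_trans _ _ (P (\bigcup_j E j))).
  apply: le_measure; rewrite ?inE//.
    by apply: measurableI => //; apply: measurable_prod_ge.
  exact: bigcupT_measurable.
have nd : {homo E : i j / (i <= j)%N >-> (i <= j)%O}.
  move=> i j ij; apply/subsetPset => w [Dw /= cw]; split => //=.
  apply: le_trans cw _; apply: ler_prod => n _.
  apply/andP; split; first exact: fun_ge0.
  by have /lefP := nd_nnsfun_approx measurableT mGE ij; apply.
have := @nondecreasing_cvg_mu _ _ _ P E mE (bigcupT_measurable _ mE) nd.
apply: cvge_le; apply: nearW => j /=.
have c20 : 0 < c / 2 by rewrite divr_gt0.
have := @markov_prod_nnsfun (f j) (c / 2) v c20.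
rewrite invf_div; apply => n; apply: le_trans (Gv n).
apply: ge0_le_integral => //=.
- by move=> x _; rewrite lee_fin.
- exact/measurable_EFinP.
- by move=> x _; rewrite lee_fin.
Qed.

End conditional_product.

(** * The statistic of a window as a mean over two Poisson counts *)

Section binomial_cdf.
Context {R : realType}.
Implicit Types (q : R) (m y : nat).

Definition bcdf m q y : R := \sum_(0 <= k < y) binw m q k.

Lemma bcdfS m q y : bcdf m q y.+1 = bcdf m q y + binw m q y.
Proof. by rewrite /bcdf big_nat_recr. Qed.

Lemma bcdf0 m q : bcdf m q 0 = 0.
Proof. by rewrite /bcdf big_nil. Qed.

Lemma bcdf_total m q : bcdf m q m.+1 = 1.
Proof. by rewrite /bcdf big_mkord sum_binw. Qed.

Lemma binomial_prob_lt m q y : 0 <= q <= 1 ->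
  binomial_prob m q [set k | (k < y)%N] = (bcdf m q y)%:E.
Proof.
move=> q01; elim: y => [|y IH].
  rewrite bcdf0 [X in binomial_prob _ _ X](_ : _ = set0) ?measure0//.
  by apply/seteqP; split.
have -> : [set k | (k < y.+1)%N] = [set k | (k < y)%N] `|` [set y].
  apply/seteqP; split => k /=.
    by rewrite ltnS leq_eqVlt => /orP[/eqP ->|]; [right|left].
  by move=> [/ltnW|->].
rewrite measureU//; last first.
  by apply/seteqP; split => k //= [/[swap] ->]; rewrite ltnn.
rewrite [RHS]/= bcdfS EFinD; congr (_ + _)%E; first exact: IH.
by rewrite /= /binomial_prob q01 esum_set1 ?lee_fin ?binomial_pmf_ge0// binw_pmf.
Qed.

End binomial_cdf.

Lemma big_nat_window (S : Type) (idx : S) (op : Monoid.com_law idx)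
    (F : nat -> S) (s t T : nat) : (t <= T)%N ->
  \big[op/idx]_(s.+1 <= v < t.+1) F v =
  \big[op/idx]_(i < T | (s <= i < t)%N) F i.+1.
Proof.
move=> tT; rewrite big_add1/= (big_nat_widen _ _ _ _ _ tT).
rewrite (big_nat_widenl _ _ _ _ _ (leq0n s)) big_mkord.
by apply: eq_bigl => i; rewrite andbC.
Qed.

Section window_markov.
Context {R : realType} {N T : nat} d {Omega : measurableType d}
  (P : probability Omega R) (mu : 'I_N -> nat -> R)
  (X : 'I_N -> nat -> {mfun Omega >-> nat})
  (psi : 'I_N -> nat -> nat -> nat -> {mfun Omega >-> R}).
Hypotheses (mu_gt0 : forall n t, (1 <= t <= T)%N -> 0 < mu n t)
  (data_poisson : poisson_data T P mu X) (psi_rand : randomized T P X psi).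
Variables (s t u : nat).
Hypotheses (st : (s < t)%N) (tu : (t < u)%N) (uT : (u <= T)%N).

Let q : R := (t - s)%:R / (u - s)%:R.

Let q01 : 0 < q < 1.
Proof.
have su : (s < u)%N := ltn_trans st tu.
have us0 : 0 < (u - s)%:R :> R by rewrite ltr0n subn_gt0.
rewrite divr_gt0 ?ltr0n ?subn_gt0//=.
by rewrite ltr_pdivrMr// mul1r ltr_nat ltn_sub2r.
Qed.

Let q01w : 0 <= q <= 1.
Proof. by case/andP: q01 => /ltW -> /ltW ->. Qed.

Let dataset (x : 'I_N -> nat -> nat) : set Omega :=
  [set w | forall n v, (1 <= v <= T)%N -> X n v w = x n v].

Let datasetE x : dataset x =
  \bigcap_(p in [set: 'I_N * 'I_T]) (X p.1 p.2.+1 @^-1` [set x p.1 p.2.+1]).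
Proof.
apply/seteqP; split => w /= h.
  by move=> [n i] _ /=; apply: h; rewrite /= ltn_ord.
move=> n [//|v] /= vT.
exact: (h (n, Ordinal (vT : (v < T)%N))).
Qed.

Let measurable_dataset x : measurable (dataset x).
Proof.
rewrite datasetE; apply: fin_bigcap_measurable => // p _.
exact: measurable_funPTI.
Qed.

Lemma poisson_data_prob x : P (dataset x) =
  (\prod_n \prod_(i < T) pois (mu n i.+1) (x n i.+1))%:E.
Proof.
case: data_poisson => pX iX; rewrite datasetE.
rewrite (iX (fun p : 'I_N * 'I_T => [set x p.1 p.2.+1]))//.
rewrite (eq_bigr (fun p : 'I_N * 'I_T =>
  (poisson_pmf (mu p.1 p.2.+1) (x p.1 p.2.+1))%:E)) => [|p _]; last first.
  by apply: pX; rewrite /= ltn_ord.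
rewrite prodEFin pair_big/=; congr EFin; apply: eq_bigr => p _.
by rewrite pois_pmf// mu_gt0//= ltn_ord.
Qed.

Let y1 (x : nat -> nat) := partial_sum x s t.
Let y2 (x : nat -> nat) := partial_sum x t u.

Let partial_sumD x : partial_sum x s u = (y1 x + y2 x)%N.
Proof.
by rewrite /y1 /y2 /partial_sum (@big_cat_nat _ _ _ t.+1)//= ltnS ltnW.
Qed.

Let psi_loE (x : nat -> nat) :
  psi_lo x s t u = bcdf (y1 x + y2 x) q (y1 x) :> R.
Proof. by rewrite /psi_lo binomial_prob_lt// partial_sumD. Qed.

Let psi_hiE (x : nat -> nat) :
  psi_hi x s t u = bcdf (y1 x + y2 x) q (y1 x).+1 :> R.
Proof.
rewrite /psi_hi partial_sumD -/q.
rewrite [X in binomial_prob _ _ X](_ : _ = [set y | (y < (y1 x).+1)%N])//.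
by rewrite binomial_prob_lt.
Qed.

(** Given the data, [psi] is uniform on an interval of length
    [binw (y1 + y2) q y1], so that [v] bounds the conditional mean of [G] given
    the counts [y1] and [y2] in the two halves of the window.  The remaining
    mean is over these counts, which are independent Poisson variables. *)
Lemma window_markov (G : R -> R) (c : R) (v : 'I_N -> nat -> nat -> R)
    (b : 'I_N -> R) :
  0 < c -> measurable_fun setT G -> (forall x, 0 <= G x) ->
  (forall n y1 y2, 0 <= v n y1 y2) ->
  (forall n y1 y2,
    (\int[lebesgue_measure]_(x in
       `[bcdf (y1 + y2) q y1, bcdf (y1 + y2) q y1.+1]) (G x)%:E
     <= (binw (y1 + y2) q y1 * v n y1 y2)%:E)%E) ->
  (forall n K, \sum_(0 <= y1 < K) \sum_(0 <= y2 < K)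
     pois (\sum_(s.+1 <= r < t.+1) mu n r) y1 *
     pois (\sum_(t.+1 <= r < u.+1) mu n r) y2 * v n y1 y2 <= b n) ->
  (P [set w | (c <= \prod_(n < N) G (psi n s t u w))%R]
    <= (2 / c * \prod_n b n)%:E)%E.
Proof.
move=> c0 mG G0 v0 Gv vb.
pose E := [set w | c <= \prod_(n < N) G (psi n s t u w)].
have mE : measurable E.
  by apply: measurable_prod_ge => // n; exact: measurable_funPT.
have cond x : (P (dataset x `&` E) <= ((\prod_n \prod_(i < T)
    pois (mu n i.+1) (x n i.+1)) *
    (2 / c * \prod_n v n (y1 (x n)) (y2 (x n))))%:E)%E.
  rewrite EFinM -poisson_data_prob.
  apply: (@markov_prod _ _ _ P N (fun n => psi n s t u) (dataset x)
    (fun n => uniform_prob (@psi_lo_lt_hi R (x n) s t u st tu))) => //.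
  - by move=> B mB; exact: (psi_rand st tu uT x mB).
  - move=> n.
    have mGE : measurable_fun [set: measurableTypeR R] (EFin \o G).
      by apply/measurable_EFinP; exact: mG.
    have GE0 z : (0 <= (EFin \o G) z)%E by rewrite lee_fin.
    rewrite (integral_uniform _ mGE GE0).
    have hl : psi_hi (x n) s t u - psi_lo (x n) s t u =
        binw (y1 (x n) + y2 (x n)) q (y1 (x n)).
      by rewrite psi_loE psi_hiE bcdfS addrC addKr.
    have bp : 0 < binw (y1 (x n) + y2 (x n)) q (y1 (x n)).
      by rewrite binw_gt0// leq_addr.
    rewrite hl lee_pdivrMl// -EFinM psi_loE psi_hiE.
    exact: Gv.
(* The counts are truncated below [M] to leave finitely many data sets. *)
pose OM M := [set w | forall p : 'I_N * 'I_T, (X p.1 p.2.+1 w < M)%N].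
have mOM M : measurable (OM M).
  rewrite [X in measurable X](_ : _ =
    \bigcap_(p in [set: 'I_N * 'I_T]) (X p.1 p.2.+1 @^-1` [set k | (k < M)%N])).
    by apply: fin_bigcap_measurable => // p _; exact: measurable_funPTI.
  by apply/seteqP; split => w /= h p; [move=> _; exact: h|exact: h].
have nd : {homo (fun M => E `&` OM M) : i j / (i <= j)%N >-> (i <= j)%O}.
  move=> i j ij; apply/subsetPset => w [Ew /= Ow]; split => // p.
  by apply: leq_trans ij; exact: Ow.
have mEO M : measurable (E `&` OM M) by exact: measurableI.
have EE : \bigcup_M (E `&` OM M) = E.
  apply/seteqP; split => w; first by case=> M _ [].
  move=> Ew; exists (\max_(p : 'I_N * 'I_T) X p.1 p.2.+1 w).+1 => //.
  by split => // p; rewrite /= ltnS; apply: (leq_bigmax p).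
have := @nondecreasing_cvg_mu _ _ _ P _ mEO (bigcupT_measurable _ mEO) nd.
rewrite EE; apply: cvge_le; apply: nearW => M /=.
pose arr (x : {ffun 'I_N -> {ffun 'I_T -> 'I_M}}) n k : nat :=
  if insub k.-1 is Some i then x n i else 0%N.
have arrE x n (i : 'I_T) : arr x n i.+1 = x n i.
  by rewrite /arr /= insubT//= => p; congr (x n _ : nat); apply: val_inj.
pose J1 := [pred i : 'I_T | (s <= i < t)%N].
pose J2 := [pred i : 'I_T | (t <= i < u)%N].
have tT : (t <= T)%N := ltnW (leq_trans tu uT).
have y1E x n : y1 (arr x n) = (\sum_(i | J1 i) x n i)%N.
  rewrite /y1 /partial_sum (big_nat_window _ _ _ tT).
  by apply: eq_bigr => i _; rewrite arrE.
have y2E x n : y2 (arr x n) = (\sum_(i | J2 i) x n i)%N.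
  rewrite /y2 /partial_sum (big_nat_window _ _ _ uT).
  by apply: eq_bigr => i _; rewrite arrE.
pose w (n : 'I_N) (x : {ffun 'I_T -> 'I_M}) :=
  \prod_(i < T) pois (mu n i.+1) (x i) *
  v n (\sum_(i | J1 i) x i)%N (\sum_(i | J2 i) x i)%N.
apply: (@le_trans _ _ (\sum_(x : {ffun 'I_N -> {ffun 'I_T -> 'I_M}})
  (2 / c * \prod_n w n (x n)))%:E).
  apply: (@measure_fin_cover _ _ _ _ _ xpredT _
    (fun x => dataset (arr x) `&` E)) => //.
  - by move=> x _; apply: measurableI.
  - move=> o [Eo Oo]; exists [ffun n => [ffun i : 'I_T => Ordinal (Oo (n, i))]].
      by [].
    split=> // n [//|k] kT /=.
    have := arrE [ffun n => [ffun i : 'I_T => Ordinal (Oo (n, i))]] n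
      (Ordinal (kT : (k < T)%N)).
    by rewrite /= !ffunE => ->.
  - move=> x _; apply: le_trans (cond (arr x)) _; rewrite lee_fin.
    rewrite mulrCA ler_wpM2l ?divr_ge0// ?(ltW c0)// /w -big_split/=.
    rewrite le_eqVlt; apply/orP; left; apply/eqP; apply: eq_bigr => n _.
    by rewrite y1E y2E; under eq_bigr do rewrite arrE.
rewrite lee_fin -mulr_sumr ler_wpM2l ?divr_ge0// ?(ltW c0)//.
rewrite -(bigA_distr_bigA w).
have r0 n (i : 'I_T) : 0 <= mu n i.+1 by rewrite ltW// mu_gt0//= ltn_ord.
apply: ler_prod => n _; apply/andP; split.
  apply: sumr_ge0 => x _; rewrite mulr_ge0// prodr_ge0// => i _.
  exact: pois_ge0.
apply: le_trans (vb n (#|'I_T| * M).+1).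
have J12 i : J1 i -> ~~ J2 i by rewrite /= => /andP[_ a]; rewrite leqNgt a.
have := @sum_pois_blocks R 'I_T J1 J2 (fun i => mu n i.+1) (v n) M
  (#|'I_T| * M).+1 (r0 n) J12 (v0 n) (ltnSn _).
by rewrite (big_nat_window _ _ _ tT) (big_nat_window _ _ _ uT).
Qed.

End window_markov.

(** * Integrals of functions of a two-sided p-value *)

Section integral_bounds.
Context {R : realType}.
Local Notation leb := (@lebesgue_measure R).

Lemma measurable_inv : measurable_fun setT (fun x : R => x^-1).
Proof.
rewrite (_ : (fun x : R => x^-1) = fun x : R => x * (x ^+ 2) `^ (-1)).
  apply: measurable_funM => //.
  apply: (@measurableT_comp _ _ _ _ _ _ (fun y : R => y `^ (-1)) _
    (fun x : R => x ^+ 2)); first exact: measurable_powR.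
  exact: exprn_measurable.
apply/funext => x; rewrite powR_inv1 ?sqr_ge0//.
have [->|x0] := eqVneq x 0; first by rewrite invr0 mul0r.
by field.
Qed.

Lemma measurable_sqrt : measurable_fun setT (fun x : R => Num.sqrt x).
Proof.
by apply: nondecreasing_measurable => // x y; exact: ler_wsqrtr.
Qed.

Lemma measurable_p_value : measurable_fun setT (@p_value R).
Proof.
apply: measurable_funM => //; apply: measurable_minr => //.
exact: measurable_funB.
Qed.

Lemma measurable_ell N (l1 l2 : R) : measurable_fun setT (ell N l1 l2).
Proof.
apply: (measurableT_comp (@measurable_ln R)).
apply: measurable_funD; first apply: measurable_funD => //.
  apply: measurable_funM => //; apply: measurable_funB => //.
  apply: (measurableT_comp measurable_inv); apply: measurable_funM => //.
  apply: measurable_funX; apply: measurable_funB => //.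
apply: measurable_funM => //; apply: measurable_funB => //.
by apply: (measurableT_comp measurable_inv); exact: measurable_sqrt.
Qed.

(** The scores have poles or arbitrary default values at the end points, which
    are avoided by exhausting the open interval by compact ones. *)
Lemma integral_le_inner (G : R -> R) (lo hi C : R) : lo < hi ->
  measurable_fun setT G -> (forall x, 0 <= G x) ->
  (forall a b, lo < a -> a < b -> b < hi ->
     (\int[leb]_(x in `[a, b]) (G x)%:E <= C%:E)%E) ->
  (\int[leb]_(x in `[lo, hi]) (G x)%:E <= C%:E)%E.
Proof.
move=> lohi mG G0 GC.
have mGE (D : set (measurableTypeR R)) : measurable D ->
    measurable_fun D (EFin \o G : measurableTypeR R -> \bar R).
  by move=> mD; apply: measurable_funTS; apply/measurable_EFinP; exact: mG.
rewrite (@integral_itv_bndoo _ _ _ (EFin \o G)); last exact: mGE.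
pose e (n : nat) := (hi - lo) / (n.+3)%:R.
have e0 n : 0 < e n by rewrite divr_gt0// subr_gt0.
have e3 n : e n * 2 < hi - lo.
  rewrite /e mulrAC ltr_pdivrMr// ltr_pM2l ?subr_gt0//.
  by rewrite ltr_nat.
pose F n := (`[lo + e n, hi - e n]%classic : set (measurableTypeR R)).
have -> : (`]lo, hi[%classic : set R) = \bigcup_n F n.
  apply/seteqP; split => x /=; rewrite in_itv/=.
    case/andP=> lx xh.
    have [n hn] : exists n : nat, e n <= Num.min (x - lo) (hi - x).
      have m0 : 0 < Num.min (x - lo) (hi - x) by rewrite lt_min !subr_gt0 lx.
      have := @archi_boundP _ ((hi - lo) / Num.min (x - lo) (hi - x)).
      rewrite divr_ge0 ?(ltW m0)// ?subr_ge0 ?(ltW lohi)// => /(_ isT) hN.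
      exists (Num.bound ((hi - lo) / Num.min (x - lo) (hi - x))).
      rewrite /e ler_pdivrMr// -ler_pdivrMl// mulrC.
      by apply: ltW; apply: lt_le_trans hN _; rewrite ler_nat -addn3 leq_addr.
    exists n => //; rewrite /F/= in_itv/=.
    move: hn; rewrite le_min => /andP[h1 h2]; apply/andP; split; lra.
  case=> n _; rewrite /F /= in_itv/= => /andP[h1 h2].
  by have := e0 n; move=> h; apply/andP; split; lra.
have h := @ge0_nondecreasing_set_cvg_integral _ (measurableTypeR R) R F
  (EFin \o G) leb.
apply: cvge_le (h _ _ _ _) => [|i j ij|i|i|i x _].
- apply: nearW => n; have := e0 n; have := e3 n => h1 h2.
  by apply: GC; lra.
- apply/subsetPset => x; rewrite /F /= !in_itv/= => /andP[h1 h2].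
  have : e j <= e i.
    by rewrite /e ler_pM2l ?subr_gt0// lef_pV2 ?posrE// ler_nat.
  by move=> h3; apply/andP; split; lra.
- exact: measurable_itv.
- by apply: mGE; exact: measurable_itv.
- by rewrite lee_fin.
Qed.

Lemma integral_le_antiderivative (G F g : R -> R) (lo hi C : R) : lo < hi ->
  measurable_fun setT G -> (forall x, 0 <= G x) ->
  (forall x : R, lo < x < hi -> G x <= g x) ->
  (forall x : R, lo < x < hi -> is_derive x 1 F (g x)) ->
  (forall x : R, lo < x < hi -> {for x, continuous g}) ->
  (forall a b, lo < a -> a < b -> b < hi -> F b - F a <= C) ->
  (\int[leb]_(x in `[lo, hi]) (G x)%:E <= C%:E)%E.
Proof.
move=> lohi mG G0 Gg dF cg FC; apply: integral_le_inner => // a b la ab bh.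
have inab x : x \in `[a, b] -> lo < x < hi.
  by rewrite in_itv/= => /andP[? ?]; apply/andP; split; lra.
have cgab : {within `[a, b], continuous g}.
  by apply: continuous_in_subspaceT => x /set_mem xab; apply: cg; exact: inab.
apply: (@le_trans _ _ (\int[leb]_(x in `[a, b]) (g x)%:E)%E).
  apply: ge0_le_integral => //=.
  - by move=> x _; rewrite lee_fin.
  - by apply: measurable_funTS; apply/measurable_EFinP; exact: mG.
  - apply/measurable_EFinP; apply: subspace_continuous_measurable_fun => //.
  - by move=> x xab; rewrite lee_fin Gg// inab.
have cF x : lo < x < hi -> {for x, continuous F}.
  move=> xlh; apply: differentiable_continuous; apply/derivable1_diffP.
  by have := dF x xlh => -[].
rewrite (@continuous_FTC2 _ g F a b ab cgab); last 2 first.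
- split.
  + move=> x xab; have /dF[] // : lo < x < hi.
    by apply: inab; exact: subset_itv_oo_cc xab.
  + by apply: cvg_at_right_filter; apply: cF; apply/andP; split; lra.
  + by apply: cvg_at_left_filter; apply: cF; apply/andP; split; lra.
- move=> x xab; rewrite derive1E.
  have xlh : lo < x < hi by apply: inab; exact: subset_itv_oo_cc xab.
  by have := dF x xlh => h; rewrite derive_val.
by rewrite -EFinB lee_fin; apply: FC.
Qed.

Lemma integral_le_cst (G : R -> R) (g lo hi : R) : lo < hi -> 0 <= g ->
  measurable_fun setT G -> (forall x, 0 <= G x) ->
  (forall x : R, lo < x < hi -> G x <= g) ->
  (\int[leb]_(x in `[lo, hi]) (G x)%:E <= ((hi - lo) * g)%:E)%E.
Proof.
move=> lohi g0 mG G0 Gg.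
apply: (@integral_le_antiderivative G (fun x => g * x) (fun=> g)) => //.
- move=> x _; have h : is_derive x 1 (g \*o @id R) (g *: 1) by exact: is_deriveZ.
  by apply: is_derive_eq h _; rewrite -[LHS]/(g * 1) mulr1.
- by move=> x _; exact: cvg_cst.
- by move=> a b la ab bh; rewrite -mulrBr mulrC ler_wpM2r//; lra.
Qed.

(** An antiderivative of [g (p_value x)]: the two-sided p-value folds the unit
    interval at [1 / 2]. *)
Definition fold_anti (F : R -> R) (x : R) : R :=
  if x <= 2^-1 then F (2 * x) / 2 else F 1 - F (2 * (1 - x)) / 2.

Section fold.
Variables (G F g : R -> R).
Hypotheses (mG : measurable_fun setT G) (G0 : forall x, 0 <= G x)
  (Gg : forall x : R, 0 < x < 1 -> G x <= g (p_value x))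
  (dF : forall x : R, 0 < x < 1 -> is_derive x 1 F (g x))
  (cg : forall x : R, 0 < x < 1 -> {for x, continuous g})
  (ndF : forall x y : R, 0 <= x -> x <= y -> y <= 1 -> F x <= F y).

Let integral_left (lo hi : R) : 0 <= lo -> lo < hi -> hi <= 2^-1 ->
  (\int[leb]_(x in `[lo, hi]) (G x)%:E <= (F (2 * hi) / 2 - F (2 * lo) / 2)%:E)%E.
Proof.
move=> lo0 lohi hi2.
apply: (@integral_le_antiderivative G (fun x => F (2 * x) / 2)
  (fun x => g (2 * x))) => //.
- move=> x /andP[h1 h2]; rewrite (_ : 2 * x = p_value x).
    by apply: Gg; apply/andP; split; lra.
  by rewrite /p_value min_l//; lra.
- move=> x /andP[h1 h2].
  have h2x : is_derive x 1 ( *%R (2 : R)) (2 : R).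
    have h : is_derive x 1 (2 \*o @id R) (2 *: (1 : R)) by exact: is_deriveZ.
    by apply: is_derive_eq h _; rewrite -[LHS]/(2 * 1) mulr1.
  have hF : is_derive x 1 (F \o ( *%R 2)) (g (2 * x) * 2).
    by apply: is_derive1_comp; apply: dF; apply/andP; split; lra.
  have h : is_derive x 1 (2^-1 \*o (F \o ( *%R 2))) (2^-1 *: (g (2 * x) * 2)).
    exact: is_deriveZ.
  rewrite (_ : (fun y => _) = (2^-1 \*o (F \o ( *%R 2)))); last first.
    by apply/funext => y /=; rewrite mulrC.
  by apply: is_derive_eq h _; rewrite -[LHS]/(2^-1 * _); field.
- move=> x /andP[h1 h2].
  have c1 : {for x, continuous ( *%R (2 : R))} by exact: mulrl_continuous.
  have c2 : {for 2 * x, continuous g} by apply: cg; apply/andP; split; lra.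
  exact: (continuous_comp c1 c2).
- move=> a b la ab bh.
  have h1 : F (2 * lo) <= F (2 * a) by apply: ndF; lra.
  have h2 : F (2 * b) <= F (2 * hi) by apply: ndF; lra.
  lra.
Qed.

Let integral_right (lo hi : R) : 2^-1 <= lo -> lo < hi -> hi <= 1 ->
  (\int[leb]_(x in `[lo, hi]) (G x)%:E
   <= (F (2 * (1 - lo)) / 2 - F (2 * (1 - hi)) / 2)%:E)%E.
Proof.
move=> lo2 lohi hi1; pose k (x : R) : R := 2 * (1 - x).
have dk (x : R) : is_derive x 1 k (- 2).
  have h : is_derive x 1 (cst 2 + (- 2) \*o @id R) (0 + (- 2) *: (1 : R)).
    by apply: is_deriveD; exact: is_deriveZ.
  rewrite (_ : k = cst 2 + (- 2) \*o @id R); last first.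
    by apply/funext => y; rewrite /k !fctE /=; ring.
  by apply: is_derive_eq h _; rewrite -[LHS]/(0 + - 2 * 1); ring.
apply: (@integral_le_antiderivative G (fun x => - (F (k x) / 2))
  (fun x => g (k x))) => //.
- move=> x /andP[h1 h2]; rewrite (_ : k x = p_value x).
    by apply: Gg; apply/andP; split; lra.
  by rewrite /p_value min_r// /k; lra.
- move=> x /andP[h1 h2].
  have hF : is_derive x 1 (F \o k) (g (k x) * - 2).
    by apply: is_derive1_comp; apply: dF; apply/andP; rewrite /k; split; lra.
  have h : is_derive x 1 ((- 2^-1) \*o (F \o k)) ((- 2^-1) *: (g (k x) * - 2)).
    exact: is_deriveZ.
  rewrite (_ : (fun y => _) = ((- 2^-1) \*o (F \o k))); last first.
    by apply/funext => y /=; rewrite mulNr mulrC.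
  by apply: is_derive_eq h _; rewrite -[LHS]/(- 2^-1 * _); field.
- move=> x /andP[h1 h2].
  have c1 : {for x, continuous k}.
    apply: differentiable_continuous; apply/derivable1_diffP.
    by have [] := dk x.
  have c2 : {for k x, continuous g}.
    by apply: cg; apply/andP; rewrite /k; split; lra.
  exact: (continuous_comp c1 c2).
- move=> a b la ab bh.
  have h1 : F (k hi) <= F (k b) by apply: ndF; rewrite /k; lra.
  have h2 : F (k a) <= F (k lo) by apply: ndF; rewrite /k; lra.
  by rewrite /k in h1 h2 *; lra.
Qed.

Lemma integral_fold_le (lo hi : R) : 0 <= lo -> lo < hi -> hi <= 1 ->
  (\int[leb]_(x in `[lo, hi]) (G x)%:E
   <= (fold_anti F hi - fold_anti F lo)%:E)%E.
Proof.
move=> lo0 lohi hi1; rewrite /fold_anti.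
have [hi2|hi2] := leP hi 2^-1.
  by rewrite (le_trans (ltW lohi) hi2); apply: integral_left.
have [lo2|lo2] := leP lo 2^-1; last first.
  apply: le_trans (integral_right (ltW lo2) lohi hi1) _.
  by rewrite lee_fin; lra.
have mGE (D : set (measurableTypeR R)) : measurable D ->
    measurable_fun D (EFin \o G : measurableTypeR R -> \bar R).
  by move=> mD; apply: measurable_funTS; apply/measurable_EFinP; exact: mG.
have h1 : F (2 * (1 - 2^-1)) = F 1 by congr F; field.
have h2 : F (2 * 2^-1) = F 1 by congr F; field.
move: lo2; rewrite le_eqVlt => /orP[/eqP lo2|lo2].
  have lo2' : 2^-1 <= lo by rewrite lo2.
  apply: le_trans (integral_right lo2' lohi hi1) _.
  by rewrite lee_fin lo2 h1 h2; lra.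
have -> : (`[lo, hi]%classic : set R) = `[lo, 2^-1]%classic `|` `]2^-1, hi]%classic.
  apply/seteqP; split => x /=; rewrite !in_itv/=.
    move=> /andP[-> ->]; case: (leP x 2^-1) => _; by [left|right].
  by move=> [|] /andP[? ?]; apply/andP; split; lra.
rewrite (@ge0_integral_setU _ (measurableTypeR R) R leb _ _ _ _ (EFin \o G)).
- rewrite (_ : F 1 - _ - _ = (F (2 * 2^-1) / 2 - F (2 * lo) / 2) +
     (F (2 * (1 - 2^-1)) / 2 - F (2 * (1 - hi)) / 2)); last first.
    by rewrite h1 h2; lra.
  rewrite EFinD; apply: leeD; first exact: integral_left.
  rewrite (@integral_itv_bndoo _ _ _ (EFin \o G)); last exact: mGE.
  rewrite -(@integral_itv_bndoo _ _ _ (EFin \o G) true false); last exact: mGE.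
  exact: integral_right.
- exact: measurable_itv.
- exact: measurable_itv.
- by apply: mGE; apply: measurableU; exact: measurable_itv.
- by move=> x _; rewrite lee_fin.
- apply/disj_setPRL => x /=; rewrite !in_itv/= => /andP[h _] /andP[_ h'].
  by move: (lt_le_trans h h'); rewrite ltxx.
Qed.

End fold.
End integral_bounds.

(** * The likelihood ratio and its antiderivative *)

Section derivatives.
Context {R : realType}.
Implicit Types (f g : R -> R) (x a b k : R).

Lemma is_derive_add f g x a b : is_derive x 1 f a -> is_derive x 1 g b ->
  is_derive x 1 (fun y => f y + g y) (a + b).
Proof. exact: is_deriveD. Qed.

Lemma is_derive_opp f x a : is_derive x 1 f a ->
  is_derive x 1 (fun y => - f y) (- a).
Proof. exact: is_deriveN. Qed.

Lemma is_derive_scale k f x a : is_derive x 1 f a ->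
  is_derive x 1 (fun y => k * f y) (k * a).
Proof. exact: is_deriveZ. Qed.

Lemma is_derive_inv f x a : f x != 0 -> is_derive x 1 f a ->
  is_derive x 1 (fun y => (f y)^-1) (- (f x) ^- 2 * a).
Proof. exact: is_deriveV. Qed.

Lemma is_derive_const k x : is_derive x 1 (fun=> k) 0.
Proof. exact: is_derive_cst. Qed.

Lemma is_derive_idR x : is_derive x 1 (fun y => y) 1.
Proof. exact: is_derive_id. Qed.

Lemma is_derive_ln_comp f x a : 0 < f x -> is_derive x 1 f a ->
  is_derive x 1 (fun y => ln (f y)) ((f x)^-1 * a).
Proof.
by move=> fx df; apply: (@is_derive1_comp _ (@ln R) f) => //; exact: is_derive1_ln.
Qed.

Lemma derive_continuous f x a : is_derive x 1 f a -> {for x, continuous f}.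
Proof.
by case=> df _; apply: differentiable_continuous; exact/derivable1_diffP.
Qed.

Lemma mean_value f g a b : a <= b ->
  (forall x, a < x < b -> is_derive x 1 f (g x)) ->
  (forall x, a <= x <= b -> {for x, continuous f}) ->
  exists2 c, a <= c <= b & f b - f a = g c * (b - a).
Proof.
move=> ab df cf.
have df' x : x \in `]a, b[ -> is_derive x 1 f (g x).
  by rewrite in_itv/=; exact: df.
have cf' : {within `[a, b], continuous f}.
  by apply: continuous_in_subspaceT => x /set_mem /=; rewrite in_itv/=; exact: cf.
have [c] := MVT_segment ab df' cf'.
by rewrite in_itv/= => cab e; exists c.
Qed.

End derivatives.

Section score.
Context {R : realType}.
Variables a b : R.
Hypotheses (a0 : 0 <= a) (b0 : 0 <= b) (ab1 : a / 2 + 2 * b < 1).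

Definition like (p : R) : R := 1 + a * f1 p + b * f2 p.

Definition base_score : R := 1 - a / 2 - 2 * b.

(** The first summand of [f1] is nonnegative, so that [f1] costs [a / 2] at
    most; the pole of [f2] is kept. *)
Lemma like_ge p : 0 < p -> base_score + b / Num.sqrt p <= like p.
Proof.
move=> p0; rewrite /like /f1 /f2 /base_score.
have h : 0 <= a * (p * (2 - ln p) ^+ 2)^-1.
  by rewrite mulr_ge0// invr_ge0 mulr_ge0 ?sqr_ge0 ?ltW.
lra.
Qed.

Lemma like_gt0 p : 0 < p -> 0 < like p.
Proof.
move=> p0; apply: lt_le_trans (like_ge p0).
have h : 0 <= b / Num.sqrt p by rewrite divr_ge0 ?sqrtr_ge0.
by rewrite /base_score; move: h ab1; set z := (b / _); move=> *; lra.
Qed.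

Lemma p_value01 (x : R) : 0 < x < 1 -> 0 < p_value x <= 1.
Proof.
move=> /andP[x0 x1]; rewrite /p_value.
by case: (leP x (1 - x)) => h; apply/andP; split; lra.
Qed.

Lemma subln_gt0 (p : R) : p <= 1 -> 0 < 2 - ln p.
Proof. by move=> p1; have := ln_le0 p1; lra. Qed.

(** An antiderivative of [like], vanishing at the pole. *)
Definition like_anti (p : R) : R :=
  if p == 0 then 0
  else p + (a * ((2 - ln p)^-1 + - (2^-1 * p)) + b * (2 * Num.sqrt p + - (2 * p))).

Lemma is_derive_like_anti (p : R) : 0 < p <= 1 ->
  is_derive p 1 like_anti (like p).
Proof.
move=> /andP[p0 p1].
have l0 := subln_gt0 p1.
have h1 : is_derive p 1 (fun p => 2 + - ln p) (0 + - p^-1).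
  exact (is_derive_add (is_derive_const 2 p) (is_derive_opp (is_derive1_ln p0))).
have h2 : is_derive p 1 (fun p => (2 + - ln p)^-1) (- (2 - ln p) ^- 2 * (0 + - p^-1)).
  by apply: (@is_derive_inv _ (fun p => 2 + - ln p)) => //; rewrite gt_eqF.
have id := is_derive_idR p.
have sq := is_derive1_sqrt p0.
have := is_derive_add id (is_derive_add
  (is_derive_scale a (is_derive_add h2 (is_derive_opp (is_derive_scale 2^-1 id))))
  (is_derive_scale b (is_derive_add (is_derive_scale 2 sq)
     (is_derive_opp (is_derive_scale 2 id))))).
move=> h; apply: (@near_eq_is_derive _ _ _ (fun p => p + (a * ((2 - ln p)^-1 +
  - (2^-1 * p)) + b * (2 * Num.sqrt p + - (2 * p))))) => //.
- by near=> y; rewrite /like_anti gt_eqF//; near: y; exact: lt_nbhsr.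
apply: (is_derive_eq h); rewrite /like /f1 /f2.
have s0 : 0 < Num.sqrt p by rewrite sqrtr_gt0.
field.
by rewrite !gt_eqF.
Unshelve. all: by end_near. Qed.

Lemma ln_ge1V (x : R) : 0 < x -> 1 - x^-1 <= ln x.
Proof.
move=> x0; have xV0 : -1 < x^-1 - 1 by rewrite ltrDr invr_gt0.
have := le_ln1Dx xV0; rewrite (_ : 1 + (x^-1 - 1) = x^-1); last by ring.
by rewrite lnV ?posrE//; lra.
Qed.

Lemma like_anti_ge0 (p : R) : 0 <= p <= 1 -> 0 <= like_anti p.
Proof.
move=> /andP[p0 p1]; rewrite /like_anti; case: eqVneq => // pn0.
have {}p0 : 0 < p by rewrite lt_neqAle eq_sym pn0.
have l0 := subln_gt0 p1.
have h1 : 2^-1 * p <= (2 - ln p)^-1.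
  rewrite -[leRHS]mul1r ler_pdivlMr//.
  have h : p * ln p >= p - 1.
    by have := ler_wpM2l (ltW p0) (ln_ge1V p0); rewrite mulrBr mulfV// mulr1.
  lra.
have h2 : p <= Num.sqrt p.
  have s0 := sqrtr_ge0 p; rewrite -{1}(sqr_sqrtr (ltW p0)) expr2 ler_piMr//.
  by rewrite -sqrtr1 ler_wsqrtr.
have h3 := mulr_ge0 a0 (_ : 0 <= (2 - ln p)^-1 + - (2^-1 * p)).
have h4 := mulr_ge0 b0 (_ : 0 <= 2 * Num.sqrt p + - (2 * p)).
by rewrite !addr_ge0 ?(ltW p0)// ?h3 ?h4//; lra.
Qed.

Lemma like_anti_nd (x y : R) : 0 <= x -> x <= y -> y <= 1 ->
  like_anti x <= like_anti y.
Proof.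
rewrite le_eqVlt => /orP[/eqP <- y0 y1|x0 xy y1].
  by rewrite {1}/like_anti eqxx like_anti_ge0// y0.
have dl z : x <= z <= y -> is_derive z 1 like_anti (like z).
  by move=> /andP[xz zy]; apply: is_derive_like_anti; lra.
have [z /andP[xz zy]|z xzy|c /andP[xc cy] e] := @mean_value R like_anti like x y xy.
- by apply: dl; lra.
- exact: derive_continuous (dl z xzy).
by rewrite -subr_ge0 e mulr_ge0 ?subr_ge0// ltW// like_gt0//; lra.
Qed.

Lemma continuous_like (p : R) : 0 < p < 1 -> {for p, continuous like}.
Proof.
move=> /andP[p0 p1]; rewrite /like /f1 /f2.
have l0 := subln_gt0 (ltW p1).
have s0 : 0 < Num.sqrt p by rewrite sqrtr_gt0.
have cl : (fun p : R => 2 - ln p) x @[x --> p] --> 2 - ln p.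
  by apply: cvgB; [exact: cvg_cst|exact: continuous_ln].
apply: cvgD; first apply: cvgD; first exact: cvg_cst.
- apply: cvgM; first exact: cvg_cst.
  apply: cvgB; last exact: cvg_cst.
  apply: cvgV; first by rewrite gt_eqF// mulr_gt0// exprn_gt0.
  apply: cvgM; first exact: cvg_id.
  by rewrite expr2; under eq_fun do rewrite expr2; exact: cvgM.
- apply: cvgM; first exact: cvg_cst.
  apply: cvgB; last exact: cvg_cst.
  by apply: cvgV; [rewrite gt_eqF|exact: sqrt_continuous].
Qed.

Lemma integral_like (G : R -> R) (lo hi : R) : measurable_fun setT G ->
  (forall x, 0 <= G x) -> (forall x, 0 < x < 1 -> G x = like (p_value x)) ->
  0 <= lo -> lo < hi -> hi <= 1 ->
  (\int[lebesgue_measure]_(x in `[lo, hi]) (G x)%:E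
   <= (fold_anti like_anti hi - fold_anti like_anti lo)%:E)%E.
Proof.
move=> mG G0 Gl; apply: (@integral_fold_le _ G like_anti like) => //.
- by move=> x x01; rewrite Gl.
- by move=> x /andP[x0 x1]; apply: is_derive_like_anti; rewrite x0 ltW.
- exact: continuous_like.
- exact: like_anti_nd.
Qed.

End score.

(** * Windows without a change *)

Section triangle.
Context {R : realType}.

(** Reordering by the total [m] of the two counts prepares for conditioning on
    it; two counts below [K] have a total below [2 K]. *)
Lemma sum_square_le_triangle (w : nat -> nat -> R) K :
  (forall y1 y2, 0 <= w y1 y2) ->
  \sum_(0 <= y1 < K) \sum_(0 <= y2 < K) w y1 y2
  <= \sum_(0 <= m < K + K) \sum_(0 <= y < m.+1) w y (m - y)%N.
Proof.
move=> w0.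
have row y1 : (y1 < K)%N -> \sum_(0 <= y2 < K) w y1 y2
    <= \sum_(0 <= m < K + K | (y1 <= m)%N) w y1 (m - y1)%N.
  move=> y1K.
  apply: (@le_trans _ _ (\sum_(0 + y1 <= m < K + y1) w y1 (m - y1)%N)).
    rewrite big_addn addnK le_eqVlt; apply/orP; left; apply/eqP.
    by apply: eq_bigr => i _; rewrite addnK.
  rewrite add0n (big_nat_widenl _ 0)//=.
  rewrite [leRHS](big_cat_nat (n := K + y1))//=; last first.
    by rewrite leq_add2l ltnW.
  by rewrite lerDl sumr_ge0.
apply: (@le_trans _ _ (\sum_(0 <= y1 < K)
  \sum_(0 <= m < K + K | (y1 <= m)%N) w y1 (m - y1)%N)).
  by apply: ler_sum_nat => y1 /= y1K; exact: row.
rewrite (exchange_big_dep_nat xpredT)//=; apply: ler_sum_nat => m _.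
rewrite (big_nat_widen _ _ (K + m.+1)) ?leq_addr//.
rewrite [leRHS](big_nat_widen _ _ (K + m.+1)) ?leq_addl//.
rewrite [leLHS]big_mkcond [leRHS]big_mkcond; apply: ler_sum_nat => y _ /=.
rewrite ltnS; case: (y <= m)%N => /=; last by rewrite lexx.
by case: (y < K)%N.
Qed.

(** Given the total, the first of two independent Poisson counts is binomial, so
    a bound on every conditional mean is a bound on the mean. *)
Lemma sum_pois_square (A B : R) (v : nat -> nat -> R) (C : R) K :
  0 < A -> 0 < B -> (forall y1 y2, 0 <= v y1 y2) -> 0 <= C ->
  (forall m, \sum_(0 <= y < m.+1) binw m (A / (A + B)) y * v y (m - y)%N <= C) ->
  \sum_(0 <= y1 < K) \sum_(0 <= y2 < K) pois A y1 * pois B y2 * v y1 y2 <= C.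
Proof.
move=> A0 B0 v0 C0 vC.
apply: le_trans (@sum_square_le_triangle
  (fun y1 y2 => pois A y1 * pois B y2 * v y1 y2) K _) _.
  by move=> y1 y2; apply: mulr_ge0 => //; apply: mulr_ge0; apply: pois_ge0; exact: ltW.
have AB0 : 0 <= A + B by rewrite addr_ge0 ?ltW.
apply: (@le_trans _ _ (\sum_(0 <= m < K + K) pois (A + B) m * C)).
  apply: ler_sum_nat => m _.
  apply: le_trans (ler_wpM2l (pois_ge0 m AB0) (vC m)).
  rewrite mulr_sumr; apply: ler_sum_nat => y /= ym.
  by rewrite pois_split// -mulrA.
by rewrite -mulr_suml ler_piMl// sum_pois_le1.
Qed.

End triangle.

Section null_window.
Context {R : realType}.

Lemma ler_bcdf m (q : R) y y' : 0 <= q <= 1 -> (y <= y')%N ->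
  bcdf m q y <= bcdf m q y'.
Proof.
move=> q01 yy; rewrite /bcdf [leRHS](big_cat_nat (n := y))//= lerDl.
by apply: sumr_ge0 => k _; exact: binw_ge0.
Qed.

Lemma bcdf_ge0 m (q : R) y : 0 <= q <= 1 -> 0 <= bcdf m q y.
Proof. by move=> q01; apply: sumr_ge0 => k _; exact: binw_ge0. Qed.

Lemma bcdf_le1 m (q : R) y : 0 <= q <= 1 -> (y <= m.+1)%N -> bcdf m q y <= 1.
Proof. by move=> q01 ym; rewrite -(bcdf_total m q) ler_bcdf. Qed.

Lemma fold_anti0 (F : R -> R) : F 0 = 0 -> fold_anti F 0 = 0.
Proof. by move=> F0; rewrite /fold_anti invr_ge0 ler0n mulr0 F0 mul0r. Qed.

Lemma fold_anti1 (F : R -> R) : F 0 = 0 -> fold_anti F 1 = F 1.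
Proof.
move=> F0; rewrite /fold_anti ifF; last by apply/negbTE; rewrite -ltNge; lra.
by rewrite subrr mulr0 F0 mul0r subr0.
Qed.

Lemma fold_anti_nd (F : R -> R) :
  (forall x y, 0 <= x -> x <= y -> y <= 1 -> F x <= F y) ->
  forall x y, 0 <= x -> x <= y -> y <= 1 -> fold_anti F x <= fold_anti F y.
Proof.
move=> ndF x y x0 xy y1; rewrite /fold_anti.
have [y2|y2] := leP y 2^-1.
  rewrite (le_trans xy y2).
  have h : F (2 * x) <= F (2 * y) by apply: ndF; lra.
  lra.
have h1 : F (2 * (1 - y)) <= F 1 by apply: ndF; lra.
have [x2|x2] := leP x 2^-1.
  have h : F (2 * x) <= F 1 by apply: ndF; lra.
  lra.
have h : F (2 * (1 - y)) <= F (2 * (1 - x)) by apply: ndF; lra.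
lra.
Qed.

(** If [F] is an antiderivative of [g], this is the mean of [g (p_value psi)]
    for [psi] uniform on its interval given the counts [y1] and [y2]. *)
Definition cell_mean (q : R) (F : R -> R) (y1 y2 : nat) : R :=
  (fold_anti F (bcdf (y1 + y2) q y1.+1) - fold_anti F (bcdf (y1 + y2) q y1))
  / binw (y1 + y2) q y1.

Lemma cell_meanK (q : R) F y1 y2 : 0 < q < 1 ->
  binw (y1 + y2) q y1 * cell_mean q F y1 y2 =
  fold_anti F (bcdf (y1 + y2) q y1.+1) - fold_anti F (bcdf (y1 + y2) q y1).
Proof.
move=> q01; rewrite /cell_mean mulrC divfK// gt_eqF// binw_gt0//.
exact: leq_addr.
Qed.

Lemma cell_mean_ge0 (q : R) F y1 y2 : 0 < q < 1 ->
  (forall x y, 0 <= x -> x <= y -> y <= 1 -> F x <= F y) ->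
  0 <= cell_mean q F y1 y2.
Proof.
move=> /andP[q0 q1] ndF; have q01 : 0 <= q <= 1 by rewrite !ltW.
rewrite divr_ge0 ?binw_ge0// subr_ge0; apply: fold_anti_nd => //.
- exact: bcdf_ge0.
- exact: ler_bcdf.
- by apply: bcdf_le1 => //; rewrite ltnS leq_addr.
Qed.

(** The intervals of [psi] tile the unit interval as [y] varies, and the sum
    telescopes. *)
Lemma sum_cell_mean (q : R) F m : 0 < q < 1 -> F 0 = 0 ->
  \sum_(0 <= y < m.+1) binw m q y * cell_mean q F y (m - y)%N = F 1.
Proof.
move=> q01 F0.
rewrite (eq_big_nat _ _ (F2 := fun y =>
  fold_anti F (bcdf m q y.+1) - fold_anti F (bcdf m q y))).
  by rewrite telescope_sumr// bcdf_total bcdf0 fold_anti1// fold_anti0// subr0.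
move=> y /=; rewrite ltnS => ym.
by have := @cell_meanK q F y (m - y)%N q01; rewrite subnKC.
Qed.

Context {N T : nat} d {Omega : measurableType d}
  (P : probability Omega R) (mu : 'I_N -> nat -> R)
  (X : 'I_N -> nat -> {mfun Omega >-> nat})
  (psi : 'I_N -> nat -> nat -> nat -> {mfun Omega >-> R}).
Hypotheses (mu_gt0 : forall n t, (1 <= t <= T)%N -> 0 < mu n t)
  (data_poisson : poisson_data T P mu X) (psi_rand : randomized T P X psi).
Variables (l1 l2 : R).
Let a : R := l1 * ln N%:R / N%:R.
Let b : R := l2 / Num.sqrt (N%:R * ln N%:R).
Hypotheses (a0 : 0 <= a) (b0 : 0 <= b) (ab1 : a / 2 + 2 * b < 1).

Lemma expR_ell (p : R) : 0 < p -> expR (ell N l1 l2 p) = like a b p.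
Proof. by move=> p0; rewrite lnK// posrE; exact: like_gt0. Qed.

(** The event says that the product of the likelihood ratios, which has mean
    [1], reaches [expR c] times the exponential of the penalty. *)
Lemma null_window s t u (c : R) : (s < t)%N -> (t < u)%N -> (u <= T)%N ->
  (forall n v, (1 <= v < T)%N -> mu n v = mu n v.+1) ->
  (P [set w | (c <= ell_pen T s t u l1 l2
      (fun n => p_value (psi n s t u w)))%R]
   <= (2 * expR (- c) * (T%:R / 4 * ((t - s)%:R^-1 + (u - t)%:R^-1))^-1)%:E)%E.
Proof.
move=> st tu uT mu_cst.
set D := T%:R / 4 * _.
have T0 : (0 < T)%N by apply: leq_trans uT; apply: leq_ltn_trans tu.
have st0 : 0 < (t - s)%:R :> R by rewrite ltr0n subn_gt0.
have tu0 : 0 < (u - t)%:R :> R by rewrite ltr0n subn_gt0.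
have D0 : 0 < D.
  by rewrite mulr_gt0// ?divr_gt0 ?ltr0n// addr_gt0 ?invr_gt0.
pose G x := expR (ell N l1 l2 (p_value x)).
rewrite [X in P X](_ : _ =
    [set w | (expR c * D <= \prod_(n < N) G (psi n s t u w))%R]); last first.
  have DE : expR c * D = expR (c + ln D) by rewrite expRD lnK ?posrE.
  by apply/seteqP; split => w /=;
    rewrite /ell_pen /ell_sum -/D DE -expR_sum ler_expR lerBrDr.
have mu_all n v : (1 <= v <= T)%N -> mu n v = mu n 1.
  elim: v => // -[//|v] IH /andP[_ vT]; rewrite -mu_cst; last by rewrite vT.
  by apply: IH; rewrite /= ltnW.
have sumE n x y : (x <= y)%N -> (y <= T)%N ->
    \sum_(x.+1 <= v < y.+1) mu n v = (y - x)%:R * mu n 1.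
  move=> xy yT; rewrite (eq_big_nat _ _ (F2 := fun=> mu n 1)).
    by rewrite sumr_const_nat subSS mulr_natl.
  by move=> v /andP[xv vy]; apply: mu_all; lia.
set q : R := (t - s)%:R / (u - s)%:R.
have us : (u - s)%:R = (t - s)%:R + (u - t)%:R :> R.
  by rewrite -natrD; congr _%:R; lia.
have q01 : 0 < q < 1.
  rewrite /q us; apply/andP; split; first by rewrite divr_gt0// addr_gt0.
  by rewrite ltr_pdivrMr ?addr_gt0// mul1r ltrDl.
have la0 : like_anti a b 0 = 0 by rewrite /like_anti eqxx.
have la1 : like_anti a b 1 = 1.
  by rewrite /like_anti oner_eq0 ln1 sqrtr1; field.
have nd := like_anti_nd a0 b0 ab1.
have := @window_markov R N T d Omega P mu X psi mu_gt0 data_poisson psi_rand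
  s t u st tu uT G (expR c * D) (fun n => cell_mean q (like_anti a b)) (fun=> 1).
rewrite big1_eq mulr1 (_ : 2 / _ = 2 * expR (- c) * D^-1); last first.
  by rewrite expRN invfM mulrA.
apply => //.
- by rewrite mulr_gt0// expR_gt0.
- apply: (measurableT_comp (@measurable_expR R)).
  by apply: (measurableT_comp (measurable_ell N l1 l2)); exact: measurable_p_value.
- by move=> x; exact: expR_ge0.
- by move=> n y1 y2; exact: cell_mean_ge0.
- move=> n y1 y2; rewrite cell_meanK//.
  have q01w : 0 <= q <= 1 by case/andP: q01 => /ltW -> /ltW ->.
  apply: (@integral_like R a b) => //.
  + apply: (measurableT_comp (@measurable_expR R)).
    by apply: (measurableT_comp (measurable_ell N l1 l2)); exact: measurable_p_value.
  + by move=> x; exact: expR_ge0.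
  + by move=> x /p_value01/andP[x0 _]; exact: expR_ell.
  + exact: bcdf_ge0.
  + by rewrite bcdfS ltrDl binw_gt0// leq_addr.
  + by apply: bcdf_le1 => //; rewrite ltnS leq_addr.
- move=> n K; rewrite !sumE ?(ltnW st) ?(ltnW tu) ?(ltnW (leq_trans tu uT))//.
  have m0 : 0 < mu n 1 by apply: mu_gt0; rewrite /= T0.
  apply: sum_pois_square => //.
  + by rewrite mulr_gt0.
  + by rewrite mulr_gt0.
  + by move=> y1 y2; exact: cell_mean_ge0.
  + move=> m; rewrite (_ : _ / _ = q); last first.
      by rewrite -mulrDl -us /q; field; rewrite !gt_eqF// us addr_gt0.
    by rewrite sum_cell_mean// la1.
Qed.

End null_window.

(** * Stochastic dominance of the p-values *)

Section dominance.
Context {R : realType}.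

(** The double sum of [p y * p z * (w y - w z) * (g y - g z)] is twice the
    difference of the two sides. *)
Lemma chebyshev_sum m (p w g : nat -> R) :
  (forall y, (y <= m)%N -> 0 <= p y) ->
  \sum_(0 <= y < m.+1) p y = 1 ->
  (forall y z, (y <= m)%N -> (z <= m)%N -> (w y - w z) * (g y - g z) <= 0) ->
  \sum_(0 <= y < m.+1) p y * w y * g y <=
  (\sum_(0 <= y < m.+1) p y * w y) * (\sum_(0 <= y < m.+1) p y * g y).
Proof.
move=> p0 p1 wg.
have : \sum_(0 <= y < m.+1) \sum_(0 <= z < m.+1)
    p y * p z * ((w y - w z) * (g y - g z)) <= 0.
  rewrite big_nat; apply: sumr_le0 => y /=; rewrite ltnS => ym.
  rewrite big_nat; apply: sumr_le0 => z /=; rewrite ltnS => zm.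
  by rewrite mulr_ge0_le0 ?wg// mulr_ge0 ?p0.
set S := \sum_(0 <= y < m.+1) p y * w y * g y.
set A := \sum_(0 <= y < m.+1) p y * w y.
set B := \sum_(0 <= y < m.+1) p y * g y.
have -> : \sum_(0 <= y < m.+1) \sum_(0 <= z < m.+1)
    p y * p z * ((w y - w z) * (g y - g z)) = S - A * B - (A * B - S).
  transitivity (\sum_(0 <= y < m.+1) (p y * w y * g y - (p y * w y * B)
     - (p y * g y * A - p y * S))).
    apply: eq_bigr => y _.
    transitivity (\sum_(0 <= z < m.+1) (p y * w y * g y * p z
       - (p y * w y) * (p z * g z) - ((p y * g y) * (p z * w z)
       - p y * (p z * w z * g z)))).
      by apply: eq_bigr => z _; ring.
    by rewrite !sumrB -!mulr_sumr p1 mulr1.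
  by rewrite !sumrB -!mulr_suml p1 mul1r -/S -/A -/B; ring.
by lra.
Qed.

Local Notation half := (2^-1 : R).

Let half01 : 0 < half < 1.
Proof. by apply/andP; split; lra. Qed.

Let half01w : 0 <= half <= 1.
Proof. by apply/andP; split; lra. Qed.

Lemma binw_half m y : (y <= m)%N -> binw m half y = 'C(m, y)%:R * half ^+ m.
Proof.
move=> ym; rewrite /binw (_ : 1 - half = half); last by field.
by rewrite -mulrA -exprD subnKC.
Qed.

Lemma binw_half_sym m y : (y <= m)%N -> binw m half (m - y) = binw m half y.
Proof. by move=> ym; rewrite !binw_half ?leq_subr// bin_sub. Qed.

Lemma bcdf_half_sym m y : (y <= m.+1)%N ->
  bcdf m half (m.+1 - y) = 1 - bcdf m half y.
Proof.
elim: y => [|y IH] ym; first by rewrite subn0 bcdf_total bcdf0 subr0.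
have := IH (ltnW ym); rewrite ltnS in ym.
by rewrite subSS subSn// !bcdfS binw_half_sym//; lra.
Qed.

Lemma bcdf_half_le m y : (y + y <= m.+1)%N -> bcdf m half y <= half.
Proof.
move=> ym; have y_m : (y <= m.+1)%N by lia.
have := bcdf_half_sym y_m.
have : bcdf m half y <= bcdf m half (m.+1 - y) by apply: ler_bcdf => //; lia.
by lra.
Qed.

Lemma fold_anti_sym (F : R -> R) x : fold_anti F (1 - x) = F 1 - fold_anti F x.
Proof.
rewrite /fold_anti; case: (ltrgtP x half) => h.
- rewrite ifF; last by apply/negbTE; rewrite -ltNge; lra.
  by congr (_ - F _ / 2); ring.
- rewrite ifT; last by lra.
  by rewrite subKr.
- rewrite h ifT; last by lra.
  rewrite (_ : 1 - half = half); last by field.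
  by rewrite (_ : 2 * half = 1); [lra|field].
Qed.

Variables (F h : R -> R).
Hypotheses (F0 : F 0 = 0)
  (Fh : forall x y, 0 <= x -> x <= y -> y <= 1 ->
     h x * (y - x) <= F y - F x <= h y * (y - x))
  (ndh : forall x y, 0 <= x -> x <= y -> y <= 1 -> h x <= h y).

Let cell m y := cell_mean half F y (m - y).

Let cellE m y : (y <= m)%N -> binw m half y * cell m y =
  fold_anti F (bcdf m half y.+1) - fold_anti F (bcdf m half y).
Proof.
by move=> ym; have := @cell_meanK R half F y (m - y) half01; rewrite subnKC.
Qed.

Let cell_sym m y : (y <= m)%N -> cell m (m - y) = cell m y.
Proof.
move=> ym; have b0 : binw m half y != 0 by rewrite gt_eqF// binw_gt0.
apply: (mulfI b0); rewrite -{1}(binw_half_sym ym) !cellE ?leq_subr//.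
rewrite -subSn// bcdf_half_sym//; last exact: ltnW.
have -> : (m - y = m.+1 - y.+1)%N by rewrite subSS.
by rewrite bcdf_half_sym// !fold_anti_sym; lra.
Qed.

Let cell_mono m y z : (y < z)%N -> (z + z <= m)%N -> cell m y <= cell m z.
Proof.
move=> yz zm; have z_m : (z <= m)%N := leq_trans (leq_addr z z) zm.
have ym : (y <= m)%N := leq_trans (ltnW yz) z_m.
have by0 : 0 < binw m half y by rewrite binw_gt0.
have bz0 : 0 < binw m half z by rewrite binw_gt0.
have By0 := @bcdf_ge0 _ m half y half01w.
have Bz0 := @bcdf_ge0 _ m half z half01w.
have BySz : bcdf m half y.+1 <= bcdf m half z by apply: ler_bcdf.
have Bz2 : bcdf m half z <= half by exact: (bcdf_half_le (leqW zm)).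
have eBy : bcdf m half y.+1 = bcdf m half y + binw m half y by rewrite bcdfS.
have eBz : bcdf m half z.+1 = bcdf m half z + binw m half z by rewrite bcdfS.
have hy : cell m y <= h (2 * bcdf m half y.+1).
  rewrite -(ler_pM2l by0) cellE// /fold_anti !ifT; [|lra|lra].
  have /andP[_] := @Fh (2 * bcdf m half y) (2 * bcdf m half y.+1)
    ltac:(lra) ltac:(lra) ltac:(lra).
  have -> : 2 * bcdf m half y.+1 - 2 * bcdf m half y = 2 * binw m half y by lra.
  by lra.
have hz : h (2 * bcdf m half z) <= cell m z.
  rewrite -(ler_pM2l bz0) cellE//.
  have [zz|zz] := ltnP (z + z) m.
    have BSz2 : bcdf m half z.+1 <= half.
      by apply: bcdf_half_le; rewrite addSn addnS ltnS.
    rewrite /fold_anti !ifT; [|lra|lra].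
    have /andP[+ _] := @Fh (2 * bcdf m half z) (2 * bcdf m half z.+1)
      ltac:(lra) ltac:(lra) ltac:(lra).
    have -> : 2 * bcdf m half z.+1 - 2 * bcdf m half z = 2 * binw m half z by lra.
    by lra.
  have e : bcdf m half z.+1 = 1 - bcdf m half z.
    have mz : m = (z + z)%N by apply/eqP; rewrite eqn_leq zz zm.
    by rewrite -bcdf_half_sym ?leqW// {3}mz -addSn addnK.
  rewrite e fold_anti_sym.
  rewrite /fold_anti ifT//.
  have /andP[+ _] := @Fh (2 * bcdf m half z) 1 ltac:(lra) ltac:(lra) ltac:(lra).
  have : binw m half z = 1 - 2 * bcdf m half z by lra.
  by move=> ->; lra.
apply: le_trans hy (le_trans _ hz); apply: ndh; lra.
Qed.

Let weight (th : R) m y : R :=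
  (th ^+ y * (1 - th) ^+ (m - y) + th ^+ (m - y) * (1 - th) ^+ y) / 2.

Let weight_sym th m y : (y <= m)%N -> weight th m (m - y) = weight th m y.
Proof. by move=> ym; rewrite /weight subKn// addrC. Qed.

Let weight_mono th m y z : 0 < th < 1 -> (y < z)%N -> (z + z <= m)%N ->
  weight th m z <= weight th m y.
Proof.
move=> /andP[t0 t1] yz zm; rewrite /weight ler_pM2r// -subr_ge0.
set ph := 1 - th; have p0 : 0 < ph by rewrite subr_gt0.
pose dd := (z - y)%N; pose e := (m - z - y)%N.
have -> : (m - y = y + dd + e)%N by rewrite /dd /e; lia.
have -> : (m - z = y + e)%N by rewrite /e; lia.
have -> : z = (y + dd)%N by rewrite /dd; lia.
rewrite !exprD (_ : _ - _ = th ^+ y * ph ^+ y * ((th ^+ dd - ph ^+ dd) *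
  (th ^+ e - ph ^+ e))); last by ring.
apply: mulr_ge0; first by rewrite mulr_ge0 ?exprn_ge0 ?ltW.
have [le_tp|/ltW le_pt] := leP th ph.
  by rewrite mulr_le0// subr_le0 lerXn2r// nnegrE ltW.
by rewrite mulr_ge0// subr_ge0 lerXn2r// nnegrE ltW.
Qed.

(** Under any odds the two-sided p-value is stochastically smaller than
    uniform.  The likelihood ratio of the two counts, made symmetric in them,
    is larger the further the share is from [1 / 2], where the cell means are
    smaller, so the claim is the sum inequality of Chebyshev. *)
Lemma alt_cell_mean_le (th : R) m : 0 < th < 1 ->
  \sum_(0 <= y < m.+1) binw m th y * cell_mean half F y (m - y) <= F 1.
Proof.
move=> th01.
have t01 : 0 <= th <= 1 by case/andP: th01 => /ltW -> /ltW ->.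
pose w y := 2 ^+ m * weight th m y.
have bw y : (y <= m)%N -> binw m half y * w y = (binw m th y + binw m th (m - y)) / 2.
  move=> ym; rewrite binw_half// /w /weight /binw bin_sub// subKn//.
  have e : half ^+ m * 2 ^+ m = 1 by rewrite -exprMn mulVf// expr1n.
  set A := 'C(m, y)%:R; rewrite mulrA -[A * _ * _]mulrA e mulr1; ring.
have rev (f : nat -> R) : \sum_(0 <= y < m.+1) f (m - y)%N = \sum_(0 <= y < m.+1) f y.
  rewrite [RHS]big_nat_rev/= add0n; apply: eq_bigr => y _.
  by rewrite subSS.
have s1 (th' : R) : \sum_(0 <= y < m.+1) binw m th' y = 1.
  by rewrite big_mkord sum_binw.
have -> : \sum_(0 <= y < m.+1) binw m th y * cell_mean half F y (m - y) =
    \sum_(0 <= y < m.+1) binw m half y * w y * cell m y.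
  transitivity (\sum_(0 <= y < m.+1) (binw m th y * cell m y / 2 +
      binw m th (m - y) * cell m (m - y) / 2)).
    rewrite big_split/= (rev (fun y => binw m th y * cell m y / 2)).
    by rewrite -big_split/=; apply: eq_bigr => y _; rewrite /cell; field.
  apply: eq_big_nat => y /=; rewrite ltnS => ym.
  by rewrite bw// cell_sym//; field.
apply: le_trans (@chebyshev_sum m (binw m half) w (cell m) _ (s1 half) _) _.
- by move=> y ym; exact: binw_ge0.
- have main y z : (y + y <= m)%N -> (z + z <= m)%N -> (y <= z)%N ->
      (w y - w z) * (cell m y - cell m z) <= 0.
    move=> ym zm; rewrite leq_eqVlt => /orP[/eqP ->|yz].
      by rewrite !subrr mulr0.
    apply: mulr_ge0_le0; last by rewrite subr_le0 cell_mono.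
    by rewrite subr_ge0 /w ler_pM2l ?exprn_gt0// weight_mono.
  have main' y z : (y + y <= m)%N -> (z + z <= m)%N ->
      (w y - w z) * (cell m y - cell m z) <= 0.
    move=> ym zm; have [yz|/ltnW zy] := leqP y z; first exact: main.
    by rewrite -mulrNN !opprB; exact: main.
  have fold y : (y <= m)%N -> exists2 y', (y' + y' <= m)%N &
      w y = w y' /\ cell m y = cell m y'.
    move=> ym; have [h1|h1] := leqP (y + y) m; first by exists y.
    exists (m - y)%N; first by lia.
    by rewrite /w weight_sym// cell_sym.
  move=> y z /fold[y' y'm [-> ->]] /fold[z' z'm [-> ->]]; exact: main'.
rewrite sum_cell_mean// (_ : \sum_(_ <= _ < _) _ = 1) ?mul1r//.
rewrite (eq_big_nat _ _ (F2 := fun y => binw m th y / 2 + binw m th (m - y) / 2)).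
  by rewrite big_split/= (rev (fun y => binw m th y / 2)) -mulr_suml s1; field.
by move=> y /=; rewrite ltnS => ym; rewrite bw//; field.
Qed.

End dominance.

(** * Negative moments of the likelihood ratio *)

Section alternative_score.
Context {R : realType}.

Lemma ln_concave2 (w x y : R) : 0 <= w <= 1 -> 0 < x -> 0 < y ->
  w * ln x + (1 - w) * ln y <= ln (w * x + (1 - w) * y).
Proof.
move=> /andP[w0 w1] x0 y0; set M := w * x + (1 - w) * y.
have M0 : 0 < M.
  move: w0; rewrite le_eqVlt => /orP[/eqP e|w0].
    by rewrite /M -e mul0r subr0 mul1r add0r.
  by rewrite ltr_pwDl ?mulr_gt0// mulr_ge0 ?subr_ge0// ltW.
have main z : 0 < z -> ln z <= ln M + (z / M - 1).
  move=> z0; have zM : 0 < z / M by rewrite divr_gt0.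
  have := @ln_ge1V _ (z / M)^-1.
  rewrite invrK invr_gt0 => /(_ zM); rewrite lnV ?posrE// ln_div ?posrE//.
  lra.
have hx := ler_wpM2l w0 (main x x0).
have w1' : 0 <= 1 - w by rewrite subr_ge0.
have hy := ler_wpM2l w1' (main y y0).
apply: le_trans (lerD hx hy) _.
have -> : w * (ln M + (x / M - 1)) + (1 - w) * (ln M + (y / M - 1)) =
  ln M + ((w * x + (1 - w) * y) / M - 1) by ring.
by rewrite -/M divff ?gt_eqF// subrr addr0.
Qed.

(** Convexity of the exponential function, from the concavity of the logarithm. *)
Lemma expR_chord (th x : R) : 0 <= th <= 1 ->
  expR (- th * x) <= 1 - th + th * expR (- x).
Proof.
move=> th01; have e0 := expR_gt0 (- x).
have := ln_concave2 th01 e0 ltr01.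
rewrite ln1 mulr0 addr0 expRK => h.
have M0 : 0 < th * expR (- x) + (1 - th) * 1.
  case/andP: th01 => t0 t1; move: t0; rewrite le_eqVlt => /orP[/eqP <-|t0].
    by rewrite mul0r subr0 mulr1 add0r.
  by rewrite ltr_pwDl ?mulr_gt0// mulr1 subr_ge0.
rewrite -ler_expR lnK ?posrE// in h.
by rewrite mulNr -mulrN; lra.
Qed.

Variables a b th : R.
Hypotheses (a0 : 0 <= a) (b0 : 0 < b) (ab1 : a / 2 + 2 * b < 1)
  (th01 : 0 <= th <= 1).
Local Notation c0 := (base_score a b).

Lemma base_score_gt0 : 0 < c0.
Proof. by have := ab1; rewrite /base_score; lra. Qed.

Let c0_gt0 := base_score_gt0.

Definition inv_score (p : R) : R := Num.sqrt p / (c0 * Num.sqrt p + b).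

Definition inv_score_anti (p : R) : R :=
  c0^-1 * p + (- (2 * b / c0 ^+ 2) * Num.sqrt p +
    (2 * b ^+ 2 / c0 ^+ 3) * (ln (c0 * Num.sqrt p + b) + - ln b)).

(** An upper bound of [like a b p `^ - th], increasing in [p], whose integral
    is explicit. *)
Definition tilt_score (p : R) : R := 1 - th + th * inv_score p.

Definition tilt_score_anti (p : R) : R :=
  (1 - th) * p + th * inv_score_anti p.

Let den_gt0 (p : R) : 0 < c0 * Num.sqrt p + b.
Proof. by rewrite ltr_wpDl// mulr_ge0 ?sqrtr_ge0// ltW. Qed.

Lemma inv_score_nd (x y : R) : 0 <= x -> x <= y -> inv_score x <= inv_score y.
Proof.
move=> x0 xy; rewrite /inv_score ler_pdivrMr ?den_gt0// mulrAC ler_pdivlMr ?den_gt0//.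
have h := ler_wsqrtr xy.
have := ler_wpM2r (ltW b0) h.
by rewrite !mulrDr; set u := Num.sqrt x; set v := Num.sqrt y; lra.
Qed.

Lemma like_inv_le (p : R) : 0 < p -> (like a b p)^-1 <= inv_score p.
Proof.
move=> p0; have s0 : 0 < Num.sqrt p by rewrite sqrtr_gt0.
rewrite /inv_score -invf_div lef_pV2 ?posrE ?divr_gt0 ?like_gt0//; last exact: ltW.
apply: (le_trans _ (@like_ge R a b a0 p p0)).
by rewrite mulrDl mulfK ?gt_eqF.
Qed.

Lemma tilt_score_ge (p l : R) : 0 < p -> expR l = like a b p ->
  expR (- th * l) <= tilt_score p.
Proof.
move=> p0 lE; apply: le_trans (expR_chord l th01) _.
rewrite /tilt_score lerD2l expRN lE ler_wpM2l ?like_inv_le//.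
by case/andP: th01.
Qed.

Lemma is_derive_inv_score_anti (p : R) : 0 < p ->
  is_derive p 1 inv_score_anti (inv_score p).
Proof.
move=> p0; have s0 : 0 < Num.sqrt p by rewrite sqrtr_gt0.
have sq := is_derive1_sqrt p0.
have id := is_derive_idR p.
have hl := @is_derive_ln_comp R (fun p => c0 * Num.sqrt p + b) p _ (den_gt0 p)
  (is_derive_add (is_derive_scale c0 sq) (is_derive_const b p)).
have h := is_derive_add (is_derive_scale c0^-1 id)
  (is_derive_add (is_derive_scale (- (2 * b / c0 ^+ 2)) sq)
    (is_derive_scale (2 * b ^+ 2 / c0 ^+ 3)
       (is_derive_add hl (is_derive_const (- ln b) p)))).
apply: (is_derive_eq h); rewrite /inv_score.
have d0 := den_gt0 p.
field.
by rewrite !gt_eqF.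
Qed.

Lemma is_derive_tilt (p : R) : 0 < p ->
  is_derive p 1 tilt_score_anti (tilt_score p).
Proof.
move=> p0.
have h := is_derive_add (is_derive_scale (1 - th) (is_derive_idR p))
  (is_derive_scale th (is_derive_inv_score_anti p0)).
by apply: (is_derive_eq h); rewrite mulr1.
Qed.

Lemma continuous_tilt_anti (p : R) : 0 <= p -> {for p, continuous tilt_score_anti}.
Proof.
move=> p0; rewrite /tilt_score_anti /inv_score_anti.
have cs := @sqrt_continuous R p.
apply: cvgD; first by apply: cvgM; [exact: cvg_cst|exact: cvg_id].
apply: cvgM; first exact: cvg_cst.
apply: cvgD; first by apply: cvgM; [exact: cvg_cst|exact: cvg_id].
apply: cvgD; first by apply: cvgM; [exact: cvg_cst|].
apply: cvgM; first exact: cvg_cst.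
apply: cvgD; last exact: cvg_cst.
have c1 : {for p, continuous (fun p => c0 * Num.sqrt p + b)}.
  by apply: cvgD; [apply: cvgM => //; exact: cvg_cst|exact: cvg_cst].
exact: (continuous_comp c1 (continuous_ln (den_gt0 p))).
Qed.

Lemma continuous_tilt (p : R) : {for p, continuous tilt_score}.
Proof.
rewrite /tilt_score /inv_score.
have cs := @sqrt_continuous R p.
apply: cvgD; first exact: cvg_cst.
apply: cvgM; first exact: cvg_cst.
apply: cvgM => //; apply: cvgV; first by rewrite gt_eqF ?den_gt0.
by apply: cvgD; [apply: cvgM => //; exact: cvg_cst|exact: cvg_cst].
Qed.

Lemma tilt_score_nd (x y : R) : 0 <= x -> x <= y -> tilt_score x <= tilt_score y.
Proof.
move=> x0 xy; rewrite /tilt_score lerD2l ler_wpM2l ?inv_score_nd//.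
by case/andP: th01.
Qed.

Lemma tilt_score_ge0 (p : R) : 0 <= tilt_score p.
Proof.
case/andP: th01 => t0 t1.
rewrite /tilt_score addr_ge0 ?subr_ge0// mulr_ge0// divr_ge0 ?sqrtr_ge0//.
exact: ltW.
Qed.

Lemma tilt_anti_bounds (x y : R) : 0 <= x -> x <= y -> y <= 1 ->
  tilt_score x * (y - x) <= tilt_score_anti y - tilt_score_anti x
    <= tilt_score y * (y - x).
Proof.
move=> x0 xy y1.
have dl z : x < z < y -> is_derive z 1 tilt_score_anti (tilt_score z).
  by move=> /andP[xz zy]; apply: is_derive_tilt; lra.
have cl z : x <= z <= y -> {for z, continuous tilt_score_anti}.
  by move=> /andP[xz zy]; apply: continuous_tilt_anti; lra.
have [c /andP[xc cy] ->] := mean_value xy dl cl.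
have yx0 : 0 <= y - x by rewrite subr_ge0.
apply/andP; split; apply: ler_wpM2r => //; apply: tilt_score_nd => //.
exact: le_trans xc.
Qed.

Lemma tilt_anti_nd (x y : R) : 0 <= x -> x <= y -> y <= 1 ->
  tilt_score_anti x <= tilt_score_anti y.
Proof.
move=> x0 xy y1; have /andP[+ _] := tilt_anti_bounds x0 xy y1.
have : 0 <= tilt_score x * (y - x) by rewrite mulr_ge0 ?tilt_score_ge0 ?subr_ge0.
lra.
Qed.

Lemma tilt_anti0 : tilt_score_anti 0 = 0.
Proof.
by rewrite /tilt_score_anti /inv_score_anti sqrtr0 !mulr0 !add0r subrr !mulr0.
Qed.

(** With [c0 = 1 - a / 2 - 2 b], the terms [1 / c0] and [- 2 b / c0 ^ 2] cancel
    at the first order in [b], which leaves [a] and [b ^ 2 log (1 / b)]. *)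
Lemma tilt_anti1 : a / 2 + 2 * b <= 2^-1 ->
  tilt_score_anti 1 <= 1 + th * (a + 16 * b ^+ 2 * ln (1 + b^-1)).
Proof.
move=> ab2; rewrite /tilt_score_anti mulr1.
have c2 : 2^-1 <= c0 by move: ab2; rewrite /base_score; lra.
have c1 : c0 <= 1 by have := a0; have := b0; rewrite /base_score; lra.
suff h : inv_score_anti 1 <= 1 + (a + 16 * b ^+ 2 * ln (1 + b^-1)).
  have := ler_wpM2l (_ : 0 <= th) h; case/andP: th01 => -> _ /(_ isT).
  by move: (inv_score_anti 1) (16 * b ^+ 2 * ln (1 + b^-1)) => u v; lra.
rewrite /inv_score_anti sqrtr1 !mulr1.
set k := c0^-1.
have k2 : k <= 2 by rewrite /k -[2]invrK lef_pV2 ?posrE.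
have k1 : 1 <= k by rewrite /k -[1]invr1 lef_pV2 ?posrE.
have kc : k * c0 = 1 by rewrite mulVf// gt_eqF.
have cb0 : 0 < c0 + b by rewrite addr_gt0.
have L : ln (c0 + b) - ln b <= ln (1 + b^-1).
  rewrite -ln_div ?posrE// ler_ln ?posrE ?divr_gt0//; last first.
    by rewrite addr_gt0 ?invr_gt0.
  by rewrite ler_pdivrMr// mulrDl mulVf ?gt_eqF// mul1r; lra.
have L0 : 0 <= ln (c0 + b) - ln b.
  by rewrite subr_ge0 ler_ln ?posrE//; lra.
have L1 : 2 * b ^+ 2 / c0 ^+ 3 * (ln (c0 + b) + - ln b) <=
    16 * b ^+ 2 * ln (1 + b^-1).
  apply: ler_pM => //.
    by rewrite divr_ge0 ?mulr_ge0 ?exprn_ge0// ltW.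
  have k3 : k ^+ 3 <= 8.
    have -> : 8 = 2 ^+ 3 :> R by ring.
    by rewrite lerXn2r// nnegrE; lra.
  have bb : 0 <= b ^+ 2 by rewrite sqr_ge0.
  by rewrite -exprVn -/k; have := ler_wpM2l bb k3; lra.
have e1 : - (2 * b / c0 ^+ 2) = - (2 * b * k ^+ 2) by rewrite exprVn.
have e2 : k = 1 + k * (a / 2 + 2 * b).
  have : k * c0 = 1 := kc; rewrite /base_score.
  by rewrite !mulrBr; lra.
rewrite e1.
suff : k + - (2 * b * k ^+ 2) <= 1 + a by lra.
rewrite {1}e2.
have h1 : k * a <= 2 * a by rewrite ler_wpM2r.
have h2 : 2 * b * k <= 2 * b * k ^+ 2.
  by rewrite ler_pM2l ?mulr_gt0// expr2 ler_peMl//; lra.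
lra.
Qed.

End alternative_score.

(** * Windows around a change *)

Section small_p_values.
Context {R : realType}.
Local Notation half := (2^-1 : R).

(** The exponential rate of the binomial tail at counts in proportion
    [al : be]. *)
Definition tail_rate (al be : R) : R :=
  al * ln (2 * al / (al + be)) + be * ln (2 * be / (al + be)).

(** Chernoff's bound, with the tilt [al / be] under which the two counts are
    expected in proportion [al : be]. *)
Lemma bcdf_half_chernoff (al be L : R) y1 y2 : 0 < al -> al <= be ->
  y1%:R <= al * L -> be * L <= y2%:R ->
  bcdf (y1 + y2) half y1.+1 <= expR (- (L * tail_rate al be)).
Proof.
move=> al0 albe y1L y2L; have be0 : 0 < be := lt_le_trans al0 albe.
pose z := al / be; have z0 : 0 < z by rewrite divr_gt0.
have z1 : z <= 1 by rewrite ler_pdivrMr// mul1r.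
set m := (y1 + y2)%N.
have s0 : 0 < al + be by rewrite addr_gt0.
pose p1 := (al + be) / (2 * al); pose p2 := (al + be) / (2 * be).
have p10 : 0 < p1 by rewrite divr_gt0// mulr_gt0.
have p20 : 0 < p2 by rewrite divr_gt0// mulr_gt0.
have l1 : 0 <= ln p1.
  by rewrite ln_ge0// ler_pdivlMr ?mulr_gt0//; lra.
have l2 : ln p2 <= 0.
  by rewrite ln_le0// ler_pdivrMr ?mulr_gt0//; lra.
apply: (@le_trans _ _ (p1 ^+ y1 * p2 ^+ y2)); last first.
  have -> : p1 ^+ y1 * p2 ^+ y2 = expR (y1%:R * ln p1 + y2%:R * ln p2).
    by rewrite expRD !expRM_natl !lnK ?posrE.
  rewrite ler_expR /tail_rate.
  have -> : 2 * al / (al + be) = p1^-1 by rewrite invf_div.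
  have -> : 2 * be / (al + be) = p2^-1 by rewrite invf_div.
  rewrite !lnV ?posrE//.
  have h1 := ler_wpM2r l1 y1L; have h2 := ler_wnM2r l2 y2L.
  by move: (ln p1) (ln p2) h1 h2 => u v h1 h2; lra.
have -> : p1 ^+ y1 * p2 ^+ y2 = z ^- y1 * ((1 + z) * half) ^+ m.
  have -> : p2 = (1 + z) * half by rewrite /p2 /z; field; rewrite !gt_eqF.
  have -> : p1 = z^-1 * ((1 + z) * half).
    by rewrite /p1 /z; field; rewrite !gt_eqF.
  by rewrite exprMn exprVn /m exprD mulrA.
rewrite [leRHS]mulrC ler_pdivlMr ?exprn_gt0// [leRHS]exprMn exprDn mulr_suml /bcdf big_mkord mulr_suml.
rewrite -(big_mkord xpredT (fun k => binw m half k * z ^+ y1)).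
rewrite -(big_mkord xpredT (fun k => 1 ^+ (m - k) * z ^+ k *+ 'C(m, k) * half ^+ m)).
have ym : (y1.+1 <= m.+1)%N by rewrite ltnS leq_addr.
rewrite [leRHS](big_cat_nat (n := y1.+1))//=.
apply: (@le_trans _ _ (\sum_(0 <= k < y1.+1)
   1 ^+ (m - k) * z ^+ k *+ 'C(m, k) * half ^+ m)); last first.
  rewrite lerDl sumr_ge0// => k _.
  by rewrite mulr_ge0 ?exprn_ge0 ?mulrn_wge0 ?mulr_ge0 ?exprn_ge0 ?ltW.
apply: ler_sum_nat => k /= ky; rewrite ltnS in ky.
have km : (k <= m)%N := leq_trans ky (leq_addr _ _).
rewrite binw_half// expr1n mul1r -[z ^+ k *+ _]mulr_natl mulrAC.
have h : z ^+ y1 <= z ^+ k by rewrite ler_wiXn2l// ltW.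
by apply: ler_wpM2r; rewrite ?exprn_ge0//; exact: ler_wpM2l.
Qed.

(** [inc] tells whether the mean increases at the change. *)
Definition far_apart (inc : bool) (al be L : R) (y1 y2 : nat) : bool :=
  if inc then (y1%:R <= al * L) && (be * L <= y2%:R)
  else (y2%:R <= al * L) && (be * L <= y1%:R).

Lemma p_value_far_apart inc (al be L psi : R) y1 y2 : 0 < al -> al <= be ->
  far_apart inc al be L y1 y2 ->
  bcdf (y1 + y2) half y1 < psi < bcdf (y1 + y2) half y1.+1 ->
  p_value psi <= 2 * expR (- (L * tail_rate al be)).
Proof.
move=> al0 albe fa /andP[lo hi]; rewrite /p_value ler_pM2l//.
have ml : Num.min psi (1 - psi) <= psi by rewrite ge_min lexx.
have mr : Num.min psi (1 - psi) <= 1 - psi by rewrite ge_min lexx orbT.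
case: inc fa => /andP[h1 h2].
  have := bcdf_half_chernoff al0 albe h1 h2; lra.
have := bcdf_half_chernoff al0 albe h1 h2.
have -> : (y2.+1 = (y1 + y2).+1 - y1)%N by rewrite -addnS addKn.
rewrite addnC bcdf_half_sym; last by rewrite ltnW// ltnS leq_addr.
lra.
Qed.

Lemma sum_pois_far (A B g0 g1 dl : R) (good : nat -> nat -> bool) K :
  0 <= A -> 0 <= B -> 0 <= g0 -> g0 <= g1 ->
  \sum_(0 <= y1 < K) \sum_(0 <= y2 < K)
     pois A y1 * pois B y2 * (~~ good y1 y2)%:R <= dl ->
  \sum_(0 <= y1 < K) \sum_(0 <= y2 < K)
     pois A y1 * pois B y2 * (if good y1 y2 then g0 else g1)
  <= g0 + (g1 - g0) * dl.
Proof.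
move=> A0 B0 g00 g01 bad.
have g10 : 0 <= g1 - g0 by rewrite subr_ge0.
apply: le_trans (lerD (lexx g0) (ler_wpM2l g10 bad)).
have tot : (\sum_(0 <= y1 < K) \sum_(0 <= y2 < K) pois A y1 * pois B y2) * g0 <= g0.
  rewrite ler_piMl//.
  rewrite (eq_bigr (fun y1 => pois A y1 * \sum_(0 <= y2 < K) pois B y2)).
    rewrite -mulr_suml mulr_ile1 ?sum_pois_le1//.
      by apply: sumr_ge0 => *; exact: pois_ge0.
    by apply: sumr_ge0 => *; exact: pois_ge0.
  by move=> y1 _; rewrite mulr_sumr.
apply: le_trans (lerD tot (lexx _)).
rewrite mulr_suml mulr_sumr -big_split/=; apply: ler_sum => y1 _.
rewrite mulr_suml mulr_sumr -big_split/=; apply: ler_sum => y2 _.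
by case: (good y1 y2) => /=; lra.
Qed.

End small_p_values.

Lemma half_window s t u : (s < t)%N -> (t - s = u - t)%N ->
  (u - s = (t - s) + (t - s))%N.
Proof. by lia. Qed.

Lemma sum_means_ge0 (R : realType) (m : nat -> R) (T x y : nat) :
  (forall v, (1 <= v <= T)%N -> 0 < m v) -> (y <= T)%N ->
  0 <= \sum_(x.+1 <= v < y.+1) m v.
Proof.
move=> m0 yT; rewrite big_nat sumr_ge0// => v /andP[xv vy].
by rewrite ltnS in vy; rewrite ltW// m0// (leq_ltn_trans _ xv)//= (leq_trans vy).
Qed.

Lemma sum_means_gt0 (R : realType) (m : nat -> R) (T x y : nat) :
  (forall v, (1 <= v <= T)%N -> 0 < m v) -> (x < y)%N -> (y <= T)%N ->
  0 < \sum_(x.+1 <= v < y.+1) m v.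
Proof.
move=> m0; case: y => // y xy yT; rewrite big_nat_recr//= ltr_wpDl//.
  by apply: (sum_means_ge0 _ m0); exact: ltnW.
by rewrite m0.
Qed.

Section alternative_window.
Context {R : realType} {N T : nat} d {Omega : measurableType d}
  (P : probability Omega R) (mu : 'I_N -> nat -> R)
  (X : 'I_N -> nat -> {mfun Omega >-> nat})
  (psi : 'I_N -> nat -> nat -> nat -> {mfun Omega >-> R}).
Hypotheses (mu_gt0 : forall n t, (1 <= t <= T)%N -> 0 < mu n t)
  (data_poisson : poisson_data T P mu X) (psi_rand : randomized T P X psi).
Variables (l1 l2 th : R).
Let a : R := l1 * ln N%:R / N%:R.
Let b : R := l2 / Num.sqrt (N%:R * ln N%:R).
Hypotheses (a0 : 0 <= a) (b0 : 0 < b) (ab1 : a / 2 + 2 * b <= 2^-1)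
  (th01 : 0 <= th <= 1).
Local Notation half := (2^-1 : R).

Let ab1' : a / 2 + 2 * b < 1.
Proof. by have := ab1; lra. Qed.

(** Chernoff's bound with the exponent [- th].  A sequence of [S] has a small
    p-value, hence the factor [g n], when its counts are far apart, and a factor
    of [tilt_score a b th 1] at most otherwise.  For the other sequences the
    dominance of the p-values gives [tilt_score_anti a b th 1]. *)
Lemma alt_window s t u (K : R) (S : pred 'I_N) (inc : 'I_N -> bool)
    (al be L g dl : 'I_N -> R) (gam : R) (V : nat) :
  (s < t)%N -> (t - s = u - t)%N -> (u <= T)%N ->
  (V <= #|[set n | S n]%SET|)%N -> 0 <= gam <= 1 ->
  (forall n, S n -> [/\ 0 < al n, al n <= be n, 0 <= g n &
     g n <= tilt_score a b th 1]) ->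
  (forall n, S n -> [/\ forall p, 0 < p <= 1 -> p <= 2 * expR (- (L n * tail_rate (al n) (be n))) ->
       expR (- th * ell N l1 l2 p) <= g n,
     forall K, \sum_(0 <= y1 < K) \sum_(0 <= y2 < K)
       pois (\sum_(s.+1 <= r < t.+1) mu n r) y1 *
       pois (\sum_(t.+1 <= r < u.+1) mu n r) y2 *
       (~~ far_apart (inc n) (al n) (be n) (L n) y1 y2)%:R <= dl n &
     g n + (tilt_score a b th 1 - g n) * dl n <= gam]) ->
  (P [set w | (ell_sum l1 l2 (fun n => p_value (psi n s t u w)) <= K)%R]
   <= (2 * expR (th * (K + N%:R * (a + 16 * b ^+ 2 * ln (1 + b^-1))))
       * gam ^+ V)%:E)%E.
Proof.
move=> st stu uT VS /andP[gam0 gam1] HS1 HS2.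
have tu : (t < u)%N by rewrite -subn_gt0 -stu subn_gt0.
set kap := a + 16 * b ^+ 2 * ln (1 + b^-1).
have kap0 : 0 <= kap.
  have bV : 1 <= 1 + b^-1 by rewrite lerDl invr_ge0 ltW.
  apply: addr_ge0 => //; apply: mulr_ge0; last exact: ln_ge0.
  by rewrite mulr_ge0// sqr_ge0.
pose G x := expR (- th * ell N l1 l2 (p_value x)).
have mG : measurable_fun setT G.
  apply: (measurableT_comp (@measurable_expR R)).
  apply: measurable_funM => //.
  by apply: (measurableT_comp (measurable_ell N l1 l2)); exact: measurable_p_value.
have G0 x : 0 <= G x by exact: expR_ge0.
have GE w : \prod_(n < N) G (psi n s t u w) =
    expR (- (th * ell_sum l1 l2 (fun n => p_value (psi n s t u w)))).
  by rewrite -expR_sum -mulNr /ell_sum mulr_sumr.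
case/andP: (th01) => t0 t1.
set q : R := (t - s)%:R / (u - s)%:R.
have qE : q = half.
  rewrite /q (half_window st stu).
  have : (t - s)%:R != 0 :> R by rewrite pnatr_eq0 -lt0n subn_gt0.
  rewrite natrD; move: (t - s)%:R => x x0.
  by rewrite -mulr2n -[x *+ 2]mulr_natl invfM mulrCA divff ?mulr1.
have half01 : 0 < half < 1 by apply/andP; split; lra.
have half01w : 0 <= half <= 1 by apply/andP; split; lra.
pose ta := tilt_score_anti a b th.
have ta0 : ta 0 = 0 := tilt_anti0 a b th.
have tand := tilt_anti_nd b0 ab1' th01.
have ta1 : ta 1 <= 1 + th * kap := tilt_anti1 a0 b0 ab1' th01 ab1.
have ta1_ge0 : 0 <= ta 1 by rewrite -ta0; apply: tand.
pose v n y1 y2 := if S n then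
    (if far_apart (inc n) (al n) (be n) (L n) y1 y2 then g n
     else tilt_score a b th 1)
  else cell_mean half ta y1 y2.
pose bd n := if S n then gam else 1 + th * kap.
have Gp x : 0 < x < 1 -> G x <= tilt_score a b th (p_value x).
  move=> /p_value01/andP[p0 _].
  apply: tilt_score_ge => //; apply: expR_ell => //; exact: ltW.
have Gp1 x : 0 < x < 1 -> G x <= tilt_score a b th 1.
  move=> x01; apply: le_trans (Gp x x01) _.
  by case/p_value01/andP: x01 => p0 p1; apply: tilt_score_nd => //; exact: ltW.
have cells y1 y2 : [/\ 0 <= bcdf (y1 + y2) half y1,
    bcdf (y1 + y2) half y1 < bcdf (y1 + y2) half y1.+1 &
    bcdf (y1 + y2) half y1.+1 <= 1].
  split; first exact: bcdf_ge0.
  - by rewrite bcdfS ltrDl binw_gt0// leq_addr.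
  - by apply: bcdf_le1 => //; rewrite ltnS leq_addr.
have A0 n x y := @sum_means_ge0 R (mu n) T x y (mu_gt0 n).
have A1 n x y := @sum_means_gt0 R (mu n) T x y (mu_gt0 n).
have tT : (t <= T)%N := leq_trans (ltnW tu) uT.
have eK0 : 0 < expR (- (th * K)) by exact: expR_gt0.
apply: (@le_trans _ _ (2 / expR (- (th * K)) * \prod_n bd n)%:E); last first.
  have -> : expR (th * (K + N%:R * kap)) = expR (th * K) * expR (th * kap) ^+ N.
    by rewrite -expRM_natl -expRD; congr expR; ring.
  rewrite lee_fin expRN invrK mulrA -[leRHS]mulrA.
  rewrite ler_wpM2l ?mulr_ge0 ?expR_ge0//.
  rewrite /bd (bigID S)/= mulrC.
  rewrite (eq_bigr (fun=> 1 + th * kap)); last by move=> n /negbTE ->.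
  rewrite [X in _ * X](eq_bigr (fun=> gam)); last by move=> n ->.
  rewrite !prodr_const; apply: ler_pM.
  - by rewrite exprn_ge0// addr_ge0// mulr_ge0.
  - by rewrite exprn_ge0.
  - have h1 : 1 <= 1 + th * kap by rewrite lerDl mulr_ge0.
    have h2 : 1 + th * kap <= expR (th * kap) by exact: expR_ge1Dx.
    apply: (@le_trans _ _ ((1 + th * kap) ^+ N)).
      by rewrite ler_weXn2l// (leq_trans (max_card _))// card_ord.
    by rewrite lerXn2r// nnegrE ?expR_ge0// (le_trans _ h1).
  - by apply: ler_wiXn2l => //; rewrite (leq_trans VS)// cardsE.
apply: (@le_trans _ _ (P [set w | (expR (- (th * K)) <=
    \prod_(n < N) G (psi n s t u w))%R])).
  apply: le_measure; rewrite ?inE.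
  - have mS : measurable_fun setT
      (fun w => ell_sum l1 l2 (fun n => p_value (psi n s t u w))).
      apply: measurable_sum => n; apply: (measurableT_comp (measurable_ell N l1 l2)).
      by apply: (measurableT_comp measurable_p_value); exact: measurable_funPT.
    rewrite [X in measurable X](_ : _ = setT `&`
      (fun w => ell_sum l1 l2 (fun n => p_value (psi n s t u w))) @^-1` `]-oo, K]%classic).
      by apply: mS.
    by rewrite setTI; apply/seteqP; split => w /=; rewrite in_itv.
  - by apply: measurable_prod_ge => // n; exact: measurable_funPT.
  - by move=> w /= h; rewrite GE ler_expR lerN2 ler_wpM2l.
apply: (@window_markov R N T d Omega P mu X psi mu_gt0 data_poisson psi_rand
  s t u st tu uT G (expR (- (th * K))) v bd) => //.
- move=> n y1 y2; rewrite /v; case: ifPn => [Sn|_].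
    have [_ _ gn gn1] := HS1 n Sn; case: ifP => // _.
    exact: le_trans gn1.
  exact: cell_mean_ge0.
- move=> n y1 y2; rewrite -/q qE /v; have [c1 c2 c3] := cells y1 y2.
  case: ifPn => [Sn|_]; last first.
    rewrite cell_meanK//.
    have dta (x : R) : 0 < x < 1 -> is_derive x 1 ta (tilt_score a b th x).
      by move=> /andP[x0 _]; exact: (is_derive_tilt th b0 ab1' x0).
    have cta (x : R) : 0 < x < 1 -> {for x, continuous (tilt_score a b th)}.
      by move=> _; exact: (@continuous_tilt R a b th b0 ab1' x).
    exact: (integral_fold_le mG G0 Gp dta cta tand c1 c2 c3).
  have [al0 albe gn gn1] := HS1 n Sn; have [gp _ _] := HS2 n Sn.
  have -> : binw (y1 + y2) half y1 =
      bcdf (y1 + y2) half y1.+1 - bcdf (y1 + y2) half y1.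
    by rewrite bcdfS addrC addKr.
  apply: integral_le_cst => //.
    by case: ifP => // _; exact: le_trans gn1.
  move=> x /andP[x1 x2].
  have x01 : 0 < x < 1 by apply/andP; split; lra.
  case: ifP => [fa|_]; last exact: Gp1.
  apply: gp; first exact: p_value01.
  by apply: p_value_far_apart fa _ => //; rewrite x1 x2.
- move=> n K'; rewrite /v /bd; case: ifPn => [Sn|_].
    have [al0 albe gn gn1] := HS1 n Sn; have [gp far dd] := HS2 n Sn.
    apply: (le_trans _ dd).
    by apply: sum_pois_far => //; exact: A0.
  apply: sum_pois_square => //.
  + exact: A1.
  + exact: A1.
  + by move=> y1 y2; exact: cell_mean_ge0.
  + by rewrite addr_ge0// mulr_ge0.
  + move=> m; apply: le_trans ta1.
    apply: (@alt_cell_mean_le R ta (tilt_score a b th)) => //.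
    * by move=> x y x0 xy y1; exact: tilt_anti_bounds.
    * by move=> x y x0 xy _; exact: tilt_score_nd.
    * have h1 := A1 n s t st tT; have h2 := A1 n t u tu uT.
      by rewrite divr_gt0 ?addr_gt0//= ltr_pdivrMr ?addr_gt0// mul1r ltrDl.
Qed.

End alternative_window.

(** * The type I error *)

Section scan.
Context {R : realType} {N T : nat} d {Omega : measurableType d}
  (psi : 'I_N -> nat -> nat -> nat -> {mfun Omega >-> R}).
Variables (hs ds : nat -> nat) (l1 l2 c : R).

Lemma measurable_ell_pen s t u : measurable [set w | c <= ell_pen T s t u l1 l2
  (fun n => p_value (psi n s t u w))].
Proof.
pose f w := ell_pen T s t u l1 l2 (fun n => p_value (psi n s t u w)).
have mf : measurable_fun setT f.
  apply: measurable_funB => //; apply: measurable_sum => n.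
  apply: (measurableT_comp (measurable_ell N l1 l2)).
  by apply: (measurableT_comp measurable_p_value); exact: measurable_funPT.
rewrite [X in measurable X](_ : _ = setT `&` f @^-1` `[c, +oo[%classic).
  by apply: mf.
by rewrite setTI; apply/seteqP; split => w /=; rewrite in_itv/= andbT.
Qed.

Let event i k : set Omega := [set w | c <= ell_pen T (s_ hs ds i k) (t_ ds i k)
  (u_ hs ds T i k) l1 l2
  (fun n => p_value (psi n (s_ hs ds i k) (t_ ds i k) (u_ hs ds T i k) w))].

Lemma measurable_declares : measurable (declares_change hs ds T l1 l2 c psi).
Proof.
rewrite [X in measurable X](_ : _ = \bigcup_i \bigcup_k
   (if (1 <= i <= i_max hs ds T)%N && (1 <= k <= grid_size ds T i)%N
    then event i k else set0)).
  apply: bigcupT_measurable => i; apply: bigcupT_measurable => k.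
  by case: ifP => // _; exact: measurable_ell_pen.
apply/seteqP; split => w.
  by move=> [i [k [hi hk hc]]]; exists i => //; exists k => //; rewrite hi hk.
by move=> [i _ [k _]]; case: ifP => // /andP[hi hk] h; exists i, k.
Qed.

Hypotheses (ds1 : forall i, (1 <= i)%N -> (1 <= ds i)%N)
  (ds_hs : forall i, (1 <= i)%N -> (ds i <= hs i)%N).
Variables (P : probability Omega R) (mu : 'I_N -> nat -> R)
  (X : 'I_N -> nat -> {mfun Omega >-> nat}).
Let a : R := l1 * ln N%:R / N%:R.
Let b : R := l2 / Num.sqrt (N%:R * ln N%:R).
Hypotheses (mu_gt0 : forall n t, (1 <= t <= T)%N -> 0 < mu n t)
  (data_poisson : poisson_data T P mu X) (psi_rand : randomized T P X psi)
  (a0 : 0 <= a) (b0 : 0 <= b) (ab1 : a / 2 + 2 * b < 1).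

Lemma window_sum_ge0 : 0 <= window_sum hs ds T :> R.
Proof. by apply: sumr_ge0 => i _; rewrite divr_ge0. Qed.

(** Neither half of a window of scale [i] is longer than [hs i], so its penalty
    is at least [log (T / (2 hs i))].  The grid of scale [i] has at most
    [T / ds i] points. *)
Lemma type_I_bound : num_change T mu = 0%N ->
  (P (declares_change hs ds T l1 l2 c psi)
   <= (4 * expR (- c) * window_sum hs ds T)%:E)%E.
Proof.
move=> J0.
have mu_cst n v : (1 <= v < T)%N -> mu n v = mu n v.+1.
  move=> /andP[v1 vT]; apply/eqP; rewrite -[_ == _]negbK; apply/negP => ne.
  have : v \in change_points T mu.
    rewrite mem_filter mem_iota; apply/andP; split; last by lia.
    by apply/existsP; exists n.
  by move: J0; rewrite /num_change => /size0nil ->.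
pose M := (i_max hs ds T).+1.
pose Q := [pred p : 'I_M * 'I_T |
  [&& (1 <= p.1)%N, (1 <= p.2)%N & (p.2 <= grid_size ds T p.1)%N]].
pose bd (p : 'I_M * 'I_T) : R := 4 * expR (- c) * (hs p.1)%:R / T%:R.
have grid_lt i k : (1 <= i)%N -> (1 <= k <= grid_size ds T i)%N ->
    [/\ (k < T)%N, (0 < T)%N & (k * ds i < T)%N].
  move=> /ds1 d1 /andP[k1 kK].
  have h1 : (k * ds i <= T - 1)%N.
    apply: leq_trans (leq_trunc_div (T - 1) (ds i)).
    by rewrite leq_mul2r kK orbT.
  have h2 : (k <= k * ds i)%N by rewrite leq_pmulr.
  by clear -k1 h1 h2; split; lia.
apply: (@le_trans _ _ (\sum_(p | Q p) bd p)%:E).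
  apply: (@measure_fin_cover _ _ _ P _ Q _ (fun p => event p.1 p.2)) => //.
  - exact: measurable_declares.
  - by move=> p _; exact: measurable_ell_pen.
  - move=> w [i [k [hi hk hc]]]; case/andP: (hi) => i1 iM.
    have [kT _ _] := grid_lt i k i1 hk.
    have iM' : (i < M)%N by rewrite ltnS.
    exists (Ordinal iM', Ordinal kT) => //=.
    by case/andP: hk => -> ->; rewrite i1.
  - move=> [i k] /and3P[/= i1 k1 kK].
    have hk : (1 <= k <= grid_size ds T i)%N by rewrite k1.
    have [kT T0 kdT] := grid_lt i k i1 hk.
    have dd := ds1 i1; have dh := ds_hs i1.
    have kd0 : (0 < k * ds i)%N by rewrite muln_gt0 k1.
    have h0 : (0 < hs i)%N := leq_trans dd dh.
    have st : (s_ hs ds i k < t_ ds i k)%N.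
      by rewrite /s_ /t_ ltn_subrL h0.
    have tu : (t_ ds i k < u_ hs ds T i k)%N.
      by rewrite /t_ /u_ leq_min kdT andbT -addn1 leq_add2l.
    have uT : (u_ hs ds T i k <= T)%N by rewrite /u_ geq_minr.
    have := null_window mu_gt0 data_poisson psi_rand a0 b0 ab1 c st tu uT mu_cst.
    move=> /le_trans; apply; rewrite lee_fin /bd.
    have x0 : 0 < (t_ ds i k - s_ hs ds i k)%:R :> R by rewrite ltr0n subn_gt0.
    have y0 : 0 < (u_ hs ds T i k - t_ ds i k)%:R :> R by rewrite ltr0n subn_gt0.
    have xh : (t_ ds i k - s_ hs ds i k)%:R <= (hs i)%:R :> R.
      by rewrite ler_nat /s_ /t_; clear; lia.
    have yh : (u_ hs ds T i k - t_ ds i k)%:R <= (hs i)%:R :> R.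
      by rewrite ler_nat /u_ /t_; clear; lia.
    have hR : 0 < (hs i)%:R :> R by rewrite ltr0n.
    have TR : 0 < T%:R :> R by rewrite ltr0n.
    have -> : 4 * expR (- c) * (hs i)%:R / T%:R =
        2 * expR (- c) * (T%:R / 4 * (2 * (hs i)%:R^-1))^-1.
      by field; rewrite !gt_eqF.
    apply: ler_wpM2l; first by rewrite mulr_ge0 ?expR_ge0.
    have hV : 0 < (hs i)%:R^-1 :> R by rewrite invr_gt0.
    rewrite lef_pV2 ?posrE; first last.
    + by rewrite mulr_gt0 ?divr_gt0// mulr_gt0.
    + by rewrite mulr_gt0 ?divr_gt0// addr_gt0 ?invr_gt0.
    apply: ler_wpM2l; first by rewrite divr_ge0 ?ltW.
    have xV : (hs i)%:R^-1 <= (t_ ds i k - s_ hs ds i k)%:R^-1 :> R by rewrite lef_pV2.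
    have yV : (hs i)%:R^-1 <= (u_ hs ds T i k - t_ ds i k)%:R^-1 :> R by rewrite lef_pV2.
    lra.
rewrite lee_fin.
have -> : 4 * expR (- c) * window_sum hs ds T =
    \sum_(i < M | (1 <= i)%N) 4 * expR (- c) * ((hs i)%:R / (ds i)%:R).
  rewrite /window_sum mulr_sumr (big_nat_widenl _ 0)//= big_mkord.
  by apply: eq_bigl.
rewrite (_ : \sum_(p | Q p) bd p = \sum_(i < M | (1 <= i)%N)
    \sum_(k < T | (1 <= k)%N && (k <= grid_size ds T i)%N) bd (i, k)); last first.
  rewrite pair_big_dep/=; apply: eq_big => [[i k]|[i k]] //=.
apply: ler_sum => i i1; rewrite /bd/= sumr_const.
have d0 : 0 < (ds i)%:R :> R by rewrite ltr0n ds1.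
have cardK : (#|[pred k : 'I_T | (1 <= k)%N && (k <= grid_size ds T i)%N]|
    <= grid_size ds T i)%N.
  rewrite -[leqRHS](card_ord (grid_size ds T i)).
  have inj (k : 'I_T) : (k.-1 < grid_size ds T i)%N ||
      ~~ ((1 <= k)%N && (k <= grid_size ds T i)%N) by clear; lia.
  pose f (k : 'I_T) : option 'I_(grid_size ds T i) := insub k.-1.
  rewrite cardE -(size_map f).
  have -> : #|'I_(grid_size ds T i)| =
     size (map some (enum 'I_(grid_size ds T i))) by rewrite size_map cardE.
  apply: uniq_leq_size.
    rewrite map_inj_in_uniq ?enum_uniq// => k k'.
    rewrite !mem_enum !inE => /andP[k1 kK] /andP[k1' kK'].
    have h1 : (k.-1 < grid_size ds T i)%N by clear -k1 kK; lia.
    have h2 : (k'.-1 < grid_size ds T i)%N by clear -k1' kK'; lia.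
    rewrite /f !insubT => -[e]; apply: val_inj => /=.
    by clear -e k1 k1'; lia.
  move=> o /mapP[k]; rewrite mem_enum inE => /andP[k1 kK] ->.
  have h1 : (k.-1 < grid_size ds T i)%N by clear -k1 kK; lia.
  by rewrite /f insubT; apply/mapP; exists (Ordinal h1); rewrite ?mem_enum.
case: (posnP T) => [T0|T0].
  rewrite (_ : #|_| = 0%N); last first.
    apply: eq_card0 => k; have kT := ltn_ord k.
    by exfalso; move: kT; rewrite [X in (_ < X)%N]T0.
  by rewrite mulr0n mulr_ge0 ?mulr_ge0 ?expR_ge0 ?divr_ge0.
have TR : 0 < T%:R :> R by rewrite ltr0n.
apply: (@le_trans _ _ (4 * expR (- c) * (hs i)%:R / T%:R *+ grid_size ds T i)).
  rewrite -[leLHS]mulr_natr -[leRHS]mulr_natr.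
  by apply: ler_wpM2l; rewrite ?ler_nat// !mulr_ge0 ?expR_ge0 ?invr_ge0.
have gT : (grid_size ds T i)%:R <= T%:R / (ds i)%:R :> R.
  rewrite ler_pdivlMr// -natrM ler_nat.
  apply: leq_trans (leq_trunc_div (T - 1) (ds i)) _; exact: leq_subr.
rewrite -mulr_natr.
have -> : 4 * expR (- c) * ((hs i)%:R / (ds i)%:R) =
   4 * expR (- c) * (hs i)%:R / T%:R * (T%:R / (ds i)%:R).
  by field; rewrite !gt_eqF.
by rewrite ler_wpM2l// !mulr_ge0 ?expR_ge0 ?invr_ge0.
Qed.

End scan.

(** * Poisson tails at the exponential scale *)

Section poisson_tails.
Context {R : realType}.
Implicit Types (A B L al be r : R).

(** A Poisson count of mean [A] is close to [x * A] with a probability of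
    [expR (- A * pois_rate x)], up to factors polynomial in [A]. *)
Definition pois_rate (x : R) : R := x * ln x - x + 1.

Lemma pois_upper_tail A al K : 0 <= A -> 1 <= al ->
  \sum_(0 <= y < K) pois A y * (~~ (y%:R <= al * A))%:R
  <= expR (- (A * pois_rate al)).
Proof.
move=> A0 al1; have al0 : 0 < al by lra.
have l0 : 0 <= ln al := ln_ge0 al1.
apply: (@le_trans _ _ (expR (- (al * A * ln al)) * expR (A * (al - 1)))); last first.
  by rewrite -expRD ler_expR /pois_rate; lra.
apply: le_trans (ler_wpM2l (expR_ge0 _) (@sum_pois_tilt _ A al K A0 (ltW al0))).
rewrite mulr_sumr; apply: ler_sum => y _; rewrite mulrCA.
apply: ler_wpM2l; first exact: pois_ge0.
case: (lerP y%:R (al * A)) => h /=.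
  by rewrite mulr_ge0 ?expR_ge0 ?exprn_ge0 ?ltW.
have -> : al ^+ y = expR (y%:R * ln al) by rewrite expRM_natl lnK ?posrE.
rewrite -expRD -[leLHS]expR0 ler_expR.
have : 0 <= (y%:R - al * A) * ln al by rewrite mulr_ge0// subr_ge0 ltW.
lra.
Qed.

Lemma pois_lower_tail L B be r K : 0 <= L -> 0 < be -> be <= r -> r * L <= B ->
  \sum_(0 <= y < K) pois B y * (~~ (be * L <= y%:R))%:R
  <= expR (- (L * (r * pois_rate (be / r)))).
Proof.
move=> L0 be0 ber rLB; have r0 : 0 < r := lt_le_trans be0 ber.
pose z := be / r; have z0 : 0 < z by rewrite divr_gt0.
have z1 : z <= 1 by rewrite ler_pdivrMr// mul1r.
have B0 : 0 <= B by rewrite (le_trans _ rLB)// mulr_ge0// ltW.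
have l0 : ln z <= 0 := ln_le0 z1.
have rz : r * z = be by rewrite /z mulrC divfK// gt_eqF.
apply: (@le_trans _ _ (expR (- (be * L * ln z)) * expR (B * (z - 1)))); last first.
  rewrite -expRD ler_expR /pois_rate -/z.
  have h : B * (z - 1) <= r * L * (z - 1) by apply: ler_wnM2r => //; lra.
  have e : r * L * (z - 1) = L * (be - r) by rewrite -rz; ring.
  have -> : - (L * (r * (z * ln z - z + 1))) = - (be * L * ln z) + L * (be - r).
    by rewrite -rz; ring.
  lra.
apply: le_trans (ler_wpM2l (expR_ge0 _) (@sum_pois_tilt _ B z K B0 (ltW z0))).
rewrite mulr_sumr; apply: ler_sum => y _; rewrite mulrCA.
apply: ler_wpM2l; first exact: pois_ge0.
case: (lerP (be * L) y%:R) => h /=.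
  by rewrite mulr_ge0 ?expR_ge0 ?exprn_ge0 ?ltW.
have -> : z ^+ y = expR (y%:R * ln z) by rewrite expRM_natl lnK ?posrE.
rewrite -expRD -[leLHS]expR0 ler_expR.
have : 0 <= (y%:R - be * L) * ln z by rewrite mulr_le0// subr_le0 ltW.
lra.
Qed.

Lemma sum_bad_split A B (P1 P2 : pred nat) K : 0 <= A -> 0 <= B ->
  \sum_(0 <= y1 < K) \sum_(0 <= y2 < K)
     pois A y1 * pois B y2 * (~~ (P1 y1 && P2 y2))%:R
  <= \sum_(0 <= y < K) pois A y * (~~ P1 y)%:R +
     \sum_(0 <= y < K) pois B y * (~~ P2 y)%:R.
Proof.
move=> A0 B0.
apply: (@le_trans _ _ (\sum_(0 <= y1 < K) \sum_(0 <= y2 < K)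
   (pois A y1 * (~~ P1 y1)%:R * pois B y2 +
    pois A y1 * (pois B y2 * (~~ P2 y2)%:R)))).
  apply: ler_sum => y1 _; apply: ler_sum => y2 _.
  have a := pois_ge0 y1 A0; have b := pois_ge0 y2 B0.
  have ab := mulr_ge0 a b.
  by case: (P1 y1); case: (P2 y2) => /=; lra.
have S0 (C : R) (Q : pred nat) : 0 <= C -> 0 <= \sum_(0 <= y < K) pois C y * (~~ Q y)%:R.
  by move=> C0; apply: sumr_ge0 => y _; apply: mulr_ge0 => //; exact: pois_ge0.
under eq_bigr do rewrite big_split/=.
rewrite big_split/=; apply: lerD.
  rewrite -(big_distrlr _ _ _ _ _ (fun y => pois A y * (~~ P1 y)%:R) (pois B))/=.
  by rewrite ler_piMr// ?S0 ?sum_pois_le1.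
rewrite -(big_distrlr _ _ _ _ _ (pois A) (fun y => pois B y * (~~ P2 y)%:R))/=.
by rewrite ler_piMl// ?S0 ?sum_pois_le1.
Qed.

Lemma far_bad_swap A B inc al be L dl K :
  (forall K, \sum_(0 <= y1 < K) \sum_(0 <= y2 < K)
     pois (if inc then A else B) y1 * pois (if inc then B else A) y2 *
     (~~ ((y1%:R <= al * L) && (be * L <= y2%:R)))%:R <= dl) ->
  \sum_(0 <= y1 < K) \sum_(0 <= y2 < K)
     pois A y1 * pois B y2 * (~~ far_apart inc al be L y1 y2)%:R <= dl.
Proof.
rewrite /far_apart; case: inc; first exact.
move=> /(_ K); rewrite exchange_big/=; apply: le_trans.
rewrite le_eqVlt; apply/orP; left; apply/eqP.
by apply: eq_bigr => y1 _; apply: eq_bigr => y2 _; rewrite [pois B _ * _]mulrC.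
Qed.

(** A Poisson count of mean [A + B] is the sum of one of mean [A] and of another
    one, hence larger. *)
Lemma sum_pois_lt_mono A B k : 0 <= A -> 0 <= B ->
  \sum_(0 <= z < k) pois (A + B) z <= \sum_(0 <= z < k) pois A z.
Proof.
move=> A0 B0.
have -> : \sum_(0 <= z < k) pois (A + B) z =
    \sum_(0 <= z < k) \sum_(0 <= x < k | (x <= z)%N) pois A x * pois B (z - x).
  apply: eq_big_nat => z /= zk; rewrite pois_conv.
  rewrite -(big_mkord xpredT (fun x => pois A x * pois B (z - x))).
  by rewrite (big_nat_widen _ _ k)//.
rewrite (exchange_big_dep_nat xpredT)//=; apply: ler_sum_nat => x /= xk.
rewrite -mulr_sumr ler_piMr ?pois_ge0//.
rewrite -(big_nat_widenl _ 0 _ xpredT (fun z => pois B (z - x)))// -{1}[x]add0n big_addn.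
by under eq_bigr do rewrite addnK; exact: sum_pois_le1.
Qed.

Lemma pois_le1 A k : 0 <= A -> pois A k <= 1.
Proof.
move=> A0; apply: le_trans (sum_pois_le1 k.+1 A0).
by rewrite big_nat_recr//= lerDr sumr_ge0// => i _; exact: pois_ge0.
Qed.

(** A single pair of counts already carries the probability that matters at
    the exponential scale. *)
Lemma far_bad_point A B B0 al be L k1 k2 K : 0 <= A -> 0 <= B0 -> B0 <= B ->
  k1%:R <= al * L -> be * L <= k2%:R ->
  \sum_(0 <= y1 < K) \sum_(0 <= y2 < K) pois A y1 * pois B y2 *
     (~~ ((y1%:R <= al * L) && (be * L <= y2%:R)))%:R
  <= 1 - pois A k1 * pois B0 k2.
Proof.
move=> A0 B00 B0B k1L k2L; have Bge : 0 <= B := le_trans B00 B0B.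
have tailB : \sum_(0 <= y < K) pois B y * (~~ (be * L <= y%:R))%:R
    <= 1 - pois B0 k2.
  apply: (@le_trans _ _ (\sum_(0 <= y < k2) pois B y)).
    rewrite (bigID (fun y => (y < k2)%N))/= [X in _ + X]big1 ?addr0; last first.
      move=> y; rewrite -leqNgt => yk.
      by rewrite (le_trans k2L) ?ler_nat//= mulr0.
    apply: (@le_trans _ _ (\sum_(0 <= y < K | (y < k2)%N) pois B y)).
      apply: ler_sum => y _; have := pois_ge0 y Bge.
      by case: (be * L <= y%:R) => /=; lra.
    have h : (K <= K + k2)%N by rewrite leq_addr.
    rewrite (big_nat_widen _ _ _ _ _ h).
    rewrite [leRHS](big_nat_widen _ _ (K + k2)) ?leq_addl//.
    rewrite [leLHS]big_mkcond [leRHS]big_mkcond; apply: ler_sum => y _ /=.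
    by case: (y < k2)%N; case: (y < K)%N => //=; exact: pois_ge0.
  have -> : B = B0 + (B - B0) by ring.
  apply: le_trans (@sum_pois_lt_mono B0 (B - B0) k2 B00 _) _.
    by rewrite subr_ge0.
  have := sum_pois_le1 k2.+1 B00; rewrite big_nat_recr//=; lra.
have pA1 := pois_le1 k1 A0; have pA0 := pois_ge0 k1 A0.
apply: (@le_trans _ _ (\sum_(0 <= y1 < K)
   (pois A y1 * (y1 != k1)%:R + pois A y1 * (y1 == k1)%:R * (1 - pois B0 k2)))).
  apply: ler_sum => y1 _; have p0 := pois_ge0 y1 A0.
  case: (eqVneq y1 k1) => [->|_] /=.
    rewrite mulr0 add0r mulr1 k1L /=.
    rewrite (eq_bigr (fun y => pois A k1 * (pois B y * (~~ (be * L <= y%:R))%:R))).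
      by rewrite -mulr_sumr ler_wpM2l.
    by move=> y _; rewrite mulrA.
  rewrite mulr1 mulr0 mul0r addr0.
  apply: (@le_trans _ _ (\sum_(0 <= y < K) pois A y1 * pois B y)).
    apply: ler_sum => y _; have := mulr_ge0 p0 (pois_ge0 y Bge).
    by case: (_ && _) => /=; lra.
  by rewrite -mulr_sumr ler_piMr// sum_pois_le1.
have pB1 := pois_le1 k2 B00; have pB0 := pois_ge0 k2 B00.
have h1 : \sum_(0 <= y < K) (pois A y * (y != k1)%:R + pois A y * (y == k1)%:R) <= 1.
  rewrite (eq_bigr (pois A)) ?sum_pois_le1// => y _.
  by case: (y == k1) => /=; lra.
have h2 : \sum_(0 <= y < K) pois A y * (y != k1)%:R <= 1 - pois A k1.
  have := sum_pois_le1 (K + k1.+1) A0.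
  rewrite (bigD1_seq k1) ?iota_uniq//=; last first.
    by rewrite mem_index_iota addnS ltnS leq_addl.
  have : \sum_(0 <= y < K) pois A y * (y != k1)%:R <=
      \sum_(0 <= y < K + k1.+1 | y != k1) pois A y.
    rewrite (eq_bigr (fun y => if y != k1 then pois A y else 0)); last first.
      by move=> y _; case: (y != k1); rewrite ?mulr1 ?mulr0.
    rewrite [leRHS]big_mkcond [leRHS](big_cat_nat (n := K)) ?leq_addr//= lerDl.
    by apply: sumr_ge0 => y _; case: ifP => // _; exact: pois_ge0.
  lra.
move: h1; rewrite !big_split/= -mulr_suml.
set u := \sum_(0 <= y < K) _ * (_ != _)%:R in h2 *.
set v := \sum_(0 <= y < K) _ * (_ == _)%:R => h1.
have : v * (1 - pois B0 k2) <= (1 - u) * (1 - pois B0 k2).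
  by apply: ler_wpM2r; lra.
have : (u - (1 - pois A k1)) * pois B0 k2 <= 0.
  by rewrite mulr_le0_ge0//; lra.
lra.
Qed.

(** Stirling's formula up to a factor of order [k ^ (1 / 2)], by induction from
    [(1 + 1 / k) ^ (k + 1) >= e]. *)
Lemma fact_le_pow k : (1 <= k)%N ->
  k`!%:R <= k%:R ^+ k.+1 * expR (1 - k%:R) :> R.
Proof.
elim: k => // k IH _; case: k IH => [|k] IH.
  by rewrite subrr expR0 mulr1 expr1n.
set x : R := k.+1%:R; have x0 : 0 < x :> R by rewrite ltr0n.
have x1 : k.+2%:R = x + 1 :> R by rewrite -natr1.
rewrite factS natrM x1.
apply: le_trans (ler_wpM2l _ (IH isT)) _; first by rewrite addr_ge0// ltW.
rewrite -/x [(x + 1) ^+ _]exprS -mulrA ler_pM2l ?addr_gt0//.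
have -> : expR (1 - x) = expR (1 - (x + 1)) * expR 1 by rewrite -expRD; congr expR; ring.
rewrite [expR (1 - (x + 1)) * _]mulrC mulrA ler_pM2r ?expR_gt0//.
rewrite -ler_pdivlMl ?exprn_gt0// mulrC -expr_div_n.
have q0 : 0 < (x + 1) / x by rewrite divr_gt0 ?addr_gt0.
have -> : ((x + 1) / x) ^+ k.+2 = expR (k.+2%:R * ln ((x + 1) / x)).
  by rewrite expRM_natl lnK ?posrE.
rewrite ler_expR.
have h := @ln_ge1V R ((x + 1) / x) q0.
have : k.+2%:R * (1 - ((x + 1) / x)^-1) <= k.+2%:R * ln ((x + 1) / x).
  by rewrite ler_wpM2l.
rewrite {1}x1 invf_div.
have -> : (x + 1) * (1 - x / (x + 1)) = 1 by field; rewrite gt_eqF// addr_gt0.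
by [].
Qed.

Lemma pois_ge (a : R) k : 0 < a -> (1 <= k)%N ->
  expR (k%:R - 1 - a - k%:R * ln (k%:R / a) - ln k%:R) <= pois a k.
Proof.
move=> a0 k1; have k0 : 0 < k%:R :> R by rewrite ltr0n.
have f0 : 0 < k`!%:R :> R by rewrite ltr0n fact_gt0.
rewrite /pois mulrAC ler_pdivlMr//.
apply: le_trans (ler_wpM2l (expR_ge0 _) (fact_le_pow k1)) _.
have e (x : R) m : 0 < x -> x ^+ m = expR (m%:R * ln x).
  by move=> x0; rewrite expRM_natl lnK ?posrE.
rewrite (e k%:R)// (e a)// -!expRD ler_expR ln_div ?posrE// -natr1.
lra.
Qed.

Lemma ln_le (x y : R) : 0 < x -> x <= y -> ln x <= ln y.
Proof.
by move=> x0 xy; rewrite ler_ln ?posrE//; exact: lt_le_trans xy.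
Qed.

(** The integer part of [al * L] costs a factor polynomial in [L]. *)
Lemma pois_floor L al : 0 < al -> al <= 1 -> 2 <= al * L ->
  exists2 k : nat, k%:R <= al * L &
    expR (- (L * pois_rate al) - 2 - ln L) <= pois L k.
Proof.
move=> al0 al1 alL.
have L0 : 0 < L by rewrite -(pmulr_rgt0 _ al0); lra.
have aL0 : 0 <= al * L by lra.
have /andP[k_le k_gt] := truncn_itv aL0.
set k := Num.truncn (al * L) in k_le k_gt.
have k1 : (1 <= k)%N by rewrite -(ler_nat R); move: k_gt; rewrite -natr1; lra.
exists k => //; apply: le_trans (pois_ge L0 k1); rewrite ler_expR.
have k0 : 0 < k%:R :> R by rewrite ltr0n.
have lnk : ln k%:R <= ln al + ln L.
  by rewrite -lnM ?posrE//; exact: ln_le.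
have kL : k%:R * ln (k%:R / L) <= k%:R * ln al.
  apply: ler_wpM2l; first exact: ltW.
  by apply: ln_le; [exact: divr_gt0|rewrite ler_pdivrMr].
have lal := ln_le0 al1.
have h : k%:R * ln al <= (al * L - 1) * ln al.
  by apply: ler_wnM2r => //; move: k_gt; rewrite -natr1; lra.
move: k_gt; rewrite -natr1 /pois_rate; lra.
Qed.

(** For the larger of the two counts the integer above [be * L] is used; the
    step from [be * L] to it costs a bounded factor. *)
Lemma pois_ceil L be r : 0 < r -> r <= be -> 1 <= be * L ->
  exists2 k : nat, be * L <= k%:R &
    expR (- (L * (r * pois_rate (be / r))) - 1 - ln (2 * be / r) -
       (ln (2 * be) + ln L)) <= pois (r * L) k.
Proof.
move=> r0 rbe beL; have be0 : 0 < be := lt_le_trans r0 rbe.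
have L0 : 0 < L by rewrite -(pmulr_rgt0 _ be0); lra.
have bL0 : 0 <= be * L by lra.
have /andP[k_le k_gt] := truncn_itv bL0.
set m := Num.truncn (be * L) in k_le k_gt.
set k := m.+1 in k_gt.
have km : k%:R = m%:R + 1 :> R by rewrite natr1.
exists k; first exact: ltW.
have rL0 : 0 < r * L by rewrite mulr_gt0.
apply: le_trans (pois_ge rL0 (ltn0Sn m)); rewrite -/k ler_expR.
have k0 : 0 < k%:R :> R by rewrite ltr0n.
have k2 : k%:R <= 2 * be * L by rewrite km; lra.
have lnk : ln k%:R <= ln (2 * be) + ln L.
  by rewrite -lnM ?posrE ?mulr_gt0//; exact: ln_le.
set a := r * L in rL0 *; set x0 := be * L in beL bL0 k_le k_gt *.
have x00 : 0 < x0 by lra.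
have lnka : ln (k%:R / a) <= ln (2 * be / r).
  apply: ln_le; first by rewrite divr_gt0.
  by rewrite ler_pdivrMr// /a mulrA divfK ?gt_eqF.
have lnka0 : 0 <= ln (k%:R / a).
  apply: ln_ge0; rewrite ler_pdivlMr// mul1r /a.
  by apply: le_trans (ltW k_gt); rewrite /x0 ler_wpM2r// ltW.
have split : ln (k%:R / a) = ln (k%:R / x0) + ln (x0 / a).
  by rewrite !ln_div ?posrE//; lra.
have h1 : x0 * ln (k%:R / x0) <= k%:R - x0.
  have kx : 0 < k%:R / x0 by rewrite divr_gt0.
  have := le_ln1Dx (_ : -1 < k%:R / x0 - 1).
  rewrite (_ : 1 + (k%:R / x0 - 1) = k%:R / x0); last by ring.
  rewrite ltrDr kx => /(_ isT) h.
  have := ler_wpM2l (ltW x00) h.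
  by rewrite mulrBr mulr1 [x0 * (_ / x0)]mulrC divfK ?gt_eqF.
have h2 : (k%:R - x0) * ln (k%:R / a) <= ln (k%:R / a).
  by rewrite ler_piMl//; rewrite km; lra.
have e : L * (r * pois_rate (be / r)) = x0 * ln (x0 / a) - x0 + a.
  have -> : x0 / a = be / r by rewrite /x0 /a; field; rewrite !gt_eqF.
  by rewrite /pois_rate /x0 /a; field; rewrite gt_eqF.
rewrite e.
have h3 : x0 * ln (k%:R / a) = x0 * ln (k%:R / x0) + x0 * ln (x0 / a).
  by rewrite split mulrDr.
lra.
Qed.

(** Since [al <= 1] and [r <= be], counts this far apart are atypical; the two
    integers next to [al L] and [be L] have most of their probability at the
    exponential scale. *)
Lemma far_bad_rate L B al be r K : 0 < al -> al <= 1 -> 0 < r -> r <= be ->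
  2 <= al * L -> 1 <= be * L -> r * L <= B ->
  \sum_(0 <= y1 < K) \sum_(0 <= y2 < K) pois L y1 * pois B y2 *
     (~~ ((y1%:R <= al * L) && (be * L <= y2%:R)))%:R
  <= 1 - expR (- (L * (pois_rate al + r * pois_rate (be / r)))
       - (3 + ln (2 * be / r) + ln (2 * be)) - 2 * ln L).
Proof.
move=> al0 al1 r0 rbe alL beL rLB.
have L0 : 0 < L by rewrite -(pmulr_rgt0 _ al0); lra.
have [k1 k1L p1] := pois_floor al0 al1 alL.
have [k2 k2L p2] := pois_ceil r0 rbe beL.
have rL0 : 0 <= r * L by rewrite mulr_ge0// ltW.
apply: le_trans (far_bad_point K (ltW L0) rL0 rLB k1L k2L) _.
rewrite lerD2l lerN2; apply: le_trans (ler_pM (expR_ge0 _) (expR_ge0 _) p1 p2).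
by rewrite -expRD ler_expR; lra.
Qed.

(** Here [1 <= al] and [be <= r], so that typical counts are far apart. *)
Lemma far_bad_tail L B al be r K : 0 <= L -> 1 <= al -> 0 < be -> be <= r ->
  r * L <= B ->
  \sum_(0 <= y1 < K) \sum_(0 <= y2 < K) pois L y1 * pois B y2 *
     (~~ ((y1%:R <= al * L) && (be * L <= y2%:R)))%:R
  <= expR (- (L * pois_rate al)) + expR (- (L * (r * pois_rate (be / r)))).
Proof.
move=> L0 al1 be0 ber rLB; have r0 := lt_le_trans be0 ber.
have B0 : 0 <= B by rewrite (le_trans _ rLB)// mulr_ge0// ltW.
apply: le_trans (@sum_bad_split L B (fun y => y%:R <= al * L)
  (fun y => be * L <= y%:R) K L0 B0) _.
by apply: lerD; [exact: pois_upper_tail|exact: pois_lower_tail].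
Qed.

Lemma pois_rate_ge0 (x : R) : 0 < x -> 0 <= pois_rate x.
Proof.
move=> x0; have := ler_wpM2l (ltW x0) (ln_ge1V x0).
by rewrite mulrBr mulr1 mulfV ?gt_eqF// /pois_rate; lra.
Qed.

Lemma pois_rate_gt0 (x : R) : 0 < x -> x != 1 -> 0 < pois_rate x.
Proof.
move=> x0 x1; pose y := - ln x.
have y0 : y != 0 by rewrite oppr_eq0 ln_eq0.
have := expR_gt1Dx y0; rewrite /y expRN lnK ?posrE// => h.
have : x * (1 - ln x) < x * x^-1 by rewrite ltr_pM2l.
by rewrite mulfV ?gt_eqF// /pois_rate; lra.
Qed.

End poisson_tails.

(** * The optimal counts and the detection boundary *)

(** Used with [g] the denominator of [rho] and [m] a positive lower bound of
    it: the set whose supremum is [rho] is bounded. *)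
Lemma ratio_bound (R : realType) (b x m g : R) : 0 < b -> 0 <= x -> 0 < m ->
  m <= g -> (b - x) / g <= b / m.
Proof.
move=> b0 x0 m0 mg; have g0 := lt_le_trans m0 mg.
apply: (@le_trans _ _ (b / g)).
  by rewrite ler_wpM2r ?invr_ge0 ?(ltW g0)// gerBl.
by rewrite ler_wpM2l ?(ltW b0)// lef_pV2 ?posrE.
Qed.

Section rate_optimisation.
Context {R : realType}.

Lemma ln_gt1V (x : R) : 0 < x -> x != 1 -> 1 - x^-1 < ln x.
Proof.
move=> x0 x1; have := pois_rate_gt0 x0 x1; rewrite /pois_rate => h.
rewrite -(ltr_pM2l x0) mulrBr mulr1 mulfV ?gt_eqF//; lra.
Qed.

Lemma tail_rate_gt0 (al be : R) : 0 < al -> al < be -> 0 < tail_rate al be.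
Proof.
move=> al0 albe; have be0 : 0 < be := lt_trans al0 albe.
have s0 : 0 < al + be by rewrite addr_gt0.
have h1 : al * (1 - (2 * al / (al + be))^-1) < al * ln (2 * al / (al + be)).
  rewrite ltr_pM2l//; apply: ln_gt1V; first by rewrite divr_gt0// mulr_gt0.
  by rewrite lt_eqF// ltr_pdivrMr//; lra.
have h2 : be * (1 - (2 * be / (al + be))^-1) <= be * ln (2 * be / (al + be)).
  by rewrite ler_wpM2l// ?(ltW be0)// ln_ge1V// divr_gt0// mulr_gt0.
rewrite /tail_rate; apply: le_lt_trans (ltr_leD h1 h2).
rewrite !invf_div le_eqVlt; apply/orP; left; apply/eqP.
by field; rewrite !gt_eqF.
Qed.

Variable r : R.
Hypothesis r1 : 1 < r.
Let r0 : 0 < r.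
Proof. exact: lt_trans r1. Qed.
Let lr := ln r.
Let lr0 : 0 < lr.
Proof. by have := r1; exact: ln_gt0. Qed.

Lemma I_tail_rate : I_ r = tail_rate 1 r.
Proof. by rewrite /I_ /tail_rate [RHS]addrC mulr1 mul1r [1 + r]addrC. Qed.

Lemma I_gt0 : 0 < I_ r.
Proof. by rewrite I_tail_rate; exact: tail_rate_gt0. Qed.

Definition log_g (w : R) : R := ln ((1 + expR (w * ln r)) / 2) / w.

Let log_gK w : 0 < w -> w * log_g w = ln ((1 + expR (w * lr)) / 2).
Proof. by move=> w0; rewrite /log_g mulrC divfK// gt_eqF. Qed.

Lemma g_log_g w : g_ r w = expR (log_g w).
Proof.
have hp : 0 < (1 + r `^ w) / 2 by rewrite divr_gt0// ltr_wpDr ?powR_ge0.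
rewrite /g_ {1}/powR gt_eqF// mulrC /log_g.
by rewrite {1}/powR gt_eqF.
Qed.

Lemma log_g_ge0 w : 0 < w -> 0 <= log_g w.
Proof.
move=> w0; rewrite divr_ge0 ?(ltW w0)// ln_ge0// ler_pdivlMr// mul1r.
have : 1 <= expR (w * lr) by rewrite -expR0 ler_expR mulr_ge0// ltW.
by lra.
Qed.

Lemma log_g_le w : 0 < w -> log_g w <= lr.
Proof.
move=> w0; rewrite -(ler_pM2l w0) log_gK//.
have e1 : 1 <= expR (w * lr) by rewrite -expR0 ler_expR mulr_ge0// ltW.
rewrite -{2}[w * lr]expRK; apply: ln_le; first by rewrite divr_gt0// addr_gt0 ?expR_gt0.
by rewrite ler_pdivrMr//; lra.
Qed.

(** The counts, relative to the smaller rate, at which it is cheapest to reach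
    a small p-value. *)
Definition opt_al (w : R) : R := expR ((1 - w) * log_g w).
Definition opt_be (w : R) : R := expR (w * lr + (1 - w) * log_g w).
(** The exponents of the p-value and of the probability of the optimal counts
    are multiples of this quantity, the latter up to the difference
    [opt_gain], which is the denominator of [rho]. *)
Definition opt_gap (w : R) : R := opt_be w * lr - 2 * g_ r w * log_g w.
Definition opt_gain (w : R) : R := 2 * g_ r w - 1 - r.

Lemma opt_sum w : 0 < w -> opt_al w + opt_be w = 2 * g_ r w.
Proof.
move=> w0; rewrite /opt_al /opt_be expRD g_log_g.
have e : expR (w * log_g w) = (1 + expR (w * lr)) / 2.
  by rewrite log_gK// lnK// posrE divr_gt0// addr_gt0// expR_gt0.
have -> : expR (log_g w) = expR ((1 - w) * log_g w) * expR (w * log_g w).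
  by rewrite -expRD; congr expR; ring.
by rewrite e; field.
Qed.

Lemma opt_tail_rate w : 0 < w -> tail_rate (opt_al w) (opt_be w) = w * opt_gap w.
Proof.
move=> w0; rewrite /tail_rate opt_sum// /opt_gap.
have g0 : 0 < g_ r w by rewrite g_log_g expR_gt0.
have e1 : ln (2 * opt_al w / (2 * g_ r w)) = - (w * log_g w).
  have -> : 2 * opt_al w / (2 * g_ r w) = opt_al w / g_ r w.
    by field; rewrite gt_eqF.
  rewrite ln_div ?posrE ?expR_gt0// g_log_g /opt_al !expRK; ring.
have e2 : ln (2 * opt_be w / (2 * g_ r w)) = w * lr - w * log_g w.
  have -> : 2 * opt_be w / (2 * g_ r w) = opt_be w / g_ r w.
    by field; rewrite gt_eqF.
  rewrite ln_div ?posrE ?expR_gt0// g_log_g /opt_be !expRK; ring.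
rewrite e1 e2 -opt_sum//; ring.
Qed.

Lemma opt_cost w : 0 < w ->
  pois_rate (opt_al w) + r * pois_rate (opt_be w / r) =
  (w - 1) * opt_gap w - opt_gain w.
Proof.
move=> w0; rewrite /pois_rate.
have -> : ln (opt_be w / r) = (w - 1) * (lr - log_g w).
  by rewrite ln_div ?posrE ?expR_gt0// /opt_be expRK -/lr; ring.
rewrite /opt_gap /opt_gain -opt_sum//.
have -> : ln (opt_al w) = (1 - w) * log_g w by rewrite /opt_al expRK.
by field; rewrite gt_eqF.
Qed.

Lemma opt_al_bounds w : 1 <= w <= 2 -> r^-1 <= opt_al w <= 1.
Proof.
move=> /andP[w1 w2]; have w0 : 0 < w by lra.
have h0 := log_g_ge0 w0; have h1 := log_g_le w0.
rewrite /opt_al -{1}[r]lnK ?posrE// -expRN -[X in _ <= _ <= X]expR0 !ler_expR.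
rewrite -/lr; apply/andP; split; last by rewrite mulr_le0_ge0// subr_le0.
have : (w - 1) * log_g w <= 1 * lr by rewrite ler_pM ?subr_ge0//; lra.
lra.
Qed.

Lemma opt_be_bounds w : 1 <= w <= 2 -> r <= opt_be w <= r ^+ 2.
Proof.
move=> /andP[w1 w2]; have w0 : 0 < w by lra.
have h0 := log_g_ge0 w0; have h1 := log_g_le w0.
have -> : r ^+ 2 = expR (2 * lr) by rewrite expRM_natl lnK ?posrE.
have -> : opt_be w = expR (w * lr + (1 - w) * log_g w) by [].
rewrite -{1}[r]lnK ?posrE// !ler_expR -/lr.
have a : (w - 1) * log_g w <= (w - 1) * lr by rewrite ler_wpM2l ?subr_ge0.
have b : 0 <= (w - 1) * log_g w by rewrite mulr_ge0 ?subr_ge0.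
have c : (w - 1) * lr <= 1 * lr by rewrite ler_wpM2r ?(ltW lr0)//; lra.
by apply/andP; split; lra.
Qed.

(** The tangent of the logarithm bounds [g_ r w] below by [log_g w],
    and the concavity of the logarithm bounds [log_g w].  In particular the
    denominator of [rho] stays away from [0] for [w] away from [1]. *)
Lemma opt_gain_ge w : 1 <= w -> (1 - w^-1) * I_ r <= opt_gain w.
Proof.
move=> w1; have w0 : 0 < w by lra.
pose k := ln ((1 + r) / 2).
have rp : 0 < 1 + r by rewrite addr_gt0.
have kp : 0 < (1 + r) / 2 by rewrite divr_gt0.
have IE : I_ r = r * (lr - k) - k.
  rewrite /I_; have -> : 2 * r / (r + 1) = r / ((1 + r) / 2).
    by field; rewrite !gt_eqF// addrC.
  have -> : 2 / (r + 1) = ((1 + r) / 2)^-1 by field; rewrite !gt_eqF// addrC.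
  by rewrite ln_div ?posrE// lnV ?posrE.
have h1 : (1 + r) * (log_g w - k) <= opt_gain w.
  have gp : 0 < g_ r w / ((1 + r) / 2) by rewrite divr_gt0// g_log_g expR_gt0.
  have hh : -1 < g_ r w / ((1 + r) / 2) - 1 by rewrite ltrDr.
  have := le_ln1Dx hh.
  rewrite (_ : 1 + (g_ r w / ((1 + r) / 2) - 1) = g_ r w / ((1 + r) / 2)); last by ring.
  rewrite ln_div ?posrE ?g_log_g ?expR_gt0// expRK -/k -g_log_g => h.
  have := ler_wpM2l (ltW rp) h; rewrite /opt_gain.
  have -> : (1 + r) * (g_ r w / ((1 + r) / 2) - 1) = 2 * g_ r w - (1 + r).
    by field; rewrite gt_eqF.
  lra.
have h2 : r * (w - 1) * lr + (1 + r) * k <= (1 + r) * (w * log_g w).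
  have w01 : 0 <= (1 + r)^-1 <= 1.
    by rewrite invr_ge0 (ltW rp)/= -[1]invr1 lef_pV2 ?posrE//; have := r0; lra.
  have := ln_concave2 w01 ltr01 (expR_gt0 ((w - 1) * lr)).
  rewrite ln1 mulr0 add0r expRK mulr1 => h.
  have e : (1 + r)^-1 + (1 - (1 + r)^-1) * expR ((w - 1) * lr) =
      (1 + expR (w * lr)) / 2 / ((1 + r) / 2).
    have -> : expR (w * lr) = r * expR ((w - 1) * lr).
      by rewrite -{1}[r]lnK ?posrE// -expRD -/lr; congr expR; ring.
    by field; rewrite gt_eqF.
  move: h; rewrite e ln_div ?posrE ?divr_gt0 ?addr_gt0 ?expR_gt0// -log_gK// -/k => h.
  have := ler_wpM2l (ltW rp) h.
  have -> : (1 + r) * ((1 - (1 + r)^-1) * ((w - 1) * lr)) = r * (w - 1) * lr.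
    by field; rewrite gt_eqF.
  lra.
rewrite -(ler_pM2l w0).
have -> : w * ((1 - w^-1) * I_ r) = (w - 1) * I_ r by field; rewrite gt_eqF.
have h3 := ler_wpM2l (ltW w0) h1.
rewrite IE; lra.
Qed.

Lemma opt_gain1 : opt_gain 1 = 0.
Proof.
have rp : 0 < (1 + r) / 2 by rewrite divr_gt0// addr_gt0.
have lrK : expR (ln r) = r by rewrite lnK ?posrE.
rewrite /opt_gain g_log_g /log_g divr1 mul1r lrK lnK ?posrE//.
by field.
Qed.

Lemma continuous_opt_tail (w : R) : 0 < w ->
  {for w, continuous (fun w : R => w * opt_gap w)}.
Proof.
move=> w0.
have cg : {for w, continuous log_g}.
  apply: cvgM; last by apply: cvgV; [rewrite gt_eqF|exact: cvg_id].
  have c1 : {for w, continuous (fun w : R => (1 + expR (w * ln r)) / 2)}.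
    apply: cvgM; last exact: cvg_cst.
    apply: cvgD; first exact: cvg_cst.
    have c0 : {for w, continuous (fun w : R => w * ln r)}.
      by apply: cvgM; [exact: cvg_id|exact: cvg_cst].
    exact: (continuous_comp c0 (@continuous_expR R _)).
  have p : 0 < (1 + expR (w * ln r)) / 2.
    by rewrite divr_gt0// addr_gt0// expR_gt0.
  exact: (continuous_comp c1 (continuous_ln p)).
apply: cvgM; first exact: cvg_id.
apply: cvgB.
  apply: cvgM; last exact: cvg_cst.
  have c2 : {for w, continuous (fun w : R => w * lr + (1 - w) * log_g w)}.
    apply: cvgD; first by apply: cvgM; [exact: cvg_id|exact: cvg_cst].
    by apply: cvgM => //; apply: cvgB; [exact: cvg_cst|exact: cvg_id].
  exact: (continuous_comp c2 (@continuous_expR R _)).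
apply: cvgM => //; apply: cvgM; first exact: cvg_cst.
rewrite (_ : g_ r = expR \o log_g); last by apply/funext => z; exact: g_log_g.
exact: (continuous_comp cg (@continuous_expR R _)).
Qed.

Variables z be0 : R.
Hypotheses (z01 : 0 < z < 1) (be0b : (1 - z) / 2 < be0 < 1 - z).

Lemma rho_ge w : (1 - z) / be0 < w <= 2 ->
  be0 - w^-1 * (1 - z) <= rho r be0 z * opt_gain w.
Proof.
move=> /andP[wl w2]; have /andP[b1 b2] := be0b; have /andP[z0 z1] := z01.
have bp : 0 < be0 by lra.
pose w0 := (1 - z) / be0.
have w01 : 1 < w0 by rewrite ltr_pdivlMr// mul1r.
have m0 : 0 < (1 - w0^-1) * I_ r.
  by rewrite mulr_gt0 ?I_gt0// subr_gt0 invf_lt1//; lra.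
have gain_ge v : w0 < v -> (1 - w0^-1) * I_ r <= opt_gain v.
  move=> wv; apply: le_trans (opt_gain_ge _); last by lra.
  by rewrite ler_wpM2r ?(ltW I_gt0)// lerD2l lerN2 lef_pV2 ?posrE//; lra.
have gw : 0 < opt_gain w by apply: lt_le_trans (gain_ge w wl).
rewrite -ler_pdivrMr// /rho.
apply: ub_le_sup; last by exists w => //=; rewrite wl w2.
exists (be0 / ((1 - w0^-1) * I_ r)) => _ /= [v /andP[v0 v2] <-].
have vp : 0 < v := lt_trans (lt_trans ltr01 w01) v0.
apply: (ratio_bound bp _ m0 (gain_ge v v0)).
by apply: mulr_ge0; rewrite ?invr_ge0 ?subr_ge0 ltW.
Qed.

Lemma rho_gt0 : 0 < rho r be0 z.
Proof.
have /andP[b1 b2] := be0b; have /andP[z0 z1] := z01.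
have bp : 0 < be0 by lra.
have h2 : (1 - z) / be0 < 2 <= (2 : R).
  by rewrite lexx andbT ltr_pdivrMr//; lra.
have := rho_ge h2.
have g2 : 0 < opt_gain 2.
  apply: lt_le_trans (opt_gain_ge _); last by lra.
  by rewrite mulr_gt0 ?I_gt0//; lra.
move=> h; rewrite -(pmulr_lgt0 _ g2); apply: lt_le_trans h; lra.
Qed.

(** The choice of counts behind the detection boundary: with [L = H log N]
    the chance of counts [opt_al w * L] and [opt_be w * L] is of order
    [N ^ - (H * cost)], their p-value of order [N ^ - (H * tail_rate)], and a
    p-value below [N ^ - (1 - z)] gains nothing more.  The tangency condition
    [H * tail_rate = 1 - z] picks [w] unless it falls outside of [1, 2]. *)
Lemma rate_choice (e : R) : 0 < e -> exists2 sl : R, 0 < sl &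
  forall H, (1 + e) * rho r be0 z <= H ->
  exists al be : R, [/\ r^-1 <= al, al <= 1, r <= be, be <= r ^+ 2 &
    be0 - (1 - z) / 2 + sl <=
    Num.min (H * tail_rate al be) (1 - z) / 2 -
    H * (pois_rate al + r * pois_rate (be / r))].
Proof.
move=> e0; have /andP[b1 b2] := be0b; have /andP[z0 z1] := z01.
have bp : 0 < be0 by lra.
have rh := rho_gt0; have Ir := I_gt0.
(* Up to [w2] the numerator of [rho] is at most [- sl1]; beyond [w2] its
   denominator is at least [m0]. *)
pose sl1 := (1 - z - be0) / 2.
pose w2 := (1 - z) / (be0 + sl1).
have w21 : 1 < w2 by rewrite ltr_pdivlMr /sl1; lra.
pose m0 := (1 - w2^-1) * I_ r.
have m00 : 0 < m0 by rewrite mulr_gt0// subr_gt0 invf_lt1//; lra.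
pose sl := Num.min sl1 (e * rho r be0 z * m0).
have sl10 : 0 < sl1 by rewrite divr_gt0// !subr_gt0.
have sl0 : 0 < sl by rewrite lt_min sl10 /= (mulr_gt0 (mulr_gt0 e0 rh) m00).
have sl1' : sl <= sl1 by rewrite ge_min lexx.
have sl2' : sl <= e * rho r be0 z * m0 by rewrite ge_min lexx orbT.
exists sl => // H HH.
have H0 : 0 < H by apply: lt_le_trans HH; rewrite mulr_gt0// addr_gt0.
have key w : 1 <= w <= 2 -> be0 - w^-1 * (1 - z) + sl <= H * opt_gain w.
  move=> /andP[w1 ww2]; have w0 : 0 < w by lra.
  have g0 : 0 <= opt_gain w.
    by apply: le_trans (opt_gain_ge w1); rewrite mulr_ge0 ?(ltW Ir)// subr_ge0 invf_le1.
  have [hw|hw] := leP w w2.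
    have : w2^-1 <= w^-1 by rewrite lef_pV2 ?posrE//; lra.
    have e2 : w2^-1 * (1 - z) = be0 + sl1.
      by rewrite /w2 invf_div divfK// gt_eqF//; lra.
    move=> h; have h' : w2^-1 * (1 - z) <= w^-1 * (1 - z) by rewrite ler_wpM2r//; lra.
    have : 0 <= H * opt_gain w by rewrite mulr_ge0// ltW.
    by rewrite /sl1 in e2 sl1'; lra.
  have gm : m0 <= opt_gain w.
    apply: le_trans (opt_gain_ge w1); rewrite ler_wpM2r ?(ltW Ir)// lerD2l lerN2.
    by rewrite lef_pV2 ?posrE//; lra.
  have hr : be0 - w^-1 * (1 - z) <= rho r be0 z * opt_gain w.
    have [h|h] := ltP ((1 - z) / be0) w; first by apply: rho_ge; rewrite h.
    apply: (@le_trans _ _ 0); last by rewrite mulr_ge0// ltW.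
    rewrite subr_le0 mulrC ler_pdivlMr//.
    by move: h; rewrite ler_pdivlMr// mulrC.
  have : (1 + e) * rho r be0 z * opt_gain w <= H * opt_gain w by rewrite ler_wpM2r.
  have : e * rho r be0 z * m0 <= e * rho r be0 z * opt_gain w.
    by rewrite ler_wpM2l// mulr_ge0// ltW.
  lra.
have fin w : 1 <= w <= 2 ->
    be0 - (1 - z) / 2 + sl <=
    Num.min (H * (w * opt_gap w)) (1 - z) / 2 -
    H * ((w - 1) * opt_gap w - opt_gain w) ->
  exists al be : R, [/\ r^-1 <= al, al <= 1, r <= be, be <= r ^+ 2 &
    be0 - (1 - z) / 2 + sl <=
    Num.min (H * tail_rate al be) (1 - z) / 2 -
    H * (pois_rate al + r * pois_rate (be / r))].
  move=> w12 h; have w0 : 0 < w by case/andP: w12; lra.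
  exists (opt_al w), (opt_be w); have /andP[a1 a2] := opt_al_bounds w12.
  have /andP[c1 c2] := opt_be_bounds w12.
  by split => //; rewrite opt_tail_rate// opt_cost.
(* The exponent [H * tail_rate] of the p-value at [w] is [H * (w * opt_gap w)];
   the choice is [2] if it stays below [1 - z] there, [1] if it exceeds
   [1 - z] there already, and a point of equality otherwise. *)
have [h2|h2] := leP (H * (2 * opt_gap 2)) (1 - z).
  have w12 : (1 : R) <= 2 <= (2 : R) by rewrite lexx ler1n.
  apply: (fin 2) => //; rewrite min_l//.
  by have := key 2 w12; lra.
have [h1|h1] := leP (1 - z) (H * (1 * opt_gap 1)).
  have w12 : (1 : R) <= 1 <= (2 : R) by rewrite lexx ler1n.
  apply: (fin 1) => //; rewrite min_r// opt_gain1 /sl1 in sl1' *; lra.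
have c12 : {within `[1, 2], continuous (fun w : R => H * (w * opt_gap w))}.
  apply: continuous_in_subspaceT => x /set_mem /=; rewrite in_itv/= => /andP[x1 _].
  apply: cvgM; first exact: cvg_cst.
  by apply: continuous_opt_tail; lra.
have h12 : (1 : R) <= 2 by lra.
have hv : Num.min (H * (1 * opt_gap 1)) (H * (2 * opt_gap 2)) <= 1 - z <=
    Num.max (H * (1 * opt_gap 1)) (H * (2 * opt_gap 2)).
  by rewrite ge_min le_max (ltW h1) (ltW h2) /= orbT.
have [w] := IVT h12 c12 hv; rewrite in_itv/= => w12 hw.
apply: (fin w) => //; rewrite hw minxx.
have w0 : 0 < w by case/andP: w12; lra.
have hg : H * opt_gap w = w^-1 * (1 - z).
  by rewrite -hw; field; rewrite gt_eqF.
have e3 : H * ((w - 1) * opt_gap w - opt_gain w) =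
   (1 - z) - w^-1 * (1 - z) - H * opt_gain w.
  have -> : H * ((w - 1) * opt_gap w - opt_gain w) =
    H * (w * opt_gap w) - H * opt_gap w - H * opt_gain w by ring.
  by rewrite hw hg.
rewrite e3; have := key w w12; lra.
Qed.

End rate_optimisation.

(** * Growth of the parameters with the number of sequences *)

Section growth.
Context {R : realType}.
Local Notation lN N := (ln (N%:R : R)).

Lemma near_lnN (K : R) : \forall N \near \oo, K <= lN N.
Proof.
exists (Num.truncn (expR K)).+1 => // N /= hN.
have : expR K <= N%:R.
  have /andP[_ h] := truncn_itv (expR_ge0 K).
  by apply: ltW; apply: lt_le_trans h _; rewrite ler_nat.
move=> h; rewrite -[K]expRK; apply: ln_le => //; exact: expR_gt0.
Qed.

Lemma ln_le_lin (d x : R) : 0 < d -> 0 < x -> ln x <= d * x - ln d - 1.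
Proof.
move=> d0 x0; have h : -1 < d * x - 1 by rewrite ltrDr mulr_gt0.
have := le_ln1Dx h; rewrite (_ : 1 + (d * x - 1) = d * x); last by ring.
rewrite lnM ?posrE//; lra.
Qed.

Lemma near_lnlnN (d C : R) : 0 < d ->
  \forall N \near \oo, C + ln (lN N) <= d * lN N.
Proof.
move=> d0; have d2 : 0 < d / 2 by rewrite divr_gt0.
near=> N.
have h1 : 1 <= lN N by near: N; exact: near_lnN.
have h2 : (C - ln (d / 2)) / (d / 2) <= lN N by near: N; exact: near_lnN.
have h3 : ln (lN N) <= d / 2 * lN N - ln (d / 2) - 1.
  by apply: ln_le_lin => //; lra.
move: h2; rewrite ler_pdivrMr// => h2.
lra.
Unshelve. all: by end_near. Qed.

Lemma powR_nat (N : nat) (z : R) : (0 < N)%N -> N%:R `^ z = expR (z * lN N).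
Proof. by move=> N0; rewrite /powR pnatr_eq0 gtn_eqF. Qed.

Lemma sim_to_near (f g : nat -> R) : sim_to f g ->
  (\forall N \near \oo, 0 < g N) ->
  \forall N \near \oo, g N / 2 <= f N <= 2 * g N.
Proof.
move=> fg g0.
have h1 : (1 / 2 : R) < 1 by lra.
have h2 : (1 : R) < 2 by lra.
near=> N.
have gN : 0 < g N by near: N.
have l : 1 / 2 <= f N / g N by near: N; exact: (cvgr_ge _ fg).
have u : f N / g N <= 2 by near: N; exact: (cvgr_le _ fg).
move: l u; rewrite ler_pdivlMr// ler_pdivrMr// => l u.
by rewrite u andbT; lra.
Unshelve. all: by end_near. Qed.

Variables (zeta lambda1 : R) (T : nat -> nat) (c : nat -> R).
Hypotheses (zeta01 : 0 < zeta < 1) (lambda1_gt0 : 0 < lambda1)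
  (T_infty : T N @[N --> \oo] --> \oo)
  (logT : sim_to (fun N => ln (T N)%:R) (fun N => N%:R `^ zeta : R))
  (c_logT : c =o_\oo (fun t : nat => ln t%:R : R)).

Local Notation lT N := (ln ((T N)%:R : R)).
Definition lam2 N : R := Num.sqrt (lT N / ln (lT N)).
Definition coef_a N : R := lambda1 * lN N / N%:R.
Definition coef_b N : R := lam2 N / Num.sqrt (N%:R * lN N).

Lemma near_pos : \forall N \near \oo, (0 < N)%N.
Proof. by exists 1%N. Qed.

Lemma near_lnT : \forall N \near \oo,
  expR (zeta * lN N) / 2 <= lT N <= 2 * expR (zeta * lN N).
Proof.
have g0 : \forall N \near \oo, 0 < (N%:R `^ zeta : R).
  by near=> N; rewrite powR_nat ?expR_gt0//; near: N; exact: near_pos.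
have h := sim_to_near logT g0.
near=> N; rewrite -powR_nat; first by near: N; exact: h.
by near: N; exact: near_pos.
Unshelve. all: by end_near. Qed.

Lemma near_lnlnT : \forall N \near \oo, [/\ 0 < lT N,
  zeta * lN N - 1 <= ln (lT N) & ln (lT N) <= zeta * lN N + 1].
Proof.
near=> N.
have /andP[h1 h2] : expR (zeta * lN N) / 2 <= lT N <= 2 * expR (zeta * lN N).
  by near: N; exact: near_lnT.
have e0 : 0 < expR (zeta * lN N) / 2 by rewrite divr_gt0// expR_gt0.
have lT0 : 0 < lT N := lt_le_trans e0 h1.
have l2 : ln 2 <= 1 :> R by have := @le_ln1Dx R 1; rewrite (_ : 1 + 1 = 2)//; apply; lra.
split => //.
  have := ln_le e0 h1; rewrite ln_div ?posrE ?expR_gt0// expRK; lra.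
have := ln_le lT0 h2; rewrite lnM ?posrE ?expR_gt0// expRK; lra.
Unshelve. all: by end_near. Qed.

Lemma near_lnT_ge (K : R) : \forall N \near \oo, K <= ln (lT N).
Proof.
have /andP[z0 z1] := zeta01.
near=> N.
have [_ h _] : [/\ 0 < lT N, zeta * lN N - 1 <= ln (lT N) & ln (lT N) <= zeta * lN N + 1].
  by near: N; exact: near_lnlnT.
have : (K + 1) / zeta <= lN N by near: N; exact: near_lnN.
rewrite ler_pdivrMr//; lra.
Unshelve. all: by end_near. Qed.

(** The definition of [lam2] gives [N b ^ 2 log N = log T / log log T]. *)
Lemma near_ln_b : \forall N \near \oo, 0 < coef_b N /\
  ln (coef_b N ^+ 2) = ln (lT N) - ln (ln (lT N)) - lN N - ln (lN N).
Proof.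
near=> N.
have N0 : (0 < N)%N by near: N; exact: near_pos.
have NR : 0 < N%:R :> R by rewrite ltr0n.
have x0 : 1 <= lN N by near: N; exact: near_lnN.
have y0 : 1 <= ln (lT N) by near: N; exact: near_lnT_ge.
have [lT0 _ _] : [/\ 0 < lT N, zeta * lN N - 1 <= ln (lT N) & ln (lT N) <= zeta * lN N + 1].
  by near: N; exact: near_lnlnT.
have xp : 0 < lN N by lra.
have yp : 0 < ln (lT N) by lra.
have q0 : 0 < lT N / ln (lT N) by rewrite divr_gt0.
have q1 : 0 < N%:R * lN N by rewrite mulr_gt0.
split; first by rewrite /coef_b /lam2 divr_gt0 ?sqrtr_gt0.
rewrite /coef_b /lam2 expr_div_n !sqr_sqrtr ?ltW//.
by rewrite !ln_div ?posrE// lnM ?posrE//; ring.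
Unshelve. all: by end_near. Qed.

(** [b] is of order [N ^ - ((1 - zeta) / 2)] up to powers of [log N]. *)
Lemma near_b_small (p : R) : p < (1 - zeta) / 2 ->
  \forall N \near \oo, coef_b N <= expR (- (p * lN N)).
Proof.
move=> pz; pose d := (1 - zeta) / 2 - p; have d0 : 0 < d by rewrite subr_gt0.
near=> N.
have x0 : 1 <= lN N by near: N; exact: near_lnN.
have y0 : 1 <= ln (lT N) by near: N; exact: near_lnT_ge.
have [_ _ h] : [/\ 0 < lT N, zeta * lN N - 1 <= ln (lT N) & ln (lT N) <= zeta * lN N + 1].
  by near: N; exact: near_lnlnT.
have [b0 bE] : 0 < coef_b N /\
  ln (coef_b N ^+ 2) = ln (lT N) - ln (ln (lT N)) - lN N - ln (lN N).
  by near: N; exact: near_ln_b.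
have h1 : 1 / (2 * d) <= lN N by near: N; exact: near_lnN.
have ly : 0 <= ln (ln (lT N)) := ln_ge0 y0.
have lx : 0 <= ln (lN N) := ln_ge0 x0.
rewrite -[coef_b N]lnK ?posrE// ler_expR.
move: bE; rewrite lnXn// mulr2n => bE.
move: h1; rewrite ler_pdivrMr ?mulr_gt0// /d => h1.
lra.
Unshelve. all: by end_near. Qed.

Lemma near_b_le : \forall N \near \oo, coef_b N <= expR (- ((1 - zeta) / 2 * lN N)).
Proof.
near=> N.
have x0 : 1 <= lN N by near: N; exact: near_lnN.
have y0 : expR 1 <= ln (lT N) by near: N; exact: near_lnT_ge.
have [_ _ h] : [/\ 0 < lT N, zeta * lN N - 1 <= ln (lT N) & ln (lT N) <= zeta * lN N + 1].
  by near: N; exact: near_lnlnT.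
have [b0 bE] : 0 < coef_b N /\
  ln (coef_b N ^+ 2) = ln (lT N) - ln (ln (lT N)) - lN N - ln (lN N).
  by near: N; exact: near_ln_b.
have ly : 1 <= ln (ln (lT N)) by rewrite -[leLHS]expRK; apply: ln_le => //; exact: expR_gt0.
have lx : 0 <= ln (lN N) := ln_ge0 x0.
rewrite -[coef_b N]lnK ?posrE// ler_expR.
move: bE; rewrite lnXn// mulr2n => bE.
lra.
Unshelve. all: by end_near. Qed.

Lemma near_b_ge (d : R) : 0 < d ->
  \forall N \near \oo, expR (- (((1 - zeta) / 2 + d) * lN N)) <= coef_b N.
Proof.
move=> d0; have /andP[z0 z1] := zeta01.
near=> N.
have x0 : 1 <= lN N by near: N; exact: near_lnN.
have y0 : 1 <= ln (lT N) by near: N; exact: near_lnT_ge.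
have [_ h' h] : [/\ 0 < lT N, zeta * lN N - 1 <= ln (lT N) & ln (lT N) <= zeta * lN N + 1].
  by near: N; exact: near_lnlnT.
have [b0 bE] : 0 < coef_b N /\
  ln (coef_b N ^+ 2) = ln (lT N) - ln (ln (lT N)) - lN N - ln (lN N).
  by near: N; exact: near_ln_b.
have h2 : 2 + ln (lN N) <= d * lN N by near: N; exact: near_lnlnN.
have ly : ln (ln (lT N)) <= ln (lN N) + 1.
  have le : ln (lT N) <= lN N * 2.
    have : zeta * lN N <= 1 * lN N by rewrite ler_wpM2r// ?ltW//; lra.
    lra.
  have l2 : ln 2 <= 1 :> R by have := @le_ln1Dx R 1; rewrite (_ : 1 + 1 = 2)//; apply; lra.
  have p1 : 0 < ln (lT N) by lra.
  have p2 : 0 < lN N by lra.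
  by have := ln_le p1 le; rewrite lnM ?posrE//; lra.
rewrite -[coef_b N]lnK ?posrE// ler_expR.
move: bE; rewrite lnXn// mulr2n => bE.
lra.
Unshelve. all: by end_near. Qed.

Lemma near_a_small (p : R) : p < 1 ->
  \forall N \near \oo, coef_a N <= expR (- (p * lN N)).
Proof.
move=> p1; have d0 : 0 < 1 - p by rewrite subr_gt0.
near=> N.
have N0 : (0 < N)%N by near: N; exact: near_pos.
have NR : 0 < N%:R :> R by rewrite ltr0n.
have x0 : 1 <= lN N by near: N; exact: near_lnN.
have xp : 0 < lN N by lra.
have h2 : ln lambda1 + ln (lN N) <= (1 - p) * lN N by near: N; exact: near_lnlnN.
have a0 : 0 < coef_a N by rewrite /coef_a divr_gt0// mulr_gt0.
rewrite -[coef_a N]lnK ?posrE// ler_expR /coef_a ln_div ?posrE ?mulr_gt0//.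
rewrite lnM ?posrE//; lra.
Unshelve. all: by end_near. Qed.

Lemma near_coefs : \forall N \near \oo,
  [/\ 0 <= coef_a N, 0 < coef_b N & coef_a N / 2 + 2 * coef_b N <= 2^-1].
Proof.
have /andP[z0 z1] := zeta01.
have p1 : (1 - zeta) / 4 < (1 - zeta) / 2 by lra.
have p2 : (1 - zeta) / 4 < 1 by lra.
have pz : 0 < (1 - zeta) / 4 by lra.
near=> N.
have N0 : (0 < N)%N by near: N; exact: near_pos.
have x0 : 1 <= lN N by near: N; exact: near_lnN.
have [b0 _] : 0 < coef_b N /\
  ln (coef_b N ^+ 2) = ln (lT N) - ln (ln (lT N)) - lN N - ln (lN N).
  by near: N; exact: near_ln_b.
have hb : coef_b N <= expR (- ((1 - zeta) / 4 * lN N)) by near: N; exact: near_b_small.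
have ha : coef_a N <= expR (- ((1 - zeta) / 4 * lN N)) by near: N; exact: near_a_small.
have h1 : ln 8 / ((1 - zeta) / 4) <= lN N by near: N; exact: near_lnN.
have e8 : expR (- ((1 - zeta) / 4 * lN N)) <= 8^-1.
  rewrite -[leRHS]lnK ?posrE ?invr_gt0// ler_expR lnV ?posrE// lerN2.
  by move: h1; rewrite ler_pdivrMr// mulrC.
split => //; last by lra.
by rewrite /coef_a divr_ge0// mulr_ge0 ?ltW//; lra.
Unshelve. all: by end_near. Qed.

(** [N a = lambda1 log N] is small next to [log T], and so is
    [N b ^ 2 log (1 / b)], of order [log T / log log T]. *)
Lemma near_null_cost (d : R) : 0 < d -> \forall N \near \oo,
  N%:R * (coef_a N + 16 * coef_b N ^+ 2 * ln (1 + (coef_b N)^-1)) <= d * lT N.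
Proof.
move=> d0; have /andP[z0 z1] := zeta01.
have d2 : 0 < d / 2 by rewrite divr_gt0.
have z2 : 0 < zeta / 2 by rewrite divr_gt0.
have q : (0 : R) < 2^-1 by lra.
near=> N.
have N0 : (0 < N)%N by near: N; exact: near_pos.
have NR : 0 < N%:R :> R by rewrite ltr0n.
have N1 : 1 <= N%:R :> R by rewrite ler1n.
have x0 : 1 <= lN N by near: N; exact: near_lnN.
have xp : 0 < lN N by lra.
have y0 : 1 <= ln (lT N) by near: N; exact: near_lnT_ge.
have y1 : 64 / (d / 2) <= ln (lT N) by near: N; exact: near_lnT_ge.
have [lT0 h' h] : [/\ 0 < lT N, zeta * lN N - 1 <= ln (lT N) & ln (lT N) <= zeta * lN N + 1].
  by near: N; exact: near_lnlnT.
have [b0 bE] : 0 < coef_b N /\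
  ln (coef_b N ^+ 2) = ln (lT N) - ln (ln (lT N)) - lN N - ln (lN N).
  by near: N; exact: near_ln_b.
have h2 : (1 + ln lambda1 - ln (d / 2)) + ln (lN N) <= zeta * lN N.
  by near: N; exact: near_lnlnN.
have hbg : expR (- (((1 - zeta) / 2 + 2^-1) * lN N)) <= coef_b N.
  by near: N; exact: near_b_ge.
have part1 : N%:R * coef_a N <= d / 2 * lT N.
  rewrite /coef_a mulrC divfK ?gt_eqF//.
  have p1 : 0 < lambda1 * lN N by rewrite mulr_gt0.
  have p2 : 0 < d / 2 * lT N by rewrite mulr_gt0.
  rewrite -ler_ln ?posrE// [leLHS]lnM ?posrE// [leRHS]lnM ?posrE//; lra.
have lb : ln (1 + (coef_b N)^-1) <= 2 * lN N.
  have bV : (coef_b N)^-1 <= N%:R.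
    rewrite -[leRHS]invrK lef_pV2 ?posrE ?invr_gt0//.
    apply: le_trans hbg; rewrite -[leLHS]lnK ?posrE ?invr_gt0// ler_expR lnV ?posrE//.
    rewrite lerN2 -[leRHS]mul1r ler_wpM2r//; first exact: ltW.
    lra.
  have l2 : ln 2 <= 1 :> R by have := @le_ln1Dx R 1; rewrite (_ : 1 + 1 = 2)//; apply; lra.
  have : ln (1 + (coef_b N)^-1) <= ln (2 * N%:R).
    by apply: ln_le; [rewrite addr_gt0// invr_gt0|rewrite mulr_natl mulr2n lerD].
  by rewrite lnM ?posrE//; lra.
have bb : N%:R * coef_b N ^+ 2 * lN N = lT N / ln (lT N).
  have yp : 0 < ln (lT N) by lra.
  have bp : 0 < coef_b N ^+ 2 by rewrite exprn_gt0.
  have np : 0 < N%:R * coef_b N ^+ 2 by rewrite mulr_gt0.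
  have lp : 0 < N%:R * coef_b N ^+ 2 * lN N by rewrite mulr_gt0.
  have rp : 0 < lT N / ln (lT N) by rewrite divr_gt0.
  have e : ln (N%:R * coef_b N ^+ 2 * lN N) = ln (lT N / ln (lT N)).
    rewrite ln_div ?posrE// [LHS]lnM ?posrE// [X in X + _]lnM ?posrE// bE; ring.
  exact: (ln_inj _ _ e).
have part2 : N%:R * (16 * coef_b N ^+ 2 * ln (1 + (coef_b N)^-1)) <= d / 2 * lT N.
  have b2 : 0 <= N%:R * (16 * coef_b N ^+ 2).
    by apply: mulr_ge0; [exact: ltW|apply: mulr_ge0 => //; exact: sqr_ge0].
  have h3 := ler_wpM2l b2 lb.
  have e1 : N%:R * (16 * coef_b N ^+ 2) * (2 * lN N) = 32 * (lT N / ln (lT N)).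
    by rewrite -bb; ring.
  have yp : 0 < ln (lT N) by lra.
  have h4 : 32 * (lT N / ln (lT N)) <= d / 2 * lT N.
    rewrite mulrA ler_pdivrMr//.
    move: y1; rewrite ler_pdivrMr// => y1.
    have := ler_wpM2l (ltW lT0) y1.
    by lra.
  by rewrite mulrA; lra.
rewrite mulrDr; lra.
Unshelve. all: by end_near. Qed.

Lemma near_c_small (d : R) : 0 < d -> \forall N \near \oo, c (T N) <= d * lT N.
Proof.
move=> d0.
have hc : \forall t \near \oo, c t <= d * ln (t%:R : R).
  have /eqoP/(_ d d0) h := c_logT.
  near=> t.
  have t1 : (0 < t)%N by near: t; exact: near_pos.
  have ht : `|c t| <= d * `|ln (t%:R : R)| by near: t; exact: h.
  apply: le_trans (ler_norm _) _; apply: le_trans ht _.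
  by rewrite ger0_norm// ln_ge0// ler1n.
exact: (T_infty hc).
Unshelve. all: by end_near. Qed.

End growth.

(** * The scanned window next to a change-point *)

Section scales.
Context {R : realType} (hs ds : nat -> nat).
Hypotheses (hs1 : (1 <= hs 1)%N)
  (hs_incr : forall i : nat, (1 <= i)%N -> (hs i < hs i.+1)%N)
  (ds1 : (1 <= ds 1)%N)
  (ds_incr : forall i : nat, (1 <= i)%N -> (ds i < ds i.+1)%N)
  (hs_ratio : (hs i.+1)%:R / (hs i)%:R @[i --> \oo] --> (1 : R))
  (ds_hs : (fun i : nat => (ds i)%:R : R) =o_\oo (fun i : nat => (hs i)%:R : R)).

Lemma hs_ge i : (1 <= i)%N -> (i <= hs i)%N.
Proof.
elim: i => // -[|i] IH _; first exact: hs1.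
by apply: leq_ltn_trans (hs_incr _); first exact: IH.
Qed.

Lemma ds_ge1 i : (1 <= i)%N -> (1 <= ds i)%N.
Proof.
elim: i => // -[|i] IH _; first exact: ds1.
by apply: leq_trans (IH isT) _; exact/ltnW/ds_incr.
Qed.

(** The last scale with [hs i + ds i <= h] serves: the next one does not fit,
    and it is larger by a ratio close to [1] only. *)
Lemma select_scale (eta kap : R) : 0 < eta < 1 -> 0 < kap ->
  exists h0 : R, forall h, h0 <= h -> exists i, [/\ (1 <= i)%N,
    (hs i + ds i)%:R <= h, (1 - eta) * h <= (hs i)%:R &
    (ds i)%:R <= kap * (hs i)%:R].
Proof.
move=> /andP[eta0 eta1] kap0.
pose e := Num.min (eta / 3) kap.
have e0 : 0 < e by rewrite lt_min divr_gt0.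
have e3 : e <= eta / 3 by rewrite ge_min lexx.
have ek : e <= kap by rewrite ge_min lexx orbT.
have [I0 HI0] : exists I0, forall i, (I0 <= i)%N ->
    (hs i.+1)%:R / (hs i)%:R <= 1 + e /\ (ds i)%:R <= e * (hs i)%:R.
  have h1 : \forall i \near \oo, (hs i.+1)%:R / (hs i)%:R <= 1 + e.
    by apply: (cvgr_le _ hs_ratio); rewrite ltrDl.
  have h2 : \forall i \near \oo, (ds i)%:R <= e * (hs i)%:R :> R.
    have /eqoP/(_ e e0) h := ds_hs.
    by near=> i; have := near h i; rewrite !normr_nat; apply.
  have [I0 _ HI] : \forall i \near \oo,
    (hs i.+1)%:R / (hs i)%:R <= 1 + e /\ (ds i)%:R <= e * (hs i)%:R :> R.
    by near=> i; split; near: i.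
  by exists I0 => i /HI.
pose I1 := maxn I0 1.
exists (hs I1 + ds I1)%:R => h hh.
have h_ge0 : 0 <= h by apply: le_trans hh.
have /andP[th_le th_gt] := truncn_itv h_ge0.
have leh m : (m%:R <= h) = (m <= Num.truncn h)%N.
  apply/idP/idP => [mh|mh]; last by apply: le_trans th_le; rewrite ler_nat.
  by rewrite -ltnS -(ltr_nat R) (le_lt_trans mh).
pose Q i := (1 <= i)%N && (hs i + ds i <= Num.truncn h)%N.
have Q1 : Q I1 by rewrite /Q leq_maxr -leh.
have Qb i : Q i -> (i <= Num.truncn h)%N.
  move=> /andP[i1 hi]; apply: leq_trans (hs_ge i1) _.
  by apply: leq_trans hi; exact: leq_addr.
have [i /andP[i1 hi] imax] := ex_maxnP (ex_intro _ I1 Q1) Qb.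
have iI1 : (I1 <= i)%N := imax _ Q1.
have iI0 : (I0 <= i)%N by apply: leq_trans iI1; exact: leq_maxl.
have [_ d_le] := HI0 i iI0.
have [ratio _] := HI0 i iI0.
have [_ d_le'] := HI0 i.+1 (leqW iI0).
have hp : 0 < (hs i)%:R :> R by rewrite ltr0n (leq_trans i1)// hs_ge.
exists i; split => //.
- by rewrite leh.
- have : h < (hs i.+1 + ds i.+1)%:R.
    rewrite ltNge leh; apply/negP => hi'.
    by have := imax i.+1; rewrite /Q hi' /= => /(_ isT); rewrite ltnn.
  rewrite natrD => hlt.
  move: ratio; rewrite ler_pdivrMr// => ratio.
  have b1 : h <= (1 + e) * (hs i.+1)%:R by lra.
  have b2 : (1 + e) * (hs i.+1)%:R <= (1 + e) * ((1 + e) * (hs i)%:R).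
    by rewrite ler_wpM2l//; lra.
  have b3 : (1 - eta) * ((1 + e) * (1 + e)) <= 1.
    have c1 : (1 + e) * (1 + e) <= (1 + eta / 3) * (1 + eta / 3).
      by apply: ler_pM; lra.
    have c2 : (1 - eta) * ((1 + e) * (1 + e)) <=
        (1 - eta) * ((1 + eta / 3) * (1 + eta / 3)).
      by rewrite ler_wpM2l//; lra.
    have c3 : 0 <= eta * eta by rewrite mulr_ge0// ltW.
    have c4 : 0 <= eta * (eta * eta) by rewrite mulr_ge0// ltW.
    lra.
  have b4 : (1 - eta) * h <= (1 - eta) * ((1 + e) * ((1 + e) * (hs i)%:R)).
    by rewrite ler_wpM2l//; lra.
  have b5 : (1 - eta) * ((1 + e) * (1 + e)) * (hs i)%:R <= 1 * (hs i)%:R.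
    by rewrite ler_wpM2r// ltW.
  lra.
- by apply: le_trans d_le _; rewrite ler_wpM2r// ltW.
Unshelve. all: by end_near. Qed.

End scales.

Section select_window.
Context {R : realType} {N : nat} (T : nat) (mu : 'I_N -> nat -> R).

Lemma sorted_change_points : (0 < T)%N ->
  sorted ltn (0%N :: rcons (change_points T mu) T).
Proof.
move=> T0; have cp v : v \in change_points T mu -> (1 <= v < T)%N.
  by rewrite mem_filter mem_iota => /andP[_]; lia.
have scp : sorted ltn (change_points T mu).
  by apply: sorted_filter (iota_ltn_sorted _ _); exact: ltn_trans.
rewrite /= rcons_path; move: cp scp; case: (change_points T mu) => [|x l] cp scp /=.
  by rewrite T0.
have /andP[x0 _] := cp x (mem_head _ _).
rewrite x0 /= in scp *; rewrite scp /=.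
by have /andP[_] := cp (last x l) (mem_last _ _).
Qed.

Lemma tau_lt i j : (0 < T)%N -> (i < j)%N -> (j <= (num_change T mu).+1)%N ->
  (tau T mu i < tau T mu j)%N.
Proof.
move=> T0 ij jJ; apply: (sorted_ltn_nth ltn_trans _ (sorted_change_points T0)) => //;
  rewrite inE /= size_rcons /num_change in jJ *; lia.
Qed.

Lemma tau_last : tau T mu (num_change T mu).+1 = T.
Proof. by rewrite /tau /= nth_rcons ltnn eqxx. Qed.

Lemma mean_const j n v : (0 < T)%N -> (1 <= j <= (num_change T mu).+1)%N ->
  (tau T mu j.-1 < v < tau T mu j)%N -> mu n v = mu n v.+1.
Proof.
move=> T0 /andP[j1 jJ] /andP[v1 v2].
have vT : (v < T)%N.
  apply: leq_trans v2 _; move: jJ; rewrite leq_eqVlt => /orP[/eqP ->|jJ].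
    by rewrite tau_last.
  by rewrite -[leqRHS]tau_last; exact/ltnW/tau_lt.
apply/eqP; rewrite -[_ == _]negbK; apply/negP => ne.
have vc : v \in change_points T mu.
  rewrite mem_filter mem_iota; apply/andP; split; last by lia.
  by apply/existsP; exists n.
pose i := (index v (change_points T mu)).+1.
have iJ : (i <= num_change T mu)%N by rewrite /i index_mem.
have vi : v = tau T mu i.
  by rewrite /tau /i /= nth_rcons index_mem vc nth_index.
have i1 : (j.-1 < i)%N.
  rewrite ltnNge; apply/negP; rewrite leq_eqVlt => /orP[/eqP e|h].
    by move: v1; rewrite vi e ltnn.
  have /(tau_lt T0 h) : (j.-1 <= (num_change T mu).+1)%N by lia.
  by rewrite -vi => h'; have := ltn_trans v1 h'; rewrite ltnn.
have i2 : (i < j)%N.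
  rewrite ltnNge; apply/negP; rewrite leq_eqVlt => /orP[/eqP e|h].
    by move: v2; rewrite vi e ltnn.
  have /(tau_lt T0 h) : (i <= (num_change T mu).+1)%N by lia.
  by rewrite -vi => h'; have := ltn_trans v2 h'; rewrite ltnn.
lia.
Qed.

Lemma mean_const_seg j n v w : (0 < T)%N -> (1 <= j <= (num_change T mu).+1)%N ->
  (tau T mu j.-1 < v)%N -> (v <= w)%N -> (w <= tau T mu j)%N -> mu n v = mu n w.
Proof.
move=> T0 jJ v1 vw; elim: w vw => [|w IH]; first by rewrite leqn0 => /eqP ->.
rewrite leq_eqVlt => /orP[/eqP -> //|]; rewrite ltnS => vw wt.
rewrite (IH vw (ltnW wt)); apply: (mean_const n T0 jJ).
by rewrite wt andbT (leq_trans v1 vw).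
Qed.

Lemma sum_const_nat (f : nat -> R) (k : R) x y : (x <= y)%N ->
  (forall v, (x < v <= y)%N -> f v = k) ->
  \sum_(x.+1 <= v < y.+1) f v = (y - x)%:R * k.
Proof.
move=> xy fk; rewrite (eq_big_nat _ _ (F2 := fun=> k)).
  by rewrite sumr_const_nat subSS mulr_natl.
by move=> v /andP[xv vy]; apply: fk; rewrite xv.
Qed.

Variables (hs ds : nat -> nat) (mu0 Delta h r kap : R) (V i : nat).
Hypotheses (mu0_gt0 : 0 < mu0) (i1 : (1 <= i)%N) (d1 : (1 <= ds i)%N)
  (i_le_hs : (i <= hs i)%N)
  (hi : (hs i + ds i)%:R <= h) (r1 : 1 < r) (kap1 : kap < 1)
  (dk : (ds i)%:R <= kap * (hs i)%:R)
  (k1 : r <= (1 - kap) * expR Delta) (k2 : r * (kap + expR (- Delta)) <= 1).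

Lemma grid_point (t : nat) :
  exists2 k, (k * ds i <= t)%N & (t < k * ds i + ds i)%N.
Proof.
exists (t %/ ds i)%N; first exact: leq_trunc_div.
by rewrite -mulSnr ltn_ceil.
Qed.

(** The centre is the last grid point up to the change-point.  The left half of
    the window then lies before the change, and at most the share [kap] of the
    right half does.  The bounds on [kap] keep the ratio of the two means at
    [r], whether the mean increases or decreases. *)
Lemma select_window : Lambda1 T mu0 Delta V h mu ->
  exists k, let t := (k * ds i)%N in
  [/\ (i <= i_max hs ds T)%N, (1 <= k <= grid_size ds T i)%N,
      (hs i <= t)%N, (t + hs i <= T)%N &
   exists2 S : pred 'I_N, (V <= #|[set n | S n]%SET|)%N & forall n, S n ->
     exists inc : bool,
       let A := \sum_((t - hs i).+1 <= v < t.+1) mu n v in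
       let B := \sum_(t.+1 <= v < (t + hs i).+1) mu n v in
       mu0 * (hs i)%:R <= (if inc then A else B) /\
       r * (if inc then A else B) <= (if inc then B else A)].
Proof.
move=> [muL [j [/andP[j1 jJ] gap mV]]].
have T0 : (0 < T)%N.
  rewrite lt0n; apply/eqP => T0; move: jJ.
  by rewrite /num_change /change_points T0 /= => jJ; have := leq_trans j1 jJ.
have t_gap1 : (hs i + ds i <= tau T mu j.+1 - tau T mu j)%N.
  rewrite -(ler_nat R); apply: le_trans hi (le_trans gap _).
  by rewrite ler_nat geq_minl.
have t_gap2 : (hs i + ds i <= tau T mu j - tau T mu j.-1)%N.
  rewrite -(ler_nat R); apply: le_trans hi (le_trans gap _).
  by rewrite ler_nat geq_minr.
have tT : (tau T mu j.+1 <= T)%N.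
  have : (j.+1 <= (num_change T mu).+1)%N by [].
  rewrite leq_eqVlt => /orP[/eqP ->|jJ']; first by rewrite tau_last.
  by rewrite -[leqRHS]tau_last; exact/ltnW/tau_lt.
have jb1 : (1 <= j <= (num_change T mu).+1)%N by rewrite j1 leqW.
have jb2 : (1 <= j.+1 <= (num_change T mu).+1)%N by rewrite ltnS.
have cst1 n v w := @mean_const_seg j n v w T0 jb1.
have cst2 n v w := @mean_const_seg j.+1 n v w T0 jb2.
rewrite /= in cst2.
set tj := tau T mu j in t_gap1 t_gap2 cst1 cst2 mV *.
set tn := tau T mu j.+1 in t_gap1 tT cst2.
set tp := tau T mu j.-1 in t_gap2 cst1.
have [k kt tk] := grid_point tj.
exists k; cbv zeta; set t := (k * ds i)%N in kt tk *.
have hd : (1 <= hs i)%N := leq_trans i1 i_le_hs.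
have th : (hs i <= t)%N by clear -t_gap2 tk; lia.
have thT : (t + hs i <= T)%N by clear -t_gap1 tT kt d1 hd; lia.
have kpos : (1 <= k)%N.
  rewrite lt0n; apply/eqP => k0; move: th hd; rewrite /t k0 mul0n; clear; lia.
split => //.
- rewrite /i_max; apply: (@leq_bigmax_seq _ (index_iota 1 T.+1)
    (fun i => (hs i + ds i <= T)%N) id i).
  + by rewrite mem_index_iota i1 /= ltnS (leq_trans i_le_hs)//; clear -thT; lia.
  + by clear -t_gap1 tT; lia.
- rewrite kpos /= /grid_size leq_divRL//; rewrite -/t; clear -thT hd; lia.
exists [pred n | Delta <= `|ln (mu n tj.+1 / mu n tj)|].
  by apply: leq_trans mV _; rewrite /m_change.
move=> n /= sig.
have tjT : (1 <= tj <= T)%N by clear -t_gap1 t_gap2 tT hd; lia.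
have tjT' : (1 <= tj.+1 <= T)%N by clear -t_gap1 t_gap2 tT hd; lia.
set a := mu n tj in sig *; set b := mu n tj.+1 in sig *.
have a0 : mu0 <= a by apply: muL.
have b0 : mu0 <= b by apply: muL.
have ap : 0 < a := lt_le_trans mu0_gt0 a0.
have bp : 0 < b := lt_le_trans mu0_gt0 b0.
have AE : \sum_((t - hs i).+1 <= v < t.+1) mu n v = (hs i)%:R * a.
  rewrite (@sum_const_nat _ a) ?leq_subr//; first by rewrite subKn.
  move=> v /andP[v1 v2]; apply: cst1 => //; clear -v1 v2 t_gap2 tk kt; lia.
have BE : \sum_(t.+1 <= v < (t + hs i).+1) mu n v =
    (tj - t)%:R * a + (t + hs i - tj)%:R * b.
  have tjh : (tj <= t + hs i)%N.
    rewrite -(leq_add2r 0) !addn0; apply: leq_trans (ltnW tk) _.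
    rewrite leq_add2l -(ler_nat R); apply: le_trans dk _.
    by rewrite ler_piMl// ltW.
  rewrite (big_cat_nat (n := tj.+1))//=; try by rewrite ltnS.
  congr (_ + _); apply: sum_const_nat => // v /andP[v1 v2].
    apply: cst1 => //; clear -v1 v2 t_gap2 tk kt; lia.
  apply/esym; apply: cst2 => //; clear -v1 v2 t_gap1 tk kt; lia.
have dR : (tj - t)%:R <= kap * (hs i)%:R :> R.
  apply: le_trans dk; rewrite ler_nat; clear -tk kt; lia.
set x := (tj - t)%:R : R in dR BE *.
have x0 : 0 <= x by [].
have tjh : (tj <= t + hs i)%N.
  apply: leq_trans (ltnW tk) _.
  rewrite leq_add2l -(ler_nat R); apply: le_trans dk _.
  by rewrite ler_piMl// ltW.
have yE : (t + hs i - tj)%:R = (hs i)%:R - x :> R.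
  by rewrite /x !natrB// natrD; ring.
rewrite yE in BE.
set H := (hs i)%:R : R in dR BE AE yE *.
have H0 : 0 < H by rewrite ltr0n.
have kH : kap * H <= 1 * H := ler_wpM2r (ltW H0) (ltW kap1).
have Hx : 0 <= H - x by lra.
have Ha : 0 <= H * a := mulr_ge0 (ltW H0) (ltW ap).
have kH' : 0 <= H - kap * H by lra.
have Da : 0 <= expR Delta * a := mulr_ge0 (expR_ge0 _) (ltW ap).
have rp : 0 < r := lt_trans ltr01 r1.
have [ba|ba] := leP a b.
  have hb : expR Delta * a <= b.
    have q1 : 1 <= b / a by rewrite ler_pdivlMr// mul1r.
    move: sig; rewrite ger0_norm ?ln_ge0// => sig.
    rewrite -ler_pdivlMr// -[b / a]lnK ?posrE ?divr_gt0// ler_expR.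
    by [].
  exists true; rewrite AE BE; split; first by rewrite mulrC ler_wpM2l// ltW.
  have s1 : (H - kap * H) * (expR Delta * a) <= (H - x) * b.
    by apply: ler_pM => //; lra.
  have s2 : r * (H * a) <= (1 - kap) * expR Delta * (H * a) by rewrite ler_wpM2r.
  have s3 : 0 <= x * a by rewrite mulr_ge0// ltW.
  lra.
have hb : b <= expR (- Delta) * a.
  have q1 : b / a <= 1 by rewrite ler_pdivrMr// mul1r ltW.
  move: sig; rewrite ler0_norm ?ln_le0// => sig.
  rewrite -ler_pdivrMr// -[b / a]lnK ?posrE ?divr_gt0// ler_expR.
  lra.
exists false; rewrite AE BE; split.
  have s1 : x * mu0 <= x * a by rewrite ler_wpM2l.
  have s2 : (H - x) * mu0 <= (H - x) * b by rewrite ler_wpM2l.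
  lra.
have s1 : x * a <= kap * H * a by rewrite ler_wpM2r// ltW.
have s2 : (H - x) * b <= H * (expR (- Delta) * a).
  by apply: ler_pM => //; [exact: ltW|lra].
have s3 : r * (x * a + (H - x) * b) <= r * (kap * H * a + H * (expR (- Delta) * a)).
  by rewrite ler_wpM2l ?(ltW rp)// lerD.
have s4 : r * (kap + expR (- Delta)) * (H * a) <= 1 * (H * a).
  by rewrite ler_wpM2r.
lra.
Qed.

End select_window.

(** * The type II error *)

Section signal_factor.
Context {R : realType}.

(** [gam] bounds the mean of [expR (- th * ell)] in every sequence whose means
    differ by the factor [r] at least, the smaller one, [L], being [Lmin] at
    least: [g] bounds it when the counts are far apart, and [dl] is the chance
    that they are not.  The proportions [al] and [be] may depend on [L]. *)
Definition signal_factor (N : nat) (l1 l2 th r Lmin gam : R) : Prop :=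
  let a := l1 * ln N%:R / N%:R in
  let b := l2 / Num.sqrt (N%:R * ln N%:R) in
  forall L, Lmin <= L -> exists al be g dl : R,
    [/\ 0 < al, al <= be, 0 <= g & g <= tilt_score a b th 1] /\
    [/\ forall p, 0 < p <= 1 -> p <= 2 * expR (- (L * tail_rate al be)) ->
          expR (- th * ell N l1 l2 p) <= g,
        forall B K, r * L <= B ->
          \sum_(0 <= y1 < K) \sum_(0 <= y2 < K) pois L y1 * pois B y2 *
            (~~ ((y1%:R <= al * L) && (be * L <= y2%:R)))%:R <= dl &
        g + (tilt_score a b th 1 - g) * dl <= gam].

Context {N T : nat} d {Omega : measurableType d}
  (P : probability Omega R) (mu : 'I_N -> nat -> R)
  (X : 'I_N -> nat -> {mfun Omega >-> nat})
  (psi : 'I_N -> nat -> nat -> nat -> {mfun Omega >-> R}).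
Hypotheses (mu_gt0 : forall n t, (1 <= t <= T)%N -> 0 < mu n t)
  (data_poisson : poisson_data T P mu X) (psi_rand : randomized T P X psi).
Variables (l1 l2 th : R).
Let a : R := l1 * ln N%:R / N%:R.
Let b : R := l2 / Num.sqrt (N%:R * ln N%:R).
Hypotheses (a0 : 0 <= a) (b0 : 0 < b) (ab1 : a / 2 + 2 * b <= 2^-1)
  (th01 : 0 <= th <= 1).
Variables (hs ds : nat -> nat) (mu0 Delta h r kap eta gam c : R) (V i : nat).
Hypotheses (mu0_gt0 : 0 < mu0) (i1 : (1 <= i)%N) (d1 : (1 <= ds i)%N)
  (i_le_hs : (i <= hs i)%N)
  (hi : (hs i + ds i)%:R <= h) (hh : (1 - eta) * h <= (hs i)%:R)
  (r1 : 1 < r) (kap1 : kap < 1)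
  (dk : (ds i)%:R <= kap * (hs i)%:R)
  (k1 : r <= (1 - kap) * expR Delta) (k2 : r * (kap + expR (- Delta)) <= 1)
  (gam01 : 0 <= gam <= 1)
  (sig : signal_factor N l1 l2 th r (mu0 * ((1 - eta) * h)) gam).

(** The penalty of a window with halves of length [hs i] is
    [log (T / (2 hs i))], at most [log T]. *)
Lemma type_II_bound : Lambda1 T mu0 Delta V h mu ->
  (P (~` declares_change hs ds T l1 l2 c psi) <=
   (2 * expR (th * (c + ln T%:R + N%:R * (a + 16 * b ^+ 2 * ln (1 + b^-1))))
     * gam ^+ V)%:E)%E.
Proof.
move=> L1.
have [k [iM kK ht hT [S VS HS]]] :=
  select_window mu0_gt0 i1 d1 i_le_hs hi r1 kap1 dk k1 k2 L1.
set t := (k * ds i)%N in ht hT HS.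
have hd : (1 <= hs i)%N := leq_trans i1 i_le_hs.
set s := (t - hs i)%N in HS; set u := (t + hs i)%N in hT HS.
have st : (s < t)%N by rewrite /s ltn_subrL hd (leq_trans hd ht).
have stu : (t - s = u - t)%N by rewrite /s /u subKn// addKn.
pose A n := \sum_(s.+1 <= v < t.+1) mu n v.
pose B n := \sum_(t.+1 <= v < u.+1) mu n v.
pose good n (q : bool * (R * R) * (R * R * R)) :=
  let: (inc, (al, be), (L, g, dl)) := q in
  S n ->
    [/\ 0 < al, al <= be, 0 <= g & g <= tilt_score a b th 1] /\
    [/\ forall p, 0 < p <= 1 -> p <= 2 * expR (- (L * tail_rate al be)) ->
          expR (- th * ell N l1 l2 p) <= g,
        forall K, \sum_(0 <= y1 < K) \sum_(0 <= y2 < K) pois (A n) y1 *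
          pois (B n) y2 * (~~ far_apart inc al be L y1 y2)%:R <= dl &
        g + (tilt_score a b th 1 - g) * dl <= gam].
have ex n : exists q, good n q.
  have [Sn|nS] := boolP (S n); last first.
    by exists (true, (0, 0), (0, 0, 0)) => /= Sn; rewrite Sn in nS.
  have [inc [Lmin Lr]] := HS n Sn.
  have Lge : mu0 * ((1 - eta) * h) <= (if inc then A n else B n).
    by apply: le_trans Lmin; rewrite ler_wpM2l// ltW.
  have [al [be [g [dl [c1 [c2 c3 c4]]]]]] := sig Lge.
  exists (inc, (al, be), ((if inc then A n else B n), g, dl)) => /= _.
  split => //; split => // K.
  by apply: far_bad_swap => K'; exact: c3.
have [f Hf] := boolp.choice ex.
pose inc n := (f n).1.1.
pose al n := (f n).1.2.1.
pose be n := (f n).1.2.2.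
pose L n := (f n).2.1.1.
pose g n := (f n).2.1.2.
pose dl n := (f n).2.2.
have HS1 n : S n -> [/\ 0 < al n, al n <= be n, 0 <= g n & g n <= tilt_score a b th 1].
  move=> Sn; have := Hf n; rewrite /good /al /be /g.
  by case: (f n) => [[? [? ?]] [[? ?] ?]] /(_ Sn)[].
have HS2 n : S n -> [/\ forall p, 0 < p <= 1 ->
      p <= 2 * expR (- (L n * tail_rate (al n) (be n))) ->
      expR (- th * ell N l1 l2 p) <= g n,
    forall K, \sum_(0 <= y1 < K) \sum_(0 <= y2 < K) pois (A n) y1 *
      pois (B n) y2 * (~~ far_apart (inc n) (al n) (be n) (L n) y1 y2)%:R <= dl n &
    g n + (tilt_score a b th 1 - g n) * dl n <= gam].
  move=> Sn; have := Hf n; rewrite /good /al /be /g /L /dl /inc.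
  by case: (f n) => [[? [? ?]] [[? ?] ?]] /(_ Sn)[_].
have := @alt_window R N T d Omega P mu X psi mu_gt0 data_poisson psi_rand
  l1 l2 th a0 b0 ab1 th01 s t u (c + ln T%:R) S inc al be L g dl gam V
  st stu hT VS gam01 HS1 HS2.
apply: le_trans.
have hR : 0 < (hs i)%:R :> R by rewrite ltr0n.
have T0 : (0 < T)%N := leq_trans (leq_trans hd ht) (leq_trans (leq_addr _ _) hT).
have TR : 0 < T%:R :> R by rewrite ltr0n.
apply: le_measure; rewrite ?inE.
- by apply: measurableC; exact: measurable_declares.
- have mS : measurable_fun setT
    (fun w => ell_sum l1 l2 (fun n => p_value (psi n s t u w))).
    apply: measurable_sum => n; apply: (measurableT_comp (measurable_ell N l1 l2)).
    by apply: (measurableT_comp measurable_p_value); exact: measurable_funPT.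
  rewrite [X in measurable X](_ : _ = setT `&`
    (fun w => ell_sum l1 l2 (fun n => p_value (psi n s t u w))) @^-1`
      `]-oo, c + ln T%:R]%classic); first exact: mS.
  by rewrite setTI; apply/seteqP; split => w /=; rewrite in_itv.
move=> w /= nd; rewrite leNgt; apply/negP => big; apply: nd.
exists i, k; split => //; first by rewrite i1.
have -> : s_ hs ds i k = s by [].
have -> : t_ ds i k = t by [].
have -> : u_ hs ds T i k = u by rewrite /u_ -/t -/u; apply/minn_idPl.
rewrite /ell_pen lerBrDr; apply: le_trans (ltW big); rewrite lerD2l -stu /s subKn//.
have hV : (hs i)%:R^-1 <= 1 :> R by rewrite invf_le1// ler1n.
have hV0 : 0 < (hs i)%:R^-1 :> R by rewrite invr_gt0.
apply: ln_le; first by rewrite mulr_gt0 ?divr_gt0// addr_gt0.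
have := ler_wpM2l (ltW TR) hV; lra.
Qed.

End signal_factor.

Section score_bounds.
Context {R : realType} (N : nat) (l1 l2 : R).
Let a : R := l1 * ln N%:R / N%:R.
Let b : R := l2 / Num.sqrt (N%:R * ln N%:R).
Hypotheses (a0 : 0 < a) (b0 : 0 < b) (ab1 : a / 2 + 2 * b <= 2^-1).

(** Only the pole of [f1] is kept; the other summands of [like] are nonnegative
    in total. *)
Lemma ell_ge (p : R) : 0 < p <= 1 ->
  ln a - ln p - 2 * ln (2 - ln p) <= ell N l1 l2 p.
Proof.
move=> /andP[p0 p1]; have l0 := subln_gt0 p1.
have s0 : 0 < Num.sqrt p by rewrite sqrtr_gt0.
have q0 : 0 < p * (2 - ln p) ^+ 2 by rewrite mulr_gt0// exprn_gt0.
have -> : ln a - ln p - 2 * ln (2 - ln p) = ln (a / (p * (2 - ln p) ^+ 2)).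
  rewrite ln_div ?posrE// [ln (p * _)]lnM ?posrE ?exprn_gt0// lnXn// mulr2n.
  by ring.
apply: ln_le; first by rewrite divr_gt0.
rewrite -/a -/b /f1 /f2.
have h : 0 <= b * (Num.sqrt p)^-1 by rewrite mulr_ge0 ?invr_ge0 ?ltW.
have h1 := ab1.
lra.
Qed.

Lemma tilt_score1 (th : R) : 0 <= th <= 1 -> 1 <= tilt_score a b th 1 <= 2.
Proof.
move=> /andP[t0 t1]; rewrite /tilt_score /inv_score sqrtr1 mulr1.
have h1 := ab1; have h2 := a0; have h3 := b0.
have c1 : 2^-1 <= base_score a b + b by rewrite /base_score; lra.
have c2 : base_score a b + b <= 1 by rewrite /base_score; lra.
have cp : 0 < base_score a b + b by lra.
have i1 : 1 <= 1 / (base_score a b + b) by rewrite ler_pdivlMr// mul1r.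
have i2 : 1 / (base_score a b + b) <= 2 by rewrite ler_pdivrMr//; lra.
have := ler_wpM2l t0 i1; have := ler_wpM2l t0 i2.
move: (1 / (base_score a b + b)) => w *; apply/andP; split; lra.
Qed.

End score_bounds.

(** * Few sequences with a change *)

Section narrow_rate.
Context {R : realType}.

(** By continuity at [eta = 0]: counts within the share [eta] of their means
    still have a p-value with an exponent larger than necessary. *)
Lemma narrowed_tail_rate (r e : R) : 1 < r -> 0 < e -> exists eta : R,
  [/\ 0 < eta, eta < 1, 1 + eta < (1 - eta) * r &
      1 + e / 2 <=
      (1 - eta) * ((1 + e) * (I_ r)^-1 * tail_rate (1 + eta) ((1 - eta) * r))].
Proof.
move=> r1 e0.
have r0 : 0 < r by lra.
have I0 : 0 < I_ r by rewrite I_tail_rate tail_rate_gt0.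
pose f (eta : R) :=
  (1 - eta) * ((1 + e) * (I_ r)^-1 * tail_rate (1 + eta) ((1 - eta) * r)).
have f0 : f 0 = 1 + e.
  by rewrite /f subr0 addr0 !mul1r -I_tail_rate divfK// gt_eqF.
have cA : (fun x : R => 1 + x) x @[x --> (0 : R)^'+] --> 1 + (0 : R).
  by apply: cvgD; [exact: cvg_cst|apply: cvg_within_filter; exact: cvg_id].
have cB : (fun x : R => (1 - x) * r) x @[x --> (0 : R)^'+] --> (1 - (0 : R)) * r.
  apply: cvgM; last exact: cvg_cst.
  by apply: cvgB; [exact: cvg_cst|apply: cvg_within_filter; exact: cvg_id].
have cS := cvgD cA cB.
have A0 : 0 < 1 + 0 :> R by rewrite addr0.
have B0 : 0 < (1 - 0) * r by rewrite subr0 mul1r.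
have S0 : 0 < 1 + 0 + (1 - 0) * r by rewrite addr_gt0.
have cL (g : R -> R) (l : R) : g x @[x --> (0 : R)^'+] --> l -> 0 < l ->
    ln (g x) @[x --> (0 : R)^'+] --> ln l.
  move=> gl l0; exact: (continuous_cvg _ (continuous_ln l0) gl).
have cV (g : R -> R) (l : R) : g x @[x --> (0 : R)^'+] --> l -> 0 < l ->
    g x * ln (2 * g x / (1 + x + (1 - x) * r)) @[x --> (0 : R)^'+] -->
    l * ln (2 * l / (1 + 0 + (1 - 0) * r)).
  move=> gl l0; apply: cvgM => //; apply: cL.
    apply: cvgM; first by apply: cvgM => //; exact: cvg_cst.
    by apply: cvgV; [rewrite gt_eqF|exact: cS].
  by rewrite divr_gt0// mulr_gt0.
have cf : f x @[x --> (0 : R)^'+] --> f 0.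
  apply: cvgM.
    by apply: cvgB; [exact: cvg_cst|apply: cvg_within_filter; exact: cvg_id].
  apply: cvgM; first exact: cvg_cst.
  by apply: cvgD; apply: cV.
have q : 0 < (r - 1) / (1 + r) by rewrite divr_gt0//; lra.
near ((0 : R)^'+) => x.
have x0 : 0 < x by near: x; exact: nbhs_right_gt.
have xlt1 : x < 1 by near: x; exact: nbhs_right_lt.
have xf : 1 + e / 2 <= f x by near: x; apply: (cvgr_ge _ cf); rewrite f0; lra.
exists x; split => //.
have : x < (r - 1) / (1 + r) by near: x; exact: nbhs_right_lt.
rewrite ltr_pdivlMr; first by lra.
lra.
Unshelve. all: by end_near. Qed.

End narrow_rate.

Section sparse_arithmetic.
Context {R : realType}.

(** A score loses to the factor [(2 - ln p) ^ 2] of the p-value density only a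
    small share of [- ln p], here called [q]. *)
Lemma score_of_small_p (e W x q A l1 D S l2 : R) :
  let d := e / (4 * (1 + 2 * e)) in
  0 < e -> (1 + 2 * e) * W - l2 <= q -> S <= d * (2 + q) - D - 1 ->
  l1 - x <= A -> - (l1 - (1 - 2 * d) * l2 - 4 * d + 2 * D + 2) <= x ->
  4 / e * x <= W -> (1 + e) * W <= A + q - 2 * S.
Proof.
move=> d e0 hq hS hA hx hW.
have e1 : 0 < 1 + 2 * e by lra.
have dE : (1 - 2 * d) * (1 + 2 * e) = 1 + 3 / 2 * e by rewrite /d; field; lra.
have d1 : 0 <= 1 - 2 * d.
  rewrite -(pmulr_lge0 _ e1) dE; lra.
clearbody d.
have hW' : 2 * x <= e / 2 * W.
  by move: hW; rewrite mulrAC ler_pdivrMr//; lra.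
have := ler_wpM2l d1 hq; rewrite mulrBr mulrA dE; lra.
Qed.

(** The exponent is at most [V * (1 - e2) * l], so that every factor
    [3 expR (- l)] is still worth [3 expR (- e2 * l)]. *)
Lemma sparse_error_bound (l e c t n d : R) (V : nat) : 0 < l -> 0 < e ->
  0 < t -> (0 < V)%N -> 0 < d ->
  let e2 := e / (2 * (1 + e)) in
  c <= e / 8 * t -> n <= e / 8 * t -> ln 3 <= e2 * l -> ln (6 / d) <= e2 * l ->
  2 * expR (l / ((1 + e) * (t / V%:R)) * (c + t + n)) * (3 * expR (- l)) ^+ V <= d.
Proof.
move=> l0 e0 t0 V0 d0 e2 hc hn h3 h6.
have v0 : 0 < V%:R :> R by rewrite ltr0n.
have p1 : 0 < 1 + e by lra.
have hE : l / ((1 + e) * (t / V%:R)) * (c + t + n) <= V%:R * (l - e2 * l).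
  have th0 : 0 <= l / ((1 + e) * (t / V%:R)).
    by rewrite divr_ge0 ?ltW// mulr_gt0// divr_gt0.
  apply: le_trans (ler_wpM2l th0 (_ : _ <= (1 + e / 2) * t)) _; last first.
    by rewrite le_eqVlt; apply/orP; left; apply/eqP; rewrite /e2; field;
      rewrite !gt_eqF.
  have := mulr_ge0 (ltW e0) (ltW t0); lra.
have b0 : 0 <= 3 * expR (- (e2 * l)) by rewrite mulr_ge0 ?expR_ge0.
have b1 : 3 * expR (- (e2 * l)) <= 1.
  by rewrite -[3]lnK ?posrE// -expRD -[leRHS]expR0 ler_expR subr_le0.
have b2 : 2 * (3 * expR (- (e2 * l))) <= d.
  rewrite mulrA (_ : 2 * 3 = 6); last by lra.
  have -> : expR (- (e2 * l)) = (expR (e2 * l))^-1 by rewrite expRN.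
  rewrite ler_pdivrMr ?expR_gt0// mulrC -ler_pdivrMr//.
  by rewrite -[leLHS]lnK ?posrE ?divr_gt0// ler_expR.
apply: le_trans b2; rewrite -mulrA ler_wpM2l//.
apply: le_trans (_ : (3 * expR (- (e2 * l))) ^+ V <= _); last first.
  by rewrite -[leRHS]expr1; apply: ler_wiXn2l.
apply: le_trans (ler_wpM2r _ (_ : _ <= expR (V%:R * (l - e2 * l)))) _.
- by apply: exprn_ge0; rewrite mulr_ge0 ?expR_ge0.
- by rewrite ler_expR.
rewrite expRM_natl -exprMn [X in X ^+ V](_ : _ = 3 * expR (- (e2 * l)))//.
by rewrite mulrCA -expRD; congr (_ * expR _); ring.
Qed.

End sparse_arithmetic.

Section sparse_signal.
Context {R : realType}.
Local Notation lN N := (ln (N%:R : R)).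
Variables (zeta lambda1 : R) (T : nat -> nat) (c : nat -> R).
Hypotheses (zeta01 : 0 < zeta < 1) (lambda1_gt0 : 0 < lambda1)
  (T_infty : T N @[N --> \oo] --> \oo)
  (logT : sim_to (fun N => ln (T N)%:R) (fun N => N%:R `^ zeta : R))
  (c_logT : c =o_\oo (fun t : nat => ln t%:R : R)).
Local Notation lT N := (ln ((T N)%:R : R)).
Variables (V : nat -> nat) (h : nat -> R) (epsilon r mu0 : R).
Hypotheses (epsilon_gt0 : 0 < epsilon) (r1 : 1 < r) (mu0_gt0 : 0 < mu0)
  (V_gt0 : forall N : nat, (0 < V N)%N)
  (V_small : (fun N : nat => (V N)%:R : R) =o_\oo
       (fun N : nat => ln (T N)%:R / ln N%:R : R))
  (hE : forall N : nat,
       h N = (1 + epsilon) * (I_ r)^-1 * (ln (T N)%:R / (mu0 * (V N)%:R))).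

(** [log T / V] is the score that each of the [V] sequences has to bring; it
    grows faster than the [log N] that the coefficient [a] costs. *)
Lemma near_share (M : R) : 0 < M ->
  \forall N \near \oo, M * lN N <= lT N / (V N)%:R.
Proof.
move=> M0; have /eqoP/(_ M^-1) hV := V_small.
have MV : 0 < M^-1 by rewrite invr_gt0.
near=> N.
have x1 : 1 <= lN N by near: N; exact: near_lnN.
have x0 : 0 < lN N by lra.
have [lT0 _ _] : [/\ 0 < lT N, zeta * lN N - 1 <= ln (lT N) & ln (lT N) <= zeta * lN N + 1].
  by near: N; exact: (near_lnlnT logT).
have v0 : 0 < (V N)%:R :> R by rewrite ltr0n.
have hv' : `|(V N)%:R : R| <= M^-1 * `|lT N / lN N| by near: N; exact: hV.
have hv : (V N)%:R <= M^-1 * (lT N / lN N).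
  apply: le_trans (ler_norm _) (le_trans hv' _).
  by rewrite ger0_norm// divr_ge0// ltW.
rewrite ler_pdivlMr//.
have := ler_wpM2l (ltW (mulr_gt0 M0 x0)) hv.
by rewrite [leRHS](_ : _ = lT N)//; field; rewrite !gt_eqF.
Unshelve. all: by end_near. Qed.

Lemma near_spacing_share (M : R) : \forall N \near \oo, M <= h N.
Proof.
have I0 : 0 < I_ r by rewrite I_tail_rate tail_rate_gt0.
have eps0 := epsilon_gt0.
pose C := (1 + epsilon) * (I_ r)^-1 * mu0^-1.
have C0 : 0 < C by rewrite mulr_gt0 ?invr_gt0// mulr_gt0 ?invr_gt0//; lra.
near=> N.
have x : M / C <= lN N by near: N; exact: near_lnN.
have w : 1 * lN N <= lT N / (V N)%:R by near: N; exact: near_share.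
have v0 : 0 < (V N)%:R :> R by rewrite ltr0n.
have -> : h N = C * (lT N / (V N)%:R).
  by rewrite hE /C; field; rewrite !gt_eqF.
rewrite mulrC -ler_pdivrMr//; lra.
Unshelve. all: by end_near. Qed.

Lemma near_signal_share : exists2 eta : R, 0 < eta < 1 &
  forall dl0 : R, 0 < dl0 -> \forall N \near \oo, exists th gam : R,
   [/\ 0 <= th <= 1, 0 <= gam <= 1,
     signal_factor N lambda1 (lam2 T N) th r (mu0 * ((1 - eta) * h N)) gam &
     2 * expR (th * (c (T N) + lT N + N%:R * (coef_a lambda1 N +
        16 * coef_b T N ^+ 2 * ln (1 + (coef_b T N)^-1)))) * gam ^+ V N <= dl0].
Proof.
have [eta [eta0 eta1 etar etaI]] := narrowed_tail_rate r1 epsilon_gt0.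
have al0 : 0 < 1 + eta by rewrite addr_gt0.
have al1 : 1 <= 1 + eta by rewrite lerDl ltW.
have be0 : 0 < (1 - eta) * r := lt_trans al0 etar.
have ber : (1 - eta) * r <= r.
  rewrite ler_piMl ?gerBl ?(ltW eta0)//; have := r1; lra.
exists eta; first by rewrite eta0.
move=> dl0 dl00.
have eps0 := epsilon_gt0.
have r0 : 0 < r by have := r1; lra.
have I0 : 0 < I_ r by rewrite I_tail_rate tail_rate_gt0.
pose e1 := epsilon / 4; have e10 : 0 < e1 by rewrite divr_gt0.
pose C := (1 - eta) * ((1 + epsilon) * (I_ r)^-1).
have C0 : 0 < C by rewrite mulr_gt0 ?subr_gt0// mulr_gt0 ?invr_gt0//; lra.
have CI : 1 + 2 * e1 <= C * tail_rate (1 + eta) ((1 - eta) * r).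
  by rewrite /C -mulrA; apply: le_trans etaI; rewrite /e1; lra.
pose e2 := e1 / (2 * (1 + e1)); have e20 : 0 < e2 by rewrite divr_gt0//; lra.
(* The final bound is [6 expR (- e2 * l)]. *)
pose l := Num.max (ln 3) (Num.max (ln (6 / dl0)) (ln 3) / e2).
have l3 : ln 3 <= l by rewrite /l le_max lexx.
have ln3 : 0 < ln 3 :> R by rewrite ln_gt0//; lra.
have l0 : 0 < l by lra.
have le2 : Num.max (ln (6 / dl0)) (ln 3) <= e2 * l.
  by rewrite [e2 * l]mulrC -ler_pdivrMr// /l le_max lexx orbT.
have le2a : ln (6 / dl0) <= e2 * l by apply: le_trans le2; rewrite le_max lexx.
have le2b : ln 3 <= e2 * l by apply: le_trans le2; rewrite le_max lexx orbT.
clearbody l.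
have g01 : expR (- l) <= 3^-1.
  by rewrite -[leRHS]lnK ?posrE ?invr_gt0// ler_expR lnV ?posrE// lerN2.
have g3 : 0 <= 3 * expR (- l) <= 1.
  by have := expR_ge0 (- l); move: (expR (- l)) g01 => y *; apply/andP; split; lra.
have ln2 : 0 < ln 2 :> R by rewrite ln_gt0//; lra.
have gle1 : expR (- l) <= 1 by apply: le_trans g01 _; lra.
have gam_le (tt : R) : tt <= 2 ->
    expR (- l) + (tt - expR (- l)) * expR (- l) <= 3 * expR (- l).
  move=> t2; have h0 := expR_ge0 (- l).
  have : (tt - expR (- l)) * expR (- l) <= 2 * expR (- l) by rewrite ler_wpM2r//; lra.
  lra.
have far_le (L q x W : R) : 0 < q -> C * W <= L -> (C * q)^-1 * x <= W ->
    l + ln 2 <= x -> expR (- (L * q)) <= expR (- l) / 2.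
  move=> q0 hL hW hx; rewrite -[leRHS]lnK ?posrE ?divr_gt0 ?expR_gt0// ler_expR.
  rewrite ln_div ?posrE ?expR_gt0// expRK.
  have Cq : 0 < C * q by rewrite mulr_gt0.
  have : x <= W * (C * q) by rewrite -ler_pdivrMr// mulrC.
  have := ler_wpM2r (ltW q0) hL; lra.
have p1 : 0 < pois_rate (1 + eta) by apply: pois_rate_gt0; [lra|rewrite gt_eqF//; lra].
have p2 : 0 < r * pois_rate (1 - eta).
  by rewrite mulr_gt0// pois_rate_gt0//; [lra|rewrite lt_eqF//; lra].
pose d := e1 / (4 * (1 + 2 * e1)).
have d0 : 0 < d by rewrite divr_gt0//; lra.
pose K := ln lambda1 - (1 - 2 * d) * ln 2 - 4 * d + 2 * ln d + 2.
near=> N.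
have [a0 b0 ab] : [/\ 0 <= coef_a lambda1 N, 0 < coef_b T N :> R &
   coef_a lambda1 N / 2 + 2 * coef_b T N <= 2^-1].
  by near: N; exact: (near_coefs zeta01 lambda1_gt0 logT).
have x1 : 1 <= lN N by near: N; exact: near_lnN.
have xK : - K <= lN N by near: N; exact: near_lnN.
have xL : (l + ln 2) <= lN N by near: N; exact: near_lnN.
have xT : l <= lN N by near: N; exact: near_lnN.
have [lT0 _ _] : [/\ 0 < lT N, zeta * lN N - 1 <= ln (lT N) & ln (lT N) <= zeta * lN N + 1].
  by near: N; exact: (near_lnlnT logT).
have N0 : (0 < N)%N by near: N; exact: near_pos.
have W1 : 1 * lN N <= lT N / (V N)%:R by near: N; exact: near_share.
have W2 : 4 / e1 * lN N <= lT N / (V N)%:R.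
  by near: N; apply: near_share; rewrite divr_gt0.
have W3 : (C * pois_rate (1 + eta))^-1 * lN N <= lT N / (V N)%:R.
  by near: N; apply: near_share; rewrite invr_gt0 mulr_gt0.
have W4 : (C * (r * pois_rate (1 - eta)))^-1 * lN N <= lT N / (V N)%:R.
  by near: N; apply: near_share; rewrite invr_gt0 mulr_gt0.
have hc : c (T N) <= e1 / 8 * lT N.
  by near: N; apply: near_c_small => //; rewrite divr_gt0.
have hk : N%:R * (coef_a lambda1 N +
        16 * coef_b T N ^+ 2 * ln (1 + (coef_b T N)^-1)) <= e1 / 8 * lT N.
  by near: N; apply: (near_null_cost zeta01) => //; rewrite divr_gt0.
have v0 : 0 < (V N)%:R :> R by rewrite ltr0n.
set W := lT N / (V N)%:R in W1 W2 W3 W4.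
have W0 : 0 < W by rewrite divr_gt0.
have We0 : 0 < (1 + e1) * W by apply: mulr_gt0 => //; apply: addr_gt0.
have a0' : 0 < coef_a lambda1 N.
  have NR : 0 < N%:R :> R by rewrite ltr0n.
  by rewrite /coef_a divr_gt0// mulr_gt0// (lt_le_trans ltr01).
(* A score of [(1 + e1) * W] is worth the factor [expR (- l)]. *)
pose th := l / ((1 + e1) * W).
have th0 : 0 <= th by rewrite divr_ge0// ltW.
have thW : th * ((1 + e1) * W) = l by rewrite /th divfK// gt_eqF.
have th1 : th <= 1.
  rewrite /th ler_pdivrMr// mul1r; have := mulr_gt0 e10 W0.
  by move=> ?; lra.
have th01 : 0 <= th <= 1 by rewrite th0.
have /andP[t1 t2] := tilt_score1 a0' b0 ab th01.
have final := @sparse_error_bound R l e1 (c (T N)) (lT N) _ dl0 (V N) l0 e10 lT0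
  (V_gt0 N) dl00 hc hk le2b le2a.
exists th, (3 * expR (- l)); split => //.
- move=> L; rewrite [mu0 * _](_ : _ = C * W) => [hL|]; last first.
    by rewrite hE /C /W; field; rewrite !gt_eqF.
  have L0 : 0 <= L by apply: le_trans hL; rewrite ltW// mulr_gt0.
  exists (1 + eta), ((1 - eta) * r), (expR (- l)), (expR (- l)).
  split; first by split; [|exact: ltW|exact: expR_ge0|exact: le_trans t1].
  split; last first.
  + exact: gam_le.
  + move=> B k hB.
    apply: le_trans (far_bad_tail k L0 al1 be0 ber hB) _.
    rewrite mulfK ?gt_eqF// [leRHS]splitr.
    by apply: lerD; [apply: far_le p1 hL W3 xL|apply: far_le p2 hL W4 xL].
  + move=> p p01 ple.
    rewrite ler_expR mulNr lerN2 -thW; apply: ler_wpM2l => //.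
    apply: le_trans (ell_ge a0' b0 ab p01).
    have /andP[pp _] := p01.
    have hq : (1 + 2 * e1) * W - ln 2 <= - ln p.
      have := ln_le pp ple; rewrite lnM ?posrE ?expR_gt0// expRK.
      set tr := tail_rate _ _ in CI *.
      have tr0 : 0 <= tr by apply: ltW; exact: tail_rate_gt0.
      have h1 := ler_wpM2r tr0 hL; have h2 := ler_wpM2r (ltW W0) CI.
      move: h1 h2; rewrite [C * W * tr](_ : _ = C * tr * W); [|ring].
      by move=> h1 h2 h3; rewrite -lerBDl in h3; move: h1 h2 h3;
        move: (C * tr * W) (L * tr) (ln p) => y1 y2 y3 *; lra.
    have q2 : 0 < 2 - ln p by apply: subln_gt0; have /andP[] := p01.
    rewrite -[X in X - _]/(ln (coef_a lambda1 N) - ln p).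
    apply: (@score_of_small_p R e1 W (lN N) (- ln p) _ (ln lambda1) (ln d) _ (ln 2)
      e10 hq) => //.
    * exact: ln_le_lin.
    * have NR : 0 < N%:R :> R by rewrite ltr0n.
      have lx := ln_ge0 x1.
      have lp : 0 < lN N := lt_le_trans ltr01 x1.
      have lm : 0 < lambda1 * lN N by exact: mulr_gt0.
      rewrite /coef_a ln_div ?posrE// [X in _ <= X - _]lnM ?posrE//.
      by rewrite lerD2r lerDl.
Unshelve. all: by end_near. Qed.

End sparse_signal.

(** * Many sequences with a change *)

Section moderate_scores.
Context {R : realType} (N : nat) (l1 l2 : R).
Let a : R := l1 * ln N%:R / N%:R.
Let b : R := l2 / Num.sqrt (N%:R * ln N%:R).
Hypotheses (a0 : 0 <= a) (b0 : 0 < b) (ab1 : a / 2 + 2 * b <= 2^-1).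

(** At [p = 4 exp (- s)] the summand [b / sqrt p] of [like] is
    [b * exp (s / 2) / 2].  Being bounded, it lowers the inverse of [like] in
    proportion. *)
Lemma tilt_score_gap (s : R) : 4 <= expR (s / 2) -> b * expR (s / 2) <= 1 ->
  tilt_score a b 1 (4 * expR (- s)) <= tilt_score a b 1 1 - b * expR (s / 2) / 6
  /\ tilt_score a b 1 1 <= 1 + a + 2 * b.
Proof.
move=> s4 bs; set c0 := base_score a b.
have c0E : c0 = 1 - a / 2 - 2 * b by [].
set x := expR (s / 2) in s4 bs *.
have x0 : 0 < x by exact: expR_gt0.
have sq : Num.sqrt (4 * expR (- s)) = 2 / x.
  rewrite [expR (- s)](_ : _ = x^-1 ^+ 2); last first.
    by rewrite /x -expRN -expRM_natl; congr expR; field.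
  rewrite (_ : 4 = 2 ^+ 2 :> R); last by lra.
  by rewrite -exprMn sqrtr_sqr ger0_norm// divr_ge0// ltW.
have bx : 0 < b * x by rewrite mulr_gt0.
have e1 : tilt_score a b 1 (4 * expR (- s)) = (c0 + b * x / 2)^-1.
  rewrite /tilt_score /inv_score sq -/c0 subrr add0r mul1r; field.
  by rewrite !gt_eqF//; have := a0; have := ab1; lra.
have e2 : tilt_score a b 1 1 = (c0 + b)^-1.
  by rewrite /tilt_score /inv_score sqrtr1 -/c0 subrr add0r !mul1r mulr1.
rewrite e1 e2.
have h1 := a0; have h2 := b0; have h3 := ab1.
have p1 : 0 < c0 + b by lra.
have p2 : 0 < c0 + b * x / 2 by lra.
have p3 : c0 + b <= 1 by lra.
have p4 : c0 + b * x / 2 <= 3 / 2 by lra.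
split; last first.
  rewrite invf_ple ?posrE//; last by lra.
  rewrite -[leLHS]mul1r ler_pdivrMr ?c0E; last by lra.
  have := mulr_ge0 h1 h1; have := mulr_ge0 h1 (ltW h2); have := mulr_ge0 (ltW h2) (ltW h2).
  nra.
have -> : (c0 + b * x / 2)^-1 =
    (c0 + b)^-1 - (b * x / 2 - b) / ((c0 + b) * (c0 + b * x / 2)).
  by field; rewrite !gt_eqF//; lra.
rewrite lerD2l lerN2 ler_pdivlMr; last exact: mulr_gt0.
have q : (c0 + b) * (c0 + b * x / 2) <= 3 / 2.
  by rewrite -[leRHS]mul1r ler_pM// ltW.
have := ler_wpM2l (ltW bx) q.
have := ler_wpM2l (ltW h2) s4.
lra.
Qed.

(** The gain of [tilt_score_gap] is weighted by the chance [1 - dl] of counts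
    that are far apart. *)
Lemma moderate_signal (s L r al be dl gam : R) :
  4 <= expR (s / 2) -> b * expR (s / 2) <= 1 ->
  0 < al -> al <= be -> s <= L * tail_rate al be -> dl <= 1 ->
  (forall B K, r * L <= B ->
    \sum_(0 <= y1 < K) \sum_(0 <= y2 < K) pois L y1 * pois B y2 *
      (~~ ((y1%:R <= al * L) && (be * L <= y2%:R)))%:R <= dl) ->
  1 + a + 2 * b - b * expR (s / 2) / 6 * (1 - dl) <= gam ->
  exists al be g dl : R,
    [/\ 0 < al, al <= be, 0 <= g & g <= tilt_score a b 1 1] /\
    [/\ forall p, 0 < p <= 1 -> p <= 2 * expR (- (L * tail_rate al be)) ->
          expR (- 1 * ell N l1 l2 p) <= g,
        forall B K, r * L <= B ->
          \sum_(0 <= y1 < K) \sum_(0 <= y2 < K) pois L y1 * pois B y2 *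
            (~~ ((y1%:R <= al * L) && (be * L <= y2%:R)))%:R <= dl &
        g + (tilt_score a b 1 1 - g) * dl <= gam].
Proof.
move=> s4 bs al0 albe sL dl1 far hgam.
have [gap top] := tilt_score_gap s4 bs.
have ab1' : a / 2 + 2 * b < 1 by apply: le_lt_trans ab1 _; lra.
have one01 : 0 <= (1 : R) <= (1 : R) by apply/andP; split.
set g := tilt_score a b 1 (4 * expR (- s)) in gap.
have bx : 0 <= b * expR (s / 2) by rewrite mulr_ge0 ?expR_ge0// ltW.
exists al, be, g, dl; split; first split => //.
- exact: tilt_score_ge0.
- lra.
split => //.
- move=> p p01 pp; have /andP[p0 p1] := p01.
  apply: le_trans (tilt_score_ge a0 b0 ab1' one01 p0 (expR_ell a0 (ltW b0) ab1' p0)) _.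
  apply: (tilt_score_nd b0 ab1' one01 (ltW p0)); apply: le_trans pp _.
  apply: ler_pM; [lra|exact: expR_ge0|lra|by rewrite ler_expR lerN2].
- have dl0 : 0 <= 1 - dl by lra.
  have : b * expR (s / 2) / 6 * (1 - dl) <= (tilt_score a b 1 1 - g) * (1 - dl).
    by rewrite ler_wpM2r//; lra.
  lra.
Qed.

End moderate_scores.

Section moderate_arithmetic.
Context {R : realType}.

(** [V N ^ - E] is of order [N ^ (z + s)] and outweighs the cost [2 log T], of
    order [N ^ z]. *)
Lemma moderate_error_bound (x z be0 E s c t n d : R) (V : nat) :
  0 <= E * x -> 0 < d -> c + t + n <= 2 * t -> t <= 2 * expR (z * x) ->
  expR ((1 - be0) * x) / 2 <= V%:R -> 1 - be0 - E = z + s ->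
  20 <= expR (s * x) -> ln (2 / d) <= expR (z * x) ->
  2 * expR (1 * (c + t + n)) * (1 - expR (- (E * x)) / 2) ^+ V <= d.
Proof.
move=> E0 d0 ht t2 hV Es s20 hd.
set y := expR (- (E * x)) / 2.
have y0 : 0 <= y by rewrite divr_ge0 ?expR_ge0.
have y1 : y <= 1.
  have : expR (- (E * x)) <= 1 by rewrite -[leRHS]expR0 ler_expR oppr_le0.
  rewrite /y; lra.
have hy : (1 - y) ^+ V <= expR (V%:R * - y).
  rewrite expRM_natl; apply: lerXn2r; rewrite ?nnegrE ?expR_ge0 ?subr_ge0//.
  exact: expR_ge1Dx.
have hVy : expR (z * x) * expR (s * x) / 4 <= V%:R * y.
  rewrite [leLHS](_ : _ = expR ((1 - be0) * x) / 2 * y); last first.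
    have -> : expR ((1 - be0) * x) = expR (z * x) * expR (s * x) * expR (E * x).
      by rewrite -!expRD -!mulrDl -Es subrK.
    by rewrite /y expRN; field; rewrite gt_eqF ?expR_gt0.
  by rewrite ler_wpM2r.
have := ler_wpM2l (expR_ge0 (z * x)) s20.
move: (expR_ge0 (z * x)) hVy t2 hd.
move: (expR (z * x)) (expR (s * x)) => u v u0 hVy t2 hd huv.
apply: le_trans (_ : 2 * expR (2 * t - V%:R * y) <= _).
  rewrite mul1r [X in _ <= 2 * X]expRD -mulrA ler_wpM2l//; apply: ler_pM; rewrite ?expR_ge0//.
  - by apply: exprn_ge0; rewrite subr_ge0.
  - by rewrite ler_expR.
  - by have := hy; rewrite mulrN.
have : expR (2 * t - V%:R * y) <= expR (- ln (2 / d)).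
  rewrite ler_expR; lra.
rewrite expRN lnK ?posrE ?divr_gt0// invf_div => h.
by rewrite mulrC -ler_pdivlMr.
Qed.

(** The costs [a] and [2 b] are smaller than the gain [N ^ - E] by a power of
    [N]. *)
Lemma gain_factor (a b E x q D : R) :
  a <= expR (- ((E + q) * x)) -> b <= expR (- ((E + q) * x)) ->
  ln 6 <= q * x -> expR (- (E * x)) <= D ->
  1 + a + 2 * b - D <= 1 - expR (- (E * x)) / 2.
Proof.
move=> ha hb h6 hD.
have : expR (- ((E + q) * x)) <= expR (- (E * x)) / 6.
  rewrite -[leRHS]lnK ?posrE ?divr_gt0 ?expR_gt0// ler_expR.
  rewrite ln_div ?posrE ?expR_gt0// expRK; lra.
move: (expR _) (expR _) ha hb hD => u v *; lra.
Qed.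

(** With [x = log N], the gain [b * exp (s / 2)] for [s = M * x] is weighted by
    the probability of [far_bad_rate]; the powers of [L = H * x] and the
    constants fit into the slack [sl]. *)
Lemma gain_of_rate (z be0 sl E b x M H K C Hm : R) :
  E = 1 - z - be0 - sl / 2 ->
  expR (- (((1 - z) / 2 + sl / 8) * x)) <= b -> 0 < x -> 0 < H -> 0 < sl ->
  be0 - (1 - z) / 2 + sl <= M / 2 - H * K -> H <= Hm ->
  (C + 2 * ln Hm + ln 6) / 2 + ln x <= sl / 16 * x ->
  expR (- (E * x)) <= b * expR (M * x / 2) / 6 *
    expR (- (H * x * K) - C - 2 * ln (H * x)).
Proof.
move=> EE hb x0 H0 sl0 hM HHm hC.
have lH := ln_le H0 HHm.
apply: le_trans (_ : expR (- (((1 - z) / 2 + sl / 8) * x)) * expR (M * x / 2) / 6 *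
    expR (- (H * x * K) - C - 2 * ln (H * x)) <= _); last first.
  by rewrite ler_wpM2r ?expR_ge0// ler_wpM2r ?invr_ge0// ler_wpM2r ?expR_ge0.
rewrite -[6 in X in _ <= X]lnK ?posrE// -expRN -!expRD ler_expR lnM ?posrE//.
have := ler_wpM2r (ltW x0) hM; have := mulr_gt0 sl0 x0; rewrite EE.
lra.
Qed.

(** For large means the p-value is typically below [N ^ - (1 - z)], and the gain
    is of order [1] up to a small power of [N]. *)
Lemma gain_of_large_mean (z sl E b x : R) :
  expR (- (((1 - z) / 2 + sl / 8) * x)) <= b -> ln 12 <= (E - sl / 8) * x ->
  expR (- (E * x)) <= b * expR ((1 - z) * x / 2) / 6 * (1 - 2^-1).
Proof.
move=> hb h12.
apply: le_trans (_ : expR (- (((1 - z) / 2 + sl / 8) * x)) *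
  expR ((1 - z) * x / 2) / 12 <= _); last first.
  have := ler_wpM2r (expR_ge0 ((1 - z) * x / 2)) hb; lra.
rewrite -[12]lnK ?posrE// -expRN -!expRD ler_expR; lra.
Qed.

End moderate_arithmetic.

Section moderate_signal.
Context {R : realType}.
Local Notation lN N := (ln (N%:R : R)).
Variables (zeta lambda1 : R) (T : nat -> nat) (c : nat -> R).
Hypotheses (zeta01 : 0 < zeta < 1) (lambda1_gt0 : 0 < lambda1)
  (T_infty : T N @[N --> \oo] --> \oo)
  (logT : sim_to (fun N => ln (T N)%:R) (fun N => N%:R `^ zeta : R))
  (c_logT : c =o_\oo (fun t : nat => ln t%:R : R)).
Local Notation lT N := (ln ((T N)%:R : R)).
Variables (V : nat -> nat) (h : nat -> R) (epsilon r mu0 beta : R).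
Hypotheses (epsilon_gt0 : 0 < epsilon) (r1 : 1 < r) (mu0_gt0 : 0 < mu0)
  (beta_bounds : (1 - zeta) / 2 < beta < 1 - zeta)
  (V_sim : sim_to (fun N => (V N)%:R) (fun N => N%:R `^ (1 - beta) : R))
  (hE : forall N : nat,
       h N = (1 + epsilon) * rho r beta zeta * (ln N%:R / mu0)).

Lemma near_spacing_rate (M : R) : \forall N \near \oo, M <= h N.
Proof.
have rh := rho_gt0 r1 zeta01 beta_bounds.
pose C := (1 + epsilon) * rho r beta zeta / mu0.
have C0 : 0 < C by rewrite divr_gt0// mulr_gt0// addr_gt0.
near=> N.
have x : M / C <= lN N by near: N; exact: near_lnN.
have -> : h N = lN N * C by rewrite hE /C; field; rewrite gt_eqF.
by rewrite -ler_pdivrMr.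
Unshelve. all: by end_near. Qed.

Lemma near_moderate_factor (H0 sl E : R) :
  0 < H0 -> 0 < sl -> sl <= (1 - zeta - beta) / 2 -> E = 1 - zeta - beta - sl / 2 ->
  (forall H, H0 <= H -> exists al be : R,
    [/\ r^-1 <= al, al <= 1, r <= be, be <= r ^+ 2 &
      beta - (1 - zeta) / 2 + sl <=
        Num.min (H * tail_rate al be) (1 - zeta) / 2
          - H * (pois_rate al + r * pois_rate (be / r))]) ->
  \forall N \near \oo, signal_factor N lambda1 (lam2 T N) 1 r (H0 * lN N)
    (1 - expR (- (E * lN N)) / 2).
Proof.
move=> H00 sl0 sl1 EE rate.
have /andP[z0 z1] := zeta01; have /andP[b1 b2] := beta_bounds.
have r0 : 0 < r by apply: lt_trans r1.
have [eta [eta0 eta1 etar _]] := narrowed_tail_rate r1 (@ltr01 R).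
have al0 : 0 < 1 + eta by rewrite addr_gt0.
have al1 : 1 <= 1 + eta by rewrite lerDl ltW.
have be0 : 0 < (1 - eta) * r := lt_trans al0 etar.
have ber : (1 - eta) * r <= r.
  by rewrite ler_piMl ?(ltW r0)// gerBl (ltW eta0).
have p1 : 0 < pois_rate (1 + eta).
  by apply: pois_rate_gt0 => //; rewrite gt_eqF// ltrDl.
have p2 : 0 < r * pois_rate (1 - eta).
  by apply: mulr_gt0 => //; apply: pois_rate_gt0; rewrite ?subr_gt0// lt_eqF// gtrBl.
have tr0 : 0 < tail_rate (1 + eta) ((1 - eta) * r) by exact: tail_rate_gt0.
pose Hmax := Num.max ((1 - zeta) / tail_rate (1 + eta) ((1 - eta) * r))
  (Num.max (pois_rate (1 + eta))^-1 (r * pois_rate (1 - eta))^-1).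
have Hm1 : 1 - zeta <= Hmax * tail_rate (1 + eta) ((1 - eta) * r).
  by rewrite -ler_pdivrMr// /Hmax le_max lexx.
have Hm2 : 1 <= Hmax * pois_rate (1 + eta).
  by rewrite -ler_pdivrMr// div1r /Hmax !le_max lexx orbT.
have Hm3 : 1 <= Hmax * (r * pois_rate (1 - eta)).
  by rewrite -ler_pdivrMr// div1r /Hmax !le_max lexx !orbT.
have Hmax0 : 0 < Hmax by rewrite -(pmulr_lgt0 _ p1) (lt_le_trans ltr01).
clearbody Hmax.
pose C1 := 3 + ln (2 * r) + ln (2 * r ^+ 2).
have pE : E + sl / 4 < (1 - zeta) / 2 by lra.
have pE1 : E + sl / 4 < 1 by lra.
have E0 : 0 < E by lra.
have Esl : 0 < E - sl / 8 by lra.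
have m0 : 0 < beta - (1 - zeta) / 2 by lra.
have sl8 : 0 < sl / 8 by lra.
have sl16 : 0 < sl / 16 by lra.
have sl4 : 0 < sl / 4 by lra.
near=> N.
have [a0 bb0 ab] : [/\ 0 <= coef_a lambda1 N, 0 < coef_b T N :> R &
   coef_a lambda1 N / 2 + 2 * coef_b T N <= 2^-1].
  by near: N; exact: (near_coefs zeta01 lambda1_gt0 logT).
have x1 : 1 <= lN N by near: N; exact: near_lnN.
have xH : 2 * r / H0 <= lN N by near: N; exact: near_lnN.
have xm : ln 4 / (beta - (1 - zeta) / 2) <= lN N by near: N; exact: near_lnN.
have x6 : ln 6 / (sl / 4) <= lN N by near: N; exact: near_lnN.
have x4 : ln 4 <= lN N by near: N; exact: near_lnN.
have x12 : ln 12 / (E - sl / 8) <= lN N by near: N; exact: near_lnN.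
have xC : ((C1 + 2 * ln Hmax + ln 6) / 2) + ln (lN N) <= sl / 16 * lN N.
  by near: N; exact: near_lnlnN.
have ha : coef_a lambda1 N <= expR (- ((E + sl / 4) * lN N)).
  by near: N; exact: near_a_small.
have hb : coef_b T N <= expR (- ((E + sl / 4) * lN N)).
  by near: N; exact: (near_b_small zeta01 logT).
have hbl : coef_b T N <= expR (- ((1 - zeta) / 2 * lN N)).
  by near: N; exact: (near_b_le zeta01 logT).
have hbg : expR (- (((1 - zeta) / 2 + sl / 8) * lN N)) <= coef_b T N.
  by near: N; exact: (near_b_ge zeta01 logT).
have xp : 0 < lN N := lt_le_trans ltr01 x1.
have bs s : s <= (1 - zeta) * lN N -> coef_b T N * expR (s / 2) <= 1.
  move=> hs; apply: le_trans (ler_wpM2r (expR_ge0 _) hbl) _.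
  by rewrite -expRD -[leRHS]expR0 ler_expR; lra.
have s4 s : 2 * (beta - (1 - zeta) / 2) * lN N <= s -> 4 <= expR (s / 2).
  move=> hs; rewrite -[leLHS]lnK ?posrE// ler_expR.
  by move: xm; rewrite ler_pdivrMr//; lra.
rewrite ler_pdivrMr// in x6; rewrite ler_pdivrMr// in x12.
rewrite ler_pdivrMr// in xH.
move=> L hL.
have L0 : 0 < L by apply: lt_le_trans hL; exact: mulr_gt0.
(* Above [Hmax * log N] typical counts are far enough apart.  Below, [L / log N]
   is bounded, which bounds [ln L] by [ln (lN N)] up to a constant. *)
have [LH|HL] := leP L (Hmax * lN N); last first.
  have tail q : 0 < q -> 1 <= Hmax * q -> expR (- (L * q)) <= 2^-1 / 2.
    move=> q0 hq; rewrite -[leRHS]lnK ?posrE ?divr_gt0// ler_expR.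
    rewrite -invfM lnV ?posrE// lerN2 (_ : 2 * 2 = 4); last by lra.
    apply: le_trans x4 _; rewrite -[leLHS]mul1r.
    apply: le_trans (ler_wpM2r (ltW xp) hq) _.
    by rewrite mulrAC ler_wpM2r// ltW.
  apply: (@moderate_signal _ _ _ _ a0 bb0 ab ((1 - zeta) * lN N) L r (1 + eta)
    ((1 - eta) * r) 2^-1) => //.
  - by apply: s4; rewrite ler_wpM2r ?ltW//; lra.
  - exact: bs.
  - exact: ltW.
  - apply: le_trans (ler_wpM2r (ltW xp) Hm1) _.
    by rewrite mulrAC ler_wpM2r// ltW.
  - by rewrite invf_le1// ler1n.
  - move=> B K hB; apply: le_trans (far_bad_tail K (ltW L0) al1 be0 ber hB) _.
    rewrite mulfK ?gt_eqF// [leRHS]splitr.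
    by apply: lerD; [exact: tail p1 Hm2|exact: tail p2 Hm3].
  - apply: gain_factor ha hb _ _; first by rewrite mulrC.
    by apply: gain_of_large_mean hbg _; rewrite mulrC.
pose H := L / lN N.
have HL : L = H * lN N by rewrite /H divfK// gt_eqF.
have H00' : H0 <= H by rewrite /H ler_pdivlMr.
have Hm : H <= Hmax by rewrite /H ler_pdivrMr.
have Hp : 0 < H := lt_le_trans H00 H00'.
have [al [be [alr al1' rbe ber2 hrate]]] := rate H H00'.
have alp : 0 < al by apply: lt_le_trans alr; rewrite invr_gt0.
have bep : 0 < be := lt_le_trans r0 rbe.
have K0 : 0 <= H * (pois_rate al + r * pois_rate (be / r)).
  by rewrite mulr_ge0 ?(ltW Hp)// addr_ge0 ?pois_rate_ge0// mulr_ge0 ?(ltW r0)//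
    pois_rate_ge0// divr_gt0.
set M := Num.min _ _ in hrate.
have M1 : M <= 1 - zeta by rewrite /M ge_min lexx orbT.
have M2 : M <= H * tail_rate al be by rewrite /M ge_min lexx.
clearbody M.
have L2 : 2 * r <= L by apply: le_trans hL; rewrite [H0 * _]mulrC.
have hC : 3 + ln (2 * be / r) + ln (2 * be) <= C1.
  apply: lerD.
    rewrite lerD2l; apply: ln_le; first by rewrite divr_gt0// mulr_gt0.
    by rewrite ler_pdivrMr// -mulrA -expr2 ler_wpM2l.
  by apply: ln_le; rewrite ?mulr_gt0// ler_wpM2l.
apply: (@moderate_signal _ _ _ _ a0 bb0 ab (M * lN N) L r al be
  (1 - expR (- (L * (pois_rate al + r * pois_rate (be / r)))
     - (3 + ln (2 * be / r) + ln (2 * be)) - 2 * ln L))) => //.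
- by apply: s4; rewrite ler_wpM2r ?ltW//; lra.
- by apply: bs; rewrite ler_wpM2r// ltW.
- exact: le_trans al1' (le_trans (ltW r1) rbe).
- by rewrite HL mulrAC ler_wpM2r// ltW.
- move=> B K hB; apply: far_bad_rate => //.
  + apply: le_trans (ler_wpM2r (ltW L0) alr).
    by rewrite mulrC ler_pdivlMr.
  + apply: le_trans (ler_wpM2r (ltW L0) rbe).
    have L1 : 1 <= L by apply: le_trans L2; have := r1; lra.
    by rewrite -[leLHS]mulr1; apply: ler_pM => //; exact: ltW.
- apply: gain_factor ha hb _ _; first by rewrite mulrC.
  rewrite opprB addrCA subrr addr0 HL.
  apply: (gain_of_rate EE hbg xp Hp sl0 hrate Hm).
  by apply: le_trans xC; rewrite lerD2r ler_wpM2r ?invr_ge0// !lerD2r.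
Unshelve. all: by end_near. Qed.

Lemma near_signal_moderate : exists2 eta : R, 0 < eta < 1 &
  forall dl0 : R, 0 < dl0 -> \forall N \near \oo, exists th gam : R,
   [/\ 0 <= th <= 1, 0 <= gam <= 1,
     signal_factor N lambda1 (lam2 T N) th r (mu0 * ((1 - eta) * h N)) gam &
     2 * expR (th * (c (T N) + lT N + N%:R * (coef_a lambda1 N +
        16 * coef_b T N ^+ 2 * ln (1 + (coef_b T N)^-1)))) * gam ^+ V N <= dl0].
Proof.
have eps0 := epsilon_gt0.
have /andP[z0 z1] := zeta01; have /andP[b1 b2] := beta_bounds.
have rh := rho_gt0 r1 zeta01 beta_bounds.
have e1 : 0 < 1 + epsilon by rewrite addr_gt0.
(* [(1 - eta) * (1 + epsilon) = 1 + epsilon / 2]: half of the slack pays for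
   the choice of the scale. *)
pose eta := epsilon / (2 * (1 + epsilon)).
exists eta.
  apply/andP; split; first by rewrite divr_gt0// mulr_gt0.
  by rewrite /eta ltr_pdivrMr ?mulr_gt0//; lra.
move=> dl0 dl00.
have e20 : 0 < epsilon / 2 by rewrite divr_gt0.
have [sl0 sl0p rate] := rate_choice r1 zeta01 beta_bounds e20.
pose H0 := (1 + epsilon / 2) * rho r beta zeta.
have H00 : 0 < H0 by rewrite mulr_gt0// addr_gt0.
pose sl := Num.min sl0 ((1 - zeta - beta) / 2).
have slp : 0 < sl by rewrite /sl lt_min sl0p divr_gt0//; lra.
have sl1 : sl <= (1 - zeta - beta) / 2 by rewrite /sl ge_min lexx orbT.
have slle : sl <= sl0 by rewrite /sl ge_min lexx.
clearbody sl.
pose E := 1 - zeta - beta - sl / 2.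
have E0 : 0 < E by rewrite /E; lra.
have s20 : 0 < sl / 2 by rewrite divr_gt0.
have rate' H : H0 <= H -> exists al be : R,
    [/\ r^-1 <= al, al <= 1, r <= be, be <= r ^+ 2 &
      beta - (1 - zeta) / 2 + sl <=
        Num.min (H * tail_rate al be) (1 - zeta) / 2
          - H * (pois_rate al + r * pois_rate (be / r))].
  move=> HH; have [al [be [c1 c2 c3 c4 c5]]] := rate H HH.
  by exists al, be; split => //; apply: le_trans c5; rewrite lerD2l.
have factor := near_moderate_factor H00 slp sl1 (erefl E) rate'.
near=> N.
have N0 : (0 < N)%N by near: N; exact: near_pos.
have x1 : 1 <= lN N by near: N; exact: near_lnN.
have xp : 0 < lN N := lt_le_trans ltr01 x1.
have Ex : 0 <= E * lN N by rewrite mulr_ge0 ?ltW.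
exists 1, (1 - expR (- (E * lN N)) / 2); split.
- by apply/andP; split.
- have e0 := expR_ge0 (- (E * lN N)).
  have : expR (- (E * lN N)) <= 1 by rewrite -[leRHS]expR0 ler_expR oppr_le0.
  by move: (expR _) e0 => u *; apply/andP; split; lra.
- rewrite (_ : mu0 * _ = H0 * lN N); first by near: N.
  by rewrite hE /H0 /eta; field; rewrite !gt_eqF.
have /andP[_ t2] : expR (zeta * lN N) / 2 <= lT N <= 2 * expR (zeta * lN N).
  by near: N; exact: (near_lnT logT).
have [lT0 _ _] : [/\ 0 < lT N, zeta * lN N - 1 <= ln (lT N) & ln (lT N) <= zeta * lN N + 1].
  by near: N; exact: (near_lnlnT logT).
have /andP[v1 _] : (N%:R `^ (1 - beta) : R) / 2 <= (V N)%:R <= 2 * (N%:R `^ (1 - beta) : R).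
  near: N; apply: sim_to_near V_sim _.
  by near=> M; rewrite powR_nat ?expR_gt0//; near: M; exact: near_pos.
rewrite powR_nat// in v1.
have hc : c (T N) <= 2^-1 * lT N.
  by near: N; apply: near_c_small => //; rewrite invr_gt0.
have hk : N%:R * (coef_a lambda1 N +
        16 * coef_b T N ^+ 2 * ln (1 + (coef_b T N)^-1)) <= 2^-1 * lT N.
  by near: N; apply: (near_null_cost zeta01) => //; rewrite invr_gt0.
have x20 : ln 20 / (sl / 2) <= lN N by near: N; exact: near_lnN.
have xd : ln (2 / dl0) / zeta <= lN N by near: N; exact: near_lnN.
apply: (moderate_error_bound Ex dl00 _ t2 v1 (s := sl / 2)).
- by move: (N%:R * _) hk => u hk; lra.
- by rewrite /E; lra.
- by rewrite -[leLHS]lnK ?posrE// ler_expR mulrC -ler_pdivrMr.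
- rewrite ler_pdivrMr// in xd; apply: le_trans xd _; rewrite mulrC.
  by apply: le_trans (expR_ge1Dx _); rewrite lerDr.
Unshelve. all: by end_near. Qed.

End moderate_signal.

(** * Vanishing error probabilities *)

Section suprema.
Context {R : realType}.

Lemma fine_le_bound (x : \bar R) (e : R) : 0 <= e -> (x <= e%:E)%E -> fine x <= e.
Proof. by case: x => [x||] //= _; rewrite lee_fin. Qed.

Lemma sup_between (A : set R) (e : R) : 0 <= e ->
  (forall x, A x -> 0 <= x <= e) -> 0 <= sup A <= e.
Proof.
move=> e0 hA; have [->|/set0P[x Ax]] := eqVneq A set0; first by rewrite sup0 lexx.
have ub : ubound A e by move=> y /hA /andP[].
have /andP[x0 _] := hA x Ax.
apply/andP; split; last by apply: ge_sup => //; exists x.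
by apply: le_trans x0 _; apply: ub_le_sup => //; exists e.
Qed.

(** With [kap = (1 - r exp (- Delta)) / r] the last inequality is an equality. *)
Lemma window_slack (r Delta : R) : 1 < r < expR Delta -> exists kap : R,
  [/\ 0 < kap, kap < 1, r <= (1 - kap) * expR Delta
    & r * (kap + expR (- Delta)) <= 1].
Proof.
move=> /andP[r1 rD]; have r0 : 0 < r by apply: lt_trans r1.
set y := expR (- Delta); have yD : y * expR Delta = 1.
  by rewrite /y -expRD addNr expR0.
have D0 := expR_gt0 Delta; have y0 : 0 < y by exact: expR_gt0.
have ry : r * y < 1 by rewrite -yD mulrC ltr_pM2l.
exists ((1 - r * y) / r); split.
- by rewrite divr_gt0// subr_gt0.
- rewrite ltr_pdivrMr// mul1r; have := mulr_gt0 r0 y0; lra.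
- have h : (1 - r * y) / r <= 1 - r * y.
    by rewrite ler_pdivrMr//; apply: ler_peMr; rewrite ?subr_ge0 ltW.
  apply: le_trans (_ : (r * y) * expR Delta <= _); first by rewrite -mulrA yD mulr1.
  by rewrite ler_wpM2r ?(ltW D0)// lerBrDl -lerBrDr.
- by rewrite mulrDr mulrCA divff ?gt_eqF// mulr1 subrK.
Qed.

(** The bound is [4 expR (- (c - ln W))] for [W] the window sum, unless
    [W = 0]. *)
Lemma near_type_I_bound (hs ds T : nat -> nat) (c : nat -> R) (e : R) :
  T N @[N --> \oo] --> \oo -> 0 < e ->
  c t - ln (window_sum hs ds t) @[t --> \oo] --> +oo ->
  \forall N \near \oo, 4 * expR (- c (T N)) * window_sum hs ds (T N) <= e.
Proof.
move=> T_infty e0 c_infty.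
have h : \forall t \near \oo, ln (4 / e) <= c t - ln (window_sum hs ds t).
  by have /cvgryPge := c_infty; exact.
have {h} h : \forall t \near \oo, 4 * expR (- c t) * window_sum hs ds t <= e.
  near=> t.
  have ht : ln (4 / e) <= c t - ln (window_sum hs ds t) by near: t.
  have : 0 <= window_sum hs ds t :> R by exact: window_sum_ge0.
  rewrite le_eqVlt => /orP[/eqP <-|w0]; first by rewrite mulr0 ltW.
  have w : 4 / e <= expR (c t) / window_sum hs ds t.
    rewrite -[leRHS]lnK ?posrE ?divr_gt0 ?expR_gt0// ln_div ?posrE ?expR_gt0// expRK.
    by rewrite -[leLHS]lnK ?posrE ?divr_gt0// ler_expR.
  move: w; rewrite ler_pdivlMr// mulrAC ler_pdivrMr// => w.
  by rewrite mulrAC expRN ler_pdivrMr ?expR_gt0// mulrC [e * _]mulrC mulrC.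
exact: (T_infty _ h).
Unshelve. all: by end_near. Qed.

End suprema.

Theorem theorem5 (R : realType)
  (zeta epsilon Delta r mu0 lambda1 : R)
  (zeta01 : 0 < zeta < 1) (epsilon_gt0 : 0 < epsilon) (Delta_gt0 : 0 < Delta)
  (r_bounds : 1 < r < expR Delta) (mu0_gt0 : 0 < mu0)
  (lambda1_gt0 : 0 < lambda1)
  (T : nat -> nat) (T_infty : T N @[N --> \oo] --> \oo)
  (logT : sim_to (fun N => ln (T N)%:R) (fun N => N%:R `^ zeta : R))
  (* the statistical model, for each N *)
  (d : nat -> measure_display) (Omega : forall N : nat, measurableType (d N))
  (P : forall N : nat, ('I_N -> nat -> R) -> probability (Omega N) R)
  (X : forall N : nat, 'I_N -> nat -> {mfun Omega N >-> nat})
  (psi : forall N : nat, 'I_N -> nat -> nat -> nat -> {mfun Omega N >-> R})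
  (model : forall N : nat, poisson_model (T N) (P N) (X N) (psi N))
  (* the windows h_i, d_i and the critical values c_T *)
  (hs ds : nat -> nat) (c : nat -> R)
  (hs1 : (1 <= hs 1)%N)
  (hs_incr : forall i : nat, (1 <= i)%N -> (hs i < hs i.+1)%N)
  (ds1 : (1 <= ds 1)%N)
  (ds_incr : forall i : nat, (1 <= i)%N -> (ds i < ds i.+1)%N)
  (ds_le_hs : forall i : nat, (1 <= i)%N -> (ds i <= hs i)%N)
  (hs_ratio : (hs i.+1)%:R / (hs i)%:R @[i --> \oo] --> (1 : R))
  (ds_hs : (fun i : nat => (ds i)%:R : R) =o_\oo
           (fun i : nat => (hs i)%:R : R))
  (sum_logT : (fun t : nat => ln (window_sum hs ds t) : R) =o_\oo
              (fun t : nat => ln t%:R : R))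
  (c_logT : c =o_\oo (fun t : nat => ln t%:R : R))
  (c_infty : c t - ln (window_sum hs ds t) @[t --> \oo] --> +oo)
  (* V and the minimal spacing h, under condition (a) or condition (b) *)
  (V : nat -> nat) (V_gt0 : forall N : nat, (0 < V N)%N) (h : nat -> R)
  (V_h :
    ((fun N : nat => (V N)%:R : R) =o_\oo
       (fun N : nat => ln (T N)%:R / ln N%:R : R) /\
     forall N : nat,
       h N = (1 + epsilon) * (I_ r)^-1 * (ln (T N)%:R / (mu0 * (V N)%:R)))
    \/
    (exists beta : R,
      [/\ (1 - zeta) / 2 < beta < 1 - zeta,
          sim_to (fun N => (V N)%:R) (fun N => N%:R `^ (1 - beta))
        & forall N : nat,
            h N = (1 + epsilon) * rho r beta zeta * (ln N%:R / mu0)])) :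
  let lambda2 (N : nat) : R := Num.sqrt (ln (T N)%:R / ln (ln (T N)%:R)) in
  let concludes_H1 (N : nat) : set (Omega N) :=
    declares_change hs ds (T N) lambda1 (lambda2 N) (c (T N)) (psi N) in
  sup [set fine (P N mu (concludes_H1 N)) | mu in Lambda0 (T N) mu0]
  + sup [set fine (P N mu (~` concludes_H1 N))
        | mu in Lambda1 (T N) mu0 Delta (V N) (h N)]
  @[N --> \oo] --> (0 : R).
Proof.
move=> lambda2 H1.
have /andP[r1 rD] := r_bounds.
have ds_pos i : (1 <= i)%N -> (1 <= ds i)%N by exact: ds_ge1.
have [eta eta01 sig] : exists2 eta : R, 0 < eta < 1 &
  forall dl0 : R, 0 < dl0 -> \forall N \near \oo, exists th gam : R,
   [/\ 0 <= th <= 1, 0 <= gam <= 1,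
     signal_factor N lambda1 (lam2 T N) th r (mu0 * ((1 - eta) * h N)) gam &
     2 * expR (th * (c (T N) + ln (T N)%:R + N%:R * (coef_a lambda1 N +
        16 * coef_b T N ^+ 2 * ln (1 + (coef_b T N)^-1)))) * gam ^+ V N <= dl0].
  have [[V_small hE]|[beta [beta_bounds V_sim hE]]] := V_h.
    exact: (near_signal_share zeta01 lambda1_gt0 T_infty logT c_logT epsilon_gt0 r1 mu0_gt0
      V_gt0 V_small hE).
  exact: (near_signal_moderate zeta01 lambda1_gt0 T_infty logT c_logT epsilon_gt0 r1 mu0_gt0
    beta_bounds V_sim hE).
have h_infty (M : R) : \forall N \near \oo, M <= h N.
  have [[V_small hE]|[beta [beta_bounds V_sim hE]]] := V_h.
    exact: (near_spacing_share logT epsilon_gt0 r1 mu0_gt0 V_gt0 V_small hE).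
  exact: (near_spacing_rate zeta01 epsilon_gt0 r1 mu0_gt0 beta_bounds hE).
have [kap [kap0 kap1 k1 k2]] := window_slack r_bounds.
have [h0 scale] := select_scale hs1 hs_incr hs_ratio ds_hs eta01 kap0.
apply/cvgrPdist_le => e e0.
have e2 : 0 < e / 2 by rewrite divr_gt0.
near=> N.
have [a0 b0 ab] : [/\ 0 <= coef_a lambda1 N, 0 < coef_b T N :> R &
   coef_a lambda1 N / 2 + 2 * coef_b T N <= 2^-1].
  by near: N; exact: (near_coefs zeta01 lambda1_gt0 logT).
have ab' : coef_a lambda1 N / 2 + 2 * coef_b T N < 1.
  by apply: le_lt_trans ab _; rewrite invf_lt1// ltr1n.
have [th [gam [th01 gam01 sigN boundN]]] : exists th gam : R,
   [/\ 0 <= th <= 1, 0 <= gam <= 1,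
     signal_factor N lambda1 (lam2 T N) th r (mu0 * ((1 - eta) * h N)) gam &
     2 * expR (th * (c (T N) + ln (T N)%:R + N%:R * (coef_a lambda1 N +
        16 * coef_b T N ^+ 2 * ln (1 + (coef_b T N)^-1)))) * gam ^+ V N <= e / 2].
  by near: N; exact: sig.
have nullN : 4 * expR (- c (T N)) * window_sum hs ds (T N) <= e / 2.
  by near: N; exact: near_type_I_bound.
have [i [i1 hi hh dk]] : exists i, [/\ (0 < i)%N, (hs i + ds i)%:R <= h N,
    (1 - eta) * h N <= (hs i)%:R & (ds i)%:R <= kap * (hs i)%:R :> R].
  by apply: scale; near: N; exact: h_infty.
have pos (mu : 'I_N -> nat -> R) : Lambda (T N) mu0 mu ->
    forall n t, (1 <= t <= T N)%N -> 0 < mu n t.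
  by move=> Lmu n t ht; apply: lt_le_trans mu0_gt0 (Lmu n t ht).
have /andP[s1 s1'] : 0 <= sup [set fine (P N mu (H1 N)) | mu in Lambda0 (T N) mu0]
    <= e / 2.
  apply: sup_between => [|_ [mu [Lmu J0] <-]]; first exact: ltW.
  have [data rand] := model N mu (pos mu Lmu).
  apply/andP; split; first exact: fine_ge0.
  apply: fine_le_bound; first exact: ltW.
  apply: le_trans (type_I_bound _ ds_pos ds_le_hs (pos _ Lmu) data rand a0 (ltW b0) ab' J0) _.
  by rewrite lee_fin.
have /andP[s2 s2'] : 0 <= sup [set fine (P N mu (~` H1 N)) |
    mu in Lambda1 (T N) mu0 Delta (V N) (h N)] <= e / 2.
  apply: sup_between => [|_ [mu Lmu <-]]; first exact: ltW.
  have [data rand] := model N mu (pos mu Lmu.1).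
  apply/andP; split; first exact: fine_ge0.
  apply: fine_le_bound; first exact: ltW.
  apply: le_trans (type_II_bound (pos _ Lmu.1) data rand a0 b0 ab th01 _ mu0_gt0 i1
    (ds_pos _ i1) (hs_ge hs1 hs_incr i1) hi hh r1 kap1 dk k1 k2 gam01 sigN Lmu) _.
  by rewrite lee_fin.
rewrite sub0r normrN ger0_norm ?addr_ge0//.
by rewrite [leRHS]splitr lerD.
Unshelve. all: by end_near. Qed.
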